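(* Let $N>2$, let $\Omega\subset\mathbb{R}^N$ be a bounded strictly convex domain, and assume $s\in(1/2,1)$. There exist $\mu_1>0$ and $\varphi_1\in\mathcal{C}(\mathbb{R}^N)$, negative in $\Omega$, solving the Dirichlet problem $$\begin{cases}-\Lambda_1^s\varphi_1=\mu_1\varphi_1&\text{in }\Omega,\\ \varphi_1=0&\text{in }\mathbb{R}^N\setminus\Omega,\end{cases}$$ in the viscosity sense.
   Context: The operator is $\Lambda_1^s u(x)=\inf_{\theta\in\mathbb{S}^{N-1}}\int_{\mathbb{R}}\frac{u(x+\tau\theta)-u(x)}{|\tau|^{1+2s}}\,d\tau$; integrals are in the principal value sense. ''Bounded strictly convex domain'' means a bounded domain with $\mathcal{C}^2$ boundary such that all principal curvatures of $\partial\Omega$ are positive everywhere. Viscosity solutions of $-\Lambda_1^s u=f$ in $\Omega$, $u=g$ in $\mathbb{R}^N\setminus\Omega$ (here $f=\mu_1\varphi_1$, $g=0$): a bounded upper (resp. lower) semicontinuous $u:\mathbb{R}^N\to\mathbb{R}$ is a viscosity subsolution (resp. supersolution) if $u\le g$ (resp. $\ge$) in $\mathbb{R}^N\setminus\Omega$ and, whenever $\varphi$ is smooth and $x_0\in\Omega$ is a maximum (resp. minimum) point of $u-\varphi$ in some ball $B_\delta(x_0)\subseteq\Omega$, $$-\inf_{\theta\in\mathbb{S}^{N-1}}\left\{\int_{-\delta}^{\delta}\frac{\varphi(x_0+\tau\theta)-\varphi(x_0)}{|\tau|^{1+2s}}d\tau+\int_{\mathbb{R}\setminus(-\delta,\delta)}\frac{u(x_0+\tau\theta)-u(x_0)}{|\tau|^{1+2s}}d\tau\right\}\le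 f(x_0)\quad(\text{resp. }\ge).$$ A viscosity solution is a function that is both. *)

(* Defs.v *)
From HB Require Import structures.
From mathcomp Require Import all_boot all_order all_algebra.
From mathcomp Require Import all_classical all_reals all_analysis.
Import Order.TTheory GRing.Theory Num.Theory.
Import numFieldNormedType.Exports.

Set Implicit Arguments.
Unset Strict Implicit.
Unset Printing Implicit Defensive.

Local Open Scope classical_set_scope.
Local Open Scope ring_scope.

(* Points of R^N are row vectors. The library norm on
   'rV[R]_N is the sup norm: it is only used through the topology and through
   boundedness, which do not depend on the norm; spheres and balls are defined
   from the Euclidean norm below. *)

Section Euclid.
Context {R : realType} {N : nat}.
Implicit Types (x y : 'rV[R]_N) (r : R).

Definition dotv x y : R := \sum_(i < N) x 0 i * y 0 i.

Definition enorm x : R := Num.sqrt (dotv x x).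

Definition eball x r : set 'rV[R]_N := [set y | enorm (y - x) < r].

Definition esphere : set 'rV[R]_N := [set theta | enorm theta = 1].

End Euclid.

Section Smooth.
Context {R : realType}.

Definition partial n (i : 'I_n) (f : 'rV[R]_n -> R) : 'rV[R]_n -> R :=
  fun x => 'D_(delta_mx 0 i) f x.

Fixpoint Ck n (k : nat) (f : 'rV[R]_n -> R) : Prop :=
  if k is k'.+1 then
    continuous f /\
    forall i : 'I_n,
      (forall x, derivable f x (delta_mx 0 i)) /\ Ck k' (partial i f)
  else continuous f.

Definition smooth n (f : 'rV[R]_n -> R) : Prop := forall k, Ck k f.

Definition grad n (f : 'rV[R]_n -> R) (x : 'rV[R]_n) : 'rV[R]_n :=
  \row_i partial i f x.

Definition hessian n (f : 'rV[R]_n -> R) (x : 'rV[R]_n) : 'M[R]_n :=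
  \matrix_(i, j) partial j (partial i f) x.

End Smooth.

Section Domains.
Context {R : realType} {N : nat}.
Implicit Types (Om : set 'rV[R]_N) (x : 'rV[R]_N).

Definition domain Om : Prop := [/\ open Om, connected Om & Om !=set0].

Definition boundary Om : set 'rV[R]_N := closure Om `\` interior Om.

(* In the orthonormal frame of R^N made of the N.-1 rows of E and of nu, with
   origin x0, the set Om coincides near x0 with the strict epigraph
   { (x', x_N) | gamma x' < x_N } of a C^2 function gamma. *)
Definition C2_chart Om (x0 : 'rV[R]_N) (E : 'M[R]_(N.-1, N)) (nu : 'rV[R]_N)
    (gamma : 'rV[R]_(N.-1) -> R) : Prop :=
  [/\ E *m E^T = 1%:M, nu *m nu^T = 1%:M, E *m nu^T = 0, Ck 2 gamma &
      exists2 r : R, 0 < r &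
        forall x, eball x0 r x ->
          (Om x <-> gamma ((x - x0) *m E^T) < dotv (x - x0) nu)].

Definition C2_boundary Om : Prop :=
  forall x0, boundary Om x0 -> exists E nu gamma, C2_chart Om x0 E nu gamma.

(* Fundamental forms of the graph of gamma, in the parametrization
   y |-> (y, gamma y) and with respect to the unit normal
   (- grad gamma, 1) / sqrt (1 + |grad gamma|^2), which points into the
   epigraph. *)
Definition first_form n (gamma : 'rV[R]_n -> R) (y : 'rV[R]_n) : 'M[R]_n :=
  1%:M + (grad gamma y)^T *m grad gamma y.

Definition second_form n (gamma : 'rV[R]_n -> R) (y : 'rV[R]_n) : 'M[R]_n :=
  (Num.sqrt (1 + dotv (grad gamma y) (grad gamma y)))^-1 *: hessian gamma y.

Definition shape_operator n (gamma : 'rV[R]_n -> R) (y : 'rV[R]_n) : 'M[R]_n :=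
  second_form gamma y *m invmx (first_form gamma y).

(* Principal curvatures of the boundary at x0 with respect to the inner normal
   (positive for a ball). The value does not depend on the chart. *)
Definition principal_curvature Om (x0 : 'rV[R]_N) (kappa : R) : Prop :=
  exists E nu gamma,
    C2_chart Om x0 E nu gamma /\ eigenvalue (shape_operator gamma 0) kappa.

Definition bounded_strictly_convex_domain Om : Prop :=
  [/\ domain Om, bounded_set Om, C2_boundary Om &
      forall x0 kappa,
        boundary Om x0 -> principal_curvature Om x0 kappa -> 0 < kappa].

End Domains.

Section Viscosity.
Context {R : realType} {N : nat}.
Implicit Types (Om : set 'rV[R]_N) (u phi f g w : 'rV[R]_N -> R).
Implicit Types (x theta : 'rV[R]_N) (s delta : R).

Local Notation mu := (@lebesgue_measure R).

Definition incr_quot s w (x0 : 'rV[R]_N) theta (tau : R) : R :=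
  (w (x0 + tau *: theta) - w x0) / (`|tau| `^ (1 + 2 * s)).

(* Principal value at 0; the limit exists whenever w is C^2 near x0 and
   s < 1. *)
Definition pv_inner s w (x0 : 'rV[R]_N) theta delta : \bar R :=
  lim ((\int[mu]_(tau in [set tau : R | (eps <= `|tau| < delta)%R])
          (incr_quot s w x0 theta tau)%:E)%E @[eps --> 0^'+]).

Definition outer s w (x0 : 'rV[R]_N) theta delta : \bar R :=
  (\int[mu]_(tau in [set tau : R | (delta <= `|tau|)%R])
      (incr_quot s w x0 theta tau)%:E)%E.

Definition Lambda1_test s phi u (x0 : 'rV[R]_N) delta : \bar R :=
  ereal_inf [set (pv_inner s phi x0 theta delta +
                  outer s u x0 theta delta)%E | theta in esphere].

Definition usc u : Prop := lower_semicontinuous (fun x => (- u x)%:E).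
Definition lsc u : Prop := lower_semicontinuous (fun x => (u x)%:E).

Definition max_at u phi (x0 : 'rV[R]_N) delta : Prop :=
  forall y, eball x0 delta y -> u y - phi y <= u x0 - phi x0.
Definition min_at u phi (x0 : 'rV[R]_N) delta : Prop :=
  forall y, eball x0 delta y -> u x0 - phi x0 <= u y - phi y.

(* Sub/super/solutions of - Lambda_1^s u = f in Om, u = g outside Om. *)
Definition visc_subsolution s Om f g u : Prop :=
  [/\ bounded_fun u, usc u, (forall x, ~ Om x -> u x <= g x) &
      forall phi x0 delta, smooth phi -> Om x0 -> 0 < delta ->
        eball x0 delta `<=` Om -> max_at u phi x0 delta ->
        (- Lambda1_test s phi u x0 delta <= (f x0)%:E)%E].

Definition visc_supersolution s Om f g u : Prop :=
  [/\ bounded_fun u, lsc u, (forall x, ~ Om x -> g x <= u x) &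
      forall phi x0 delta, smooth phi -> Om x0 -> 0 < delta ->
        eball x0 delta `<=` Om -> min_at u phi x0 delta ->
        ((f x0)%:E <= - Lambda1_test s phi u x0 delta)%E].

Definition visc_solution s Om f g u : Prop :=
  visc_subsolution s Om f g u /\ visc_supersolution s Om f g u.

End Viscosity.

(* Main.v *)
From HB Require Import structures.
Require Import Defs.
From mathcomp Require Import all_boot all_order all_algebra.
From mathcomp Require Import all_classical all_reals all_analysis.
From mathcomp Require Import measurable_realfun ring lra.
Import Order.TTheory GRing.Theory Num.Theory.
Import numFieldNormedType.Exports.

(** Write [u] for the nonnegative function [- phi1] and [I_th u x] for the
integral of the second difference [u (x + t th) + u (x - t th) - 2 u x]
against [t^-(1+2s)] on the half line. The equation says that the supremum of
[I_th u x] over the unit directions [th] is [- mu u x]. One half of it,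
[I_th u x <= - mu u x] for each [th], is a family of conditions on lines
([SP] below, in the viscosity sense); the other half, that some direction
almost attains the bound ([SB] below), comes from minimality.

The construction is a Perron method for the first half. For [lam >= 0] let
[wclass lam K] be the set of nonnegative continuous [w] that satisfy
[I_th w x <= - (lam w x + 1)] on every line and lie below [K] times the
barriers [ballpow] of all balls of a fixed radius [rho] that contain the
domain. Strict convexity provides enough such balls: each point outside the
domain lies outside one of them ([strictly_convex_exterior_balls]), so the
elements of the class vanish there.

The assumption [1/2 < s] gives compactness. The function [t |-> |t|^(2s-1)]
has a second difference whose integral vanishes; with the halved exponent
[gam = (2s-1)/2] the integral is strictly negative ([cone_subcritical]), so
that [- K |t|^gam] is a strict subsolution on the line away from its vertex.
Hence a supersolution on lines lies above the cones
[w x - K |y - x|^gam] as soon as this holds outside the domain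
([cone_bound]); so the class is equi-Hoelder ([hol_of_SP]), closed under
infima ([SP_finf]), and has a least element ([perron]). If at some point the
supremum over directions were smaller than required, one could lower the
least element with a paraboloid ([perron_SB]).

The set of [lam] with a nonempty class contains a positive number
([SP_class_small]) and is bounded ([wclass_lam_bound]); [mu] is its supremum.
If the least element [u] for [lam] has maximum at most [m], then [2 u] belongs
to a class for [lam + 1/(2m)] ([wclass_grow]). So [m] tends to infinity as
[lam] tends to [mu], and the normalized functions [u / m] solve the problem up
to a right-hand side [1 / m]. A barrier bound that does not depend on [K]
([perron_barrier]) makes them equi-Hoelder. A uniform limit exists, both
conditions pass to it ([SP_stab], [SB_stab]), it is not zero because the
suprema are one, and it is positive by a strong maximum principle on lines.

What remains is to pass from [SP] and [SB] to the principal value integrals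
of the definition of viscosity solutions, with Taylor's formula for the test
function ([test_ge], [test_le]). *)

Set Implicit Arguments.
Unset Strict Implicit.
Unset Printing Implicit Defensive.

Local Open Scope classical_set_scope.
Local Open Scope ring_scope.

(** * Integrals against the kernel on half lines *)

Section TailIntegrals.
Context {R : realType}.
Implicit Types (a b d t : R).
Local Notation mu := (@lebesgue_measure R).

Lemma powR_cvgy0 a : a < 0 -> x `^ a @[x --> +oo] --> (0 : R).
Proof.
move=> a0; apply/cvgrPdist_le => e e0.
near=> x.
have M0 : 0 < e `^ a^-1 by exact: powR_gt0.
have x0 : 0 < x by near: x; exact: nbhs_pinfty_gt.
have Mx : e `^ a^-1 <= x by near: x; exact: nbhs_pinfty_ge.
rewrite sub0r normrN ger0_norm ?powR_ge0//.
have -> : e = (e `^ a^-1) `^ a by rewrite -powRrM mulVf ?lt_eqF// powRr1// ltW.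
rewrite -[a]opprK !(powRN _ (- a)) lef_pV2 ?posrE ?powR_gt0//.
by apply: ge0_ler_powR; rewrite ?nnegrE ?oppr_ge0 ?ltW// opprK.
Unshelve. all: by end_near. Qed.

Lemma continuous_powR a x : 0 < x -> {for x, continuous (fun y : R => y `^ a)}.
Proof.
move=> x0; apply: differentiable_continuous; apply/derivable1_diffP.
by apply: derivable_powR; rewrite in_itv/= x0.
Qed.

Lemma within_cont_powR a (A : set R) : (forall x, A x -> 0 < x) ->
  {within A, continuous (fun y : R => y `^ a)}.
Proof.
move=> A0; apply: continuous_in_subspaceT => x; rewrite inE => /A0 x0.
exact: continuous_powR.
Qed.

(** The explicit value of the tail is what makes every estimate below
computable: the kernel is a power. *)
Lemma int_powR_tail a d : a < -1 -> 0 < d ->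
  (\int[mu]_(x in `[d, +oo[) (x `^ a)%:E = (- (d `^ (a + 1)) / (a + 1))%:E)%E.
Proof.
move=> a1 d0.
have a10 : a + 1 < 0 by rewrite -(ltrD2r (-1)) addrK add0r.
rewrite (@ge0_continuous_FTC2y _ _ (fun x => x `^ (a + 1) / (a + 1)) _ 0).
- by rewrite -EFinB sub0r mulNr.
- by move=> x _; exact: powR_ge0.
- by apply: within_cont_powR => x /=; rewrite in_itv/= andbT; exact: lt_le_trans.
- rewrite -[X in _ --> X](mul0r (a + 1)^-1).
  by apply: cvgMl; exact: powR_cvgy0.
- move=> x dx; apply: derivableM => //; apply: derivable_powR.
  by rewrite in_itv/= andbT (lt_trans d0).
- apply: cvg_at_right_filter; apply: cvgMl; exact: continuous_powR.
- move=> x; rewrite in_itv/= andbT => dx.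
  have x0 : 0 < x by rewrite (lt_trans d0).
  rewrite derive1E.
  have H := is_derive1_powR (a+1) x0.
  have -> : (fun x => x `^ (a + 1) / (a + 1)) = (a + 1)^-1 *: (fun x : R => x `^ (a + 1)).
    by apply/funext => y; rewrite mulrC.
  rewrite deriveZ/=; last by case: H.
  rewrite derive_val addrK scalerA mulVf ?scale1r//; exact: ltr0_neq0.
Qed.

Lemma integrable_powR_tail a d : a < -1 -> 0 < d ->
  mu.-integrable `[d, +oo[ (EFin \o (fun x : R => x `^ a)).
Proof.
move=> a1 d0; apply/integrableP; split.
  by apply/measurable_realfun.measurable_EFinP; apply: measurable_funTS; exact: measurable_powR.
under eq_integral do rewrite /= ger0_norm ?powR_ge0//.
by rewrite int_powR_tail// ltry.
Qed.

Lemma Rint_FTC (f F : R -> R) (a b : R) : a <= b ->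
  (forall x, a < x < b -> is_derive x 1 F (f x)) ->
  {within `[a, b], continuous F} -> {within `[a, b], continuous f} ->
  (\int[mu]_(x in `[a, b]) f x = F b - F a)%R.
Proof.
rewrite le_eqVlt => /predU1P[->|ab] dF cF cf.
  by rewrite set_itv1 Rintegral_set1 subrr.
rewrite /Rintegral (continuous_FTC2 _ _ (F := F))//.
  have [? ? ?] := (continuous_within_itvP F ab).1 cF.
  by split=> [x|//|//]; rewrite in_itv/= => xab; case: (dF x xab).
move=> x; rewrite in_itv/= => xab.
by rewrite derive1E; have H := dF x xab; rewrite derive_val.
Qed.

Definition kern (s t : R) : R := (`|t| `^ (1 + 2 * s))^-1.

(** Only half lines occur: the kernel is even, so integrals of symmetric
second differences over the outside of an interval reduce to them. *)
Definition Kint (s d : R) (g : R -> R) : R :=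
  \int[mu]_(t in `[d, +oo[) (g t * kern s t).

(** Linear growth is integrable against the kernel exactly because [2 s > 1]. *)
Definition lingr (g : R -> R) : Prop :=
  measurable_fun setT g /\
  exists A, forall t, 0 <= t -> `|g t| <= A * (1 + t).

Lemma kern_ge0 s t : 0 <= kern s t.
Proof. by rewrite invr_ge0 powR_ge0. Qed.

Lemma kernE s t : 0 <= t -> kern s t = t `^ (- (1 + 2 * s)).
Proof. by move=> t0; rewrite /kern ger0_norm// powRN. Qed.

Lemma measurable_kern s : measurable_fun setT (kern s).
Proof.
rewrite (_ : kern s = (fun y : R => y `^ (- (1 + 2 * s))) \o (fun t : R => `|t|)).
  by apply: measurableT_comp; [exact: measurable_powR|exact: normr_measurable].
by apply/funext => y; rewrite /kern /= powRN.
Qed.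

Context (s : R) (hs : 1 / 2 < s).

Lemma lingr_cst c : lingr (fun=> c).
Proof.
split=> //; exists `|c| => t t0.
by rewrite mulrDr mulr1 lerDl mulr_ge0.
Qed.

Lemma lingr_affine c e : lingr (fun t => c + e * t).
Proof.
split; first by apply: measurable_funD => //; exact: measurable_funM.
exists (`|c| + `|e|) => t t0.
rewrite (le_trans (ler_normD _ _))// normrM (ger0_norm t0).
rewrite mulrDr mulr1 !mulrDl.
by have := normr_ge0 c; have := normr_ge0 e; nra.
Qed.

Lemma lingrD f g : lingr f -> lingr g -> lingr (fun t => f t + g t).
Proof.
move=> [mf [A Af]] [mg [B Bg]]; split; first exact: measurable_funD.
exists (A + B) => t t0; rewrite (le_trans (ler_normD _ _))// mulrDl.
by rewrite lerD// ?Af// ?Bg.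
Qed.

Lemma lingrZ c f : lingr f -> lingr (fun t => c * f t).
Proof.
move=> [mf [A Af]]; split; first exact: measurable_funM.
by exists (`|c| * A) => t t0; rewrite normrM -mulrA ler_wpM2l// Af.
Qed.

Lemma lingr_bounded (g : R -> R) (B : R) : measurable_fun setT g -> (forall t, `|g t| <= B) ->
  lingr g.
Proof.
move=> mg gB; split=> //; exists B => t t0; rewrite (le_trans (gB t))//.
by rewrite mulrDr mulr1 lerDl mulr_ge0// (le_trans _ (gB 0)).
Qed.

Lemma Kint_integrable g d : lingr g -> 0 < d ->
  mu.-integrable `[d, +oo[ (EFin \o (fun t => g t * kern s t)).
Proof.
move=> [mg [A Ag]] d0.
have i1 : mu.-integrable `[d, +oo[ (EFin \o (fun x : R => x `^ (- (2 * s)))).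
  by apply: integrable_powR_tail => //; have := hs; lra.
have m2 : measurable_fun `[d, +oo[ (EFin \o (fun t => g t * kern s t)).
  apply/measurable_EFinP; apply: measurable_funTS.
  by apply: measurable_funM => //; exact: measurable_kern.
have i2 : mu.-integrable `[d, +oo[
    (EFin \o (fun x : R => `|A| * (d^-1 + 1) * x `^ (- (2 * s)))).
  have := @integrableZl _ _ _ mu _ (measurable_itv _) (`|A| * (d^-1 + 1)) _ i1.
  by apply: eq_integrable.
apply: le_integrable i2 => //.
  move=> t /=; rewrite in_itv/= andbT => dt.
  have t0 : 0 < t by exact: lt_le_trans dt.
  rewrite /= lee_fin !normrM.
  rewrite (ger0_norm (kern_ge0 _ _)) (kernE _ (ltW t0)) (ger0_norm (powR_ge0 _ _)).
  rewrite [ `| `|A| |]ger0_norm//.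
  rewrite (ger0_norm (_ : 0 <= d^-1 + 1)); last by rewrite addr_ge0// invr_ge0 ltW.
  have -> : t `^ (- (1 + 2 * s)) = t^-1 * t `^ (- (2 * s)).
    by rewrite opprD powRD ?(gt_eqF t0) ?implybT// powR_inv1// ltW.
  rewrite mulrA ler_wpM2r ?powR_ge0//.
  rewrite -ler_pdivlMr ?invr_gt0// invrK.
  apply: (le_trans (Ag _ (ltW t0))).
  rewrite -mulrA; apply: (@le_trans _ _ (`|A| * (1 + t))).
    by rewrite ler_wpM2r// ?ler_norm// addr_ge0// ltW.
  rewrite ler_wpM2l// mulrDl mul1r lerD2r.
  by rewrite mulrC ler_pdivlMr// mul1r.
Qed.

Lemma Kint_le f g d : lingr f -> lingr g -> 0 < d ->
  (forall t, d <= t -> f t <= g t) -> Kint s d f <= Kint s d g.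
Proof.
move=> lf lg d0 fg; apply: le_Rintegral => //; try exact: Kint_integrable.
move=> t /=; rewrite in_itv/= andbT => dt.
by rewrite ler_wpM2r ?kern_ge0// fg.
Qed.

Lemma KintD f g d : lingr f -> lingr g -> 0 < d ->
  Kint s d (fun t => f t + g t) = Kint s d f + Kint s d g.
Proof.
move=> lf lg d0; rewrite -RintegralD//; try exact: Kint_integrable.
by apply: eq_Rintegral => t _; rewrite mulrDl.
Qed.

Lemma KintZ c g d : lingr g -> 0 < d ->
  Kint s d (fun t => c * g t) = c * Kint s d g.
Proof.
move=> lg d0; rewrite -RintegralZl//; last exact: Kint_integrable.
by apply: eq_Rintegral => t _; rewrite mulrA.
Qed.

Lemma Kint_cst c d : 0 < d ->
  Kint s d (fun=> c) = c * (d `^ (- (2 * s)) / (2 * s)).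
Proof.
move=> d0; rewrite -[c in LHS]mulr1 KintZ//; last exact: lingr_cst.
congr (_ * _); rewrite /Kint /Rintegral.
under eq_integral.
  move=> t; rewrite inE/= in_itv/= andbT => dt.
  rewrite mul1r kernE ?(le_trans (ltW d0) dt)//; over.
rewrite int_powR_tail//=; last by have := hs; lra.
rewrite (_ : - (1 + 2 * s) + 1 = - (2 * s)); last by ring.
by rewrite invrN mulrNN.
Qed.

Lemma Kint_id d : 0 < d -> Kint s d id = d `^ (1 - 2 * s) / (2 * s - 1).
Proof.
move=> d0; rewrite /Kint /Rintegral.
under eq_integral.
  move=> t; rewrite inE/= in_itv/= andbT => dt.
  have t0 : 0 < t by exact: lt_le_trans dt.
  rewrite kernE ?(le_trans (ltW d0) dt)//.
  rewrite (_ : t * _ = t `^ (- (2 * s))); last first.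
    rewrite opprD powRD ?(gt_eqF t0) ?implybT// powR_inv1 ?(ltW t0)// mulrA.
    by rewrite divff ?mul1r// (gt_eqF t0).
  over.
rewrite int_powR_tail//=; last by have := hs; lra.
rewrite (_ : - (2 * s) + 1 = 1 - 2 * s); last by ring.
rewrite (_ : 1 - 2 * s = - (2 * s - 1)) ?invrN ?mulrNN//; last by ring.
Qed.

Lemma Kint_affine c e d : 0 < d -> Kint s d (fun t => c + e * t) =
  c * (d `^ (- (2 * s)) / (2 * s)) + e * (d `^ (1 - 2 * s) / (2 * s - 1)).
Proof.
have lid : lingr id.
  by have := lingr_affine 0 1; under eq_fun do rewrite mul1r add0r.
move=> d0; rewrite KintD//; last 2 first.
  exact: lingr_cst.
  exact: lingrZ.
by rewrite KintZ// Kint_cst// Kint_id.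
Qed.

Lemma Kint_split g d r : lingr g -> 0 < d -> d <= r ->
  Kint s d g = \int[mu]_(t in `[d, r]) (g t * kern s t) + Kint s r g.
Proof.
move=> lg d0 dr.
have ig : mu.-integrable `[d, +oo[ (EFin \o (fun t => g t * kern s t)).
  exact: Kint_integrable.
have := Rintegral_itvB (x := r) ig.
rewrite !bnd_simp => /(_ dr isT) H.
rewrite /Kint -[X in _ + X]Rintegral_itv_obnd_cbnd; last first.
  apply: integrableS ig => //; apply: subset_itvr; rewrite bnd_simp//.
by rewrite -H addrC subrK.
Qed.

(** The annulus between [d] and [r] contributes at most the integral of the
parabola [2 C t^2], which has an explicit primitive since [s < 1]. *)
Lemma Kint_split_le g d r C : s < 1 -> lingr g -> 0 < d -> d <= r ->
  (forall t, d <= t <= r -> g t <= 2 * C * t ^+ 2) ->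
  Kint s d g <= Kint s r g
     + C * ((r `^ (2 - 2 * s) - d `^ (2 - 2 * s)) / (1 - s)).
Proof.
move=> s1 lg d0 dr gC; rewrite (Kint_split lg d0 dr) addrC lerD2l.
have pos t : d <= t -> 0 < t by exact: lt_le_trans.
pose F t := C / (1 - s) * t `^ (2 - 2 * s).
pose f t := 2 * C * t `^ (1 - 2 * s).
have cf : {within `[d, r], continuous f}.
  apply: continuous_in_subspaceT => x; rewrite inE/= in_itv/= => /andP[/pos x0 _].
  by apply: cvgM; [exact: cvg_cst|exact: continuous_powR].
have -> : C * ((r `^ (2 - 2 * s) - d `^ (2 - 2 * s)) / (1 - s)) = F r - F d.
  by rewrite /F; field; lra.
have <- : \int[mu]_(t in `[d, r]) f t = F r - F d.
  apply: Rint_FTC => //; last first.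
    apply: continuous_in_subspaceT => x.
    rewrite inE/= in_itv/= => /andP[/pos x0 _].
    by apply: cvgM; [exact: cvg_cst|exact: continuous_powR].
  move=> x /andP[/ltW/pos x0 _].
  have -> : f x = C / (1 - s) *: ((2 - 2 * s) * x `^ (2 - 2 * s - 1)).
    rewrite /f (_ : 2 - 2 * s - 1 = 1 - 2 * s); last by ring.
    by rewrite /GRing.scale/=; field; lra.
  have H := is_derive1_powR (2 - 2 * s) x0.
  exact: (is_deriveZ (C / (1 - s)) H).
have ig : mu.-integrable `[d, r] (EFin \o (fun t => g t * kern s t)).
  apply: integrableS (Kint_integrable lg d0) => //.
  by apply: subset_itvl; rewrite bnd_simp.
apply: le_Rintegral => //.
  by apply: continuous_compact_integrable => //; exact: segment_compact.
move=> t /=; rewrite in_itv/= => /andP[dt tr].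
have t0 := pos _ dt.
rewrite (kernE _ (ltW t0)) /f.
have -> : t `^ (1 - 2 * s) = t ^+ 2 * t `^ (- (1 + 2 * s)).
  rewrite -(powR_mulrn _ (ltW t0)) -powRD ?(gt_eqF t0) ?implybT//; congr (_ `^ _); ring.
by rewrite mulrA ler_wpM2r ?powR_ge0// gC// dt.
Qed.

Lemma Kint_split_ge g d r C : s < 1 -> lingr g -> 0 < d -> d <= r ->
  (forall t, d <= t <= r -> - (2 * C * t ^+ 2) <= g t) ->
  Kint s r g <= Kint s d g
     + C * ((r `^ (2 - 2 * s) - d `^ (2 - 2 * s)) / (1 - s)).
Proof.
move=> s1 lg d0 dr gC.
have lN := lingrZ (-1) lg.
have := @Kint_split_le _ d r C s1 lN d0 dr.
rewrite !KintZ// ?(lt_le_trans d0)// => H.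
have {}H : - 1 * Kint s d g <= - 1 * Kint s r g +
    C * ((r `^ (2 - 2 * s) - d `^ (2 - 2 * s)) / (1 - s)).
  by apply: H => t tdr; rewrite mulN1r lerNl; exact: gC.
by move: H; rewrite !mulN1r; lra.
Qed.

End TailIntegrals.

(** * Second differences of powers on the line *)

Section PowerFacts.
Context {R : realType}.
Implicit Types (a b u x y : R).
(** Concavity of the power, in its tangent form at [1]; it follows from
[1 + x <= exp x] applied to [(1 - a) ln u] and [- a ln u]. *)
Lemma powR_Bernoulli u a : 0 <= a <= 1 -> 0 <= u -> u `^ a <= 1 + a * (u - 1).
Proof.
move=> /andP[a0 a1]; rewrite le_eqVlt => /predU1P[<-|u0].
  have [->|an0] := eqVneq a 0; first by rewrite powRr0 mul0r addr0.
  by rewrite powR0//; lra.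
rewrite /powR gt_eqF//.
have H1 := expR_ge1Dx ((1 - a) * ln u).
have H2 := expR_ge1Dx (- a * ln u).
have E0 := expR_gt0 (a * ln u).
have E1 : expR (a * ln u) * expR ((1 - a) * ln u) = u.
  by rewrite -expRD -mulrDl addrC subrK mul1r lnK.
have E2 : expR (a * ln u) * expR (- a * ln u) = 1.
  by rewrite -expRD -mulrDl subrr mul0r expR0.
move: H1 H2 E0 E1 E2; set e := expR (a * ln u).
set e1 := expR _; set e2 := expR _; set l := ln u => H1 H2 E0 E1 E2.
have -> : 1 + a * (u - 1) = e * (a * e1 + (1 - a) * e2).
  transitivity (a * (e * e1) + (1 - a) * (e * e2)); last by ring.
  by rewrite E1 E2; ring.
rewrite -[leLHS]mulr1 ler_wpM2l ?(ltW E0)//; nra.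
Qed.

Lemma continuous_normpow a : 0 < a -> continuous (fun x : R => `|x| `^ a).
Proof.
move=> a0 x; have [->|x0] := eqVneq x 0.
  apply/cvgrPdist_lt => e e0; rewrite normr0 powR0 ?gt_eqF//.
  near=> y; rewrite sub0r normrN ger0_norm ?powR_ge0//.
  have -> : e = (e `^ a^-1) `^ a by rewrite -powRrM mulVf ?gt_eqF// powRr1// ltW.
  rewrite gt0_ltr_powR ?nnegrE ?powR_ge0//.
  by near: y; exact: (@nbhs0_lt R R _ (powR_gt0 _ _)).
apply: (@continuous_comp _ _ _ (fun x : R => `|x|) (fun y => y `^ a)).
  exact: norm_continuous.
by apply: continuous_powR; rewrite normr_gt0.
Unshelve. all: by end_near. Qed.

End PowerFacts.

Section ConeIntegral.
Context {R : realType} (s : R) (hs : 1 / 2 < s) (hs1 : s < 1).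
Local Notation mu := (@lebesgue_measure R).
Implicit Types (a d t : R).

Lemma continuous_normpow_comp (T : topologicalType) (f : T -> R) (c : R) : 0 < c ->
  continuous f -> continuous (fun x => `|f x| `^ c).
Proof.
move=> c0 cf t; apply: (continuous_comp (f := f) (g := fun x => `|x| `^ c)).
  exact: cf.
exact: continuous_normpow.
Qed.

Lemma le1r_powR_aff c a : 0 < c <= 1 -> 0 <= a -> a `^ c <= 1 + a.
Proof.
move=> /andP[c0 c1] a0.
by apply: (le_trans (powR_Bernoulli _ a0)); rewrite ?c1 ?ltW//; nra.
Qed.

(** The second difference at [a] of the cone with exponent [c]; the absolute
values let the lines cross the vertex. *)
Lemma continuous_cone c a : 0 < c ->
  continuous (fun t : R => `|a + t| `^ c + `|a - t| `^ c - 2 * `|a| `^ c).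
Proof.
move=> c0 t; apply: cvgB; last exact: cvg_cst.
apply: cvgD.
  apply: (@continuous_normpow_comp _ (fun x => a + x) _ c0) => u.
  by apply: cvgD; [exact: cvg_cst|exact: cvg_id].
apply: (@continuous_normpow_comp _ (fun x => a - x) _ c0) => u.
by apply: cvgB; [exact: cvg_cst|exact: cvg_id].
Qed.

Lemma lingr_cone c a : 0 < c <= 1 ->
  lingr (fun t => `|a + t| `^ c + `|a - t| `^ c - 2 * `|a| `^ c).
Proof.
move=> /andP[c0 c1]; split.
  by apply: continuous_measurable_fun; exact: continuous_cone.
exists (2 + 4 * (1 + `|a|)) => t t0.
have H1 : `|a + t| `^ c <= 1 + (`|a| + t).
  rewrite (le_trans (le1r_powR_aff _ _))// ?c0//.
  by rewrite lerD2l (le_trans (ler_normD _ _))// (ger0_norm t0).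
have H2 : `|a - t| `^ c <= 1 + (`|a| + t).
  rewrite (le_trans (le1r_powR_aff _ _))// ?c0//.
  by rewrite lerD2l (le_trans (ler_normB _ _))// (ger0_norm t0).
have H3 : `|a| `^ c <= 1 + `|a| by rewrite le1r_powR_aff ?c0.
have := powR_ge0 `|a + t| c; have := powR_ge0 `|a - t| c.
have := powR_ge0 `|a| c; have := normr_ge0 a.
move: H1 H2 H3; set x := `|a + t| `^ c; set y := `|a - t| `^ c.
set z := `|a| `^ c; set b := `|a| => *.
rewrite ler_norml; apply/andP; split; nra.
Qed.
Let q := 2 * s - 1.
Let q0 : 0 < q. Proof. by rewrite /q; have := hs; lra. Qed.
Let q1 : q < 1. Proof. by rewrite /q; have := hs1; lra. Qed.

(** The kernel times [(a + b t)^(2s-1)] has an elementary primitive, namely a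
multiple of [((a + b t) / t)^(2s)]. This is why the exponent [2s - 1] is the
critical one. *)
Lemma is_derive_quot (a b x : R) : 0 < x -> 0 < a + b * x ->
  is_derive x 1 (fun t => ((a + b * t) / t) `^ (2 * s))
    (- (2 * s * a) * ((a + b * x) `^ q * x `^ (- (1 + 2 * s)))).
Proof.
move=> x0 abx.
have dq : is_derive x 1 (fun t => (a + b * t) / t) (- (a / x ^+ 2)).
  have xn0 : x != 0 by rewrite gt_eqF.
  rewrite (_ : (fun t => _) = (fun t => a + b * t) * (fun t : R => t^-1)); last first.
    by apply/funext.
  have d1 : is_derive x 1 (fun t => a + b * t) (0 + b * 1).
    exact: (is_deriveD (is_derive_cst a x 1) (is_deriveZ b (is_derive_id x 1))).
  have d2 := is_deriveV xn0 (is_derive_id x 1).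
  apply: (is_derive_eq (is_deriveM d1 d2)).
  by rewrite /GRing.scale/=; field.
have y0 : 0 < (a + b * x) / x by rewrite divr_gt0.
have dp := is_derive1_powR (2 * s) y0.
have D := @is_derive1_comp R (fun y => y `^ (2 * s))
  (fun t => (a + b * t) / t) x _ _ dp dq.
apply: (is_derive_eq D).
rewrite -/q powRM ?invr_ge0 ?ltW// -powR_inv1 ?(ltW x0)// -powRrM mulN1r.
have -> : - (1 + 2 * s) = - q + (- 2) by rewrite /q; ring.
rewrite (@powRD _ x (- q) (- 2)) ?(gt_eqF x0) ?implybT//.
have -> : x `^ (-2) = (x ^+ 2)^-1 by rewrite -powR_invn ?ltW.
by rewrite mulrN mulNr; congr (- _); ring.
Qed.

(** Primitive of the previous lemma, with an absolute value so that it is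
continuous across the vertex of the cone. *)
Let nr (a e t : R) := `|(a + e * t) / t| `^ (2 * s).

Lemma continuous_nr (a e t : R) : 0 < t -> {for t, continuous (nr a e)}.
Proof.
move=> t0; apply: (continuous_comp (f := fun t => (a + e * t) / t)
  (g := fun x => `|x| `^ (2 * s))).
  apply: cvgM; last by apply: cvgV; [rewrite gt_eqF|exact: cvg_id].
  by apply: cvgD; [exact: cvg_cst|apply: cvgM; [exact: cvg_cst|exact: cvg_id]].
by apply: continuous_normpow; have := hs; lra.
Qed.

Lemma is_derive_nr (a e x : R) : 0 < x -> 0 < a + e * x ->
  is_derive x 1 (nr a e)
    (- (2 * s * a) * ((a + e * x) `^ q * x `^ (- (1 + 2 * s)))).
Proof.
move=> x0 abx; apply: near_eq_is_derive (is_derive_quot x0 abx).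
have cr : {for x, continuous (fun t => (a + e * t) / t)}.
  apply: cvgM; last by apply: cvgV; [rewrite gt_eqF|exact: cvg_id].
  by apply: cvgD; [exact: cvg_cst|apply: cvgM; [exact: cvg_cst|exact: cvg_id]].
have : 0 < (a + e * x) / x by rewrite divr_gt0.
move=> /(@cvgr_gt _ _ _ _ _ _ cr) H.
near=> t; rewrite /nr gtr0_norm//.
by near: t; exact: H.
Unshelve. all: by end_near. Qed.

Lemma nrN a e t : nr (- a) (- e) t = nr a e t.
Proof. by rewrite /nr mulNr -opprD mulNr normrN. Qed.

Lemma powR_2s_le u : 0 <= u -> u `^ (2 * s) <= u + q * (u * (u - 1)).
Proof.
move=> u0.
have -> : u `^ (2 * s) = u * u `^ q.
  by rewrite /q mulr_powRB1//; have := hs; lra.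
have := powR_Bernoulli (a := q) (u := u) _ u0.
rewrite (ltW q0) (ltW q1) => /(_ isT) H.
have -> : u + q * (u * (u - 1)) = u * (1 + q * (u - 1)) by ring.
exact: ler_wpM2l.
Qed.

(** For the exponent [2s - 1] the full integral vanishes. The explicit
primitives on both sides of the vertex give the integral from [d] to infinity,
and [powR_2s_le] shows that it is of the order [d^(2-2s)]. *)
Lemma cone_critical a d : 0 < a -> 0 < d <= a ->
  Kint s d (fun t => `|a + t| `^ q + `|a - t| `^ q - 2 * `|a| `^ q)
    <= q * a `^ q / (s * a ^+ 2) * d `^ (2 - 2 * s).
Proof.
move=> a0 /andP[d0 da]; set g := fun t => _.
have s0 : 0 < s by have := hs; lra.
have lg : lingr g by apply: lingr_cone; rewrite q0 ltW.
pose E (t : R) := t `^ (- (2 * s)).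
pose c := (2 * s * a)^-1.
pose F1 t := - (c * (nr a 1 t + nr a (-1) t)) + a `^ q / s * E t.
pose F2 t := - (c * (nr a 1 t - nr a (-1) t)) + a `^ q / s * E t.
have cE t : 0 < t -> {for t, continuous E} by exact: continuous_powR.
have cF1 t : 0 < t -> {for t, continuous F1}.
  move=> t0; apply: cvgD; last by apply: cvgM; [exact: cvg_cst|exact: cE].
  apply: cvgN; apply: cvgM; [exact: cvg_cst|].
  by apply: cvgD; exact: continuous_nr.
have cF2 t : 0 < t -> {for t, continuous F2}.
  move=> t0; apply: cvgD; last by apply: cvgM; [exact: cvg_cst|exact: cE].
  apply: cvgN; apply: cvgM; [exact: cvg_cst|].
  by apply: cvgB; exact: continuous_nr.
pose f t := g t * t `^ (- (1 + 2 * s)).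
have cf t : 0 < t -> {for t, continuous f}.
  by move=> t0; apply: cvgM; [exact: continuous_cone|exact: continuous_powR].
have dE t : 0 < t -> is_derive t 1 E (- (2 * s) * t `^ (- (1 + 2 * s))).
  move=> t0; apply: (is_derive_eq (is_derive1_powR _ t0)).
  by congr (_ * _ `^ _); ring.
have dF1 t : d < t < a -> is_derive t 1 F1 (f t).
  move=> /andP[dt ta]; have t0 : 0 < t by exact: lt_trans dt.
  have p1 : 0 < a + 1 * t by lra.
  have p2 : 0 < a + -1 * t by lra.
  have D := is_deriveD (is_deriveN (is_deriveZ c
    (is_deriveD (is_derive_nr t0 p1) (is_derive_nr t0 p2))))
    (is_deriveZ (a `^ q / s) (dE _ t0)).
  apply: (is_derive_eq D).
  rewrite /f /g /GRing.scale/= !gtr0_norm//; [|lra..].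
  rewrite !mul1r mulN1r.
  move: ((a + t) `^ q) ((a - t) `^ q) (a `^ q) (t `^ _) => A B C k.
  by rewrite /c; field; rewrite !gt_eqF.
have dF2 M t : a < t < M -> is_derive t 1 F2 (f t).
  move=> /andP[dt ta]; have t0 : 0 < t by exact: lt_trans dt.
  have p1 : 0 < a + 1 * t by lra.
  have p2 : 0 < - a + 1 * t by lra.
  have D2 := is_derive_nr t0 p2.
  have N : nr (- a) 1 = nr a (- 1).
    by apply/funext => x; rewrite -nrN opprK.
  rewrite N in D2.
  have D := is_deriveD (is_deriveN (is_deriveZ c
    (is_deriveB (is_derive_nr t0 p1) D2)))
    (is_deriveZ (a `^ q / s) (dE _ t0)).
  apply: (is_derive_eq D).
  rewrite /f /g /GRing.scale/= (distrC a t) !gtr0_norm//; [|lra..].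
  rewrite !mul1r (addrC (- a)).
  move: ((a + t) `^ q) ((t - a) `^ q) (a `^ q) (t `^ _) => A B C k.
  by rewrite /c; field; rewrite !gt_eqF.
have I1 : \int[mu]_(t in `[d, a]) (g t * kern s t) = F1 a - F1 d.
  rewrite -(@Rint_FTC _ f F1 d a)//.
  - apply: eq_Rintegral => t; rewrite inE/= in_itv/= => /andP[dt _].
    by rewrite kernE// (le_trans _ dt)// ltW.
  - apply: continuous_in_subspaceT => t; rewrite inE/= in_itv/= => /andP[dt _].
    by apply: cF1; exact: lt_le_trans dt.
  - apply: continuous_in_subspaceT => t; rewrite inE/= in_itv/= => /andP[dt _].
    by apply: cf; exact: lt_le_trans dt.
have I2 M : a <= M -> \int[mu]_(t in `[a, M]) (g t * kern s t) = F2 M - F2 a.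
  move=> aM; rewrite -(@Rint_FTC _ f F2 a M)//.
  - apply: eq_Rintegral => t; rewrite inE/= in_itv/= => /andP[dt _].
    by rewrite kernE// (le_trans _ dt)// ltW.
  - apply: continuous_in_subspaceT => t; rewrite inE/= in_itv/= => /andP[dt _].
    by apply: cF2; exact: lt_le_trans dt.
  - apply: continuous_in_subspaceT => t; rewrite inE/= in_itv/= => /andP[dt _].
    by apply: cf; exact: lt_le_trans dt.
have Fa : F1 a = F2 a.
  have B0 : nr a (- 1) a = 0.
    rewrite /nr mulN1r subrr mul0r normr0 powR0// gt_eqF//; lra.
  by rewrite /F1 /F2 B0 addr0 subr0.
have F2M M : 0 < M -> F2 M <= a `^ q / s * M `^ (- (2 * s)).
  move=> M0; rewrite /F2 gerDr oppr_le0 mulr_ge0//.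
    by rewrite /c invr_ge0 !mulr_ge0// ltW.
  rewrite subr_ge0 /nr ge0_ler_powR ?nnegrE ?mulr_ge0 ?(ltW s0)//.
  rewrite !normrM ler_wpM2r// mul1r mulN1r (@gtr0_norm _ (a + M)) ?addr_gt0//.
  by rewrite ler_norml; apply/andP; split; lra.
have tail M : 0 < M -> Kint s M g <= 2 * (1 + a) * (M `^ (- (2 * s)) / (2 * s))
     + 2 * (M `^ (1 - 2 * s) / (2 * s - 1)).
  move=> M0; rewrite -Kint_affine//; apply: Kint_le => //.
    exact: lingr_affine.
  move=> t Mt; have t0 : 0 < t by exact: lt_le_trans Mt.
  have H1 : `|a + t| `^ q <= 1 + (a + t).
    rewrite gtr0_norm ?addr_gt0// le1r_powR_aff ?q0 ?(ltW q1)//.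
    by rewrite addr_ge0// ltW.
  have H2 : `|a - t| `^ q <= 1 + (a + t).
    rewrite (le_trans (le1r_powR_aff _ _)) ?q0 ?(ltW q1)// lerD2l.
    by rewrite ler_norml; apply/andP; split; lra.
  have H3 := powR_ge0 `|a| q.
  rewrite /g; nra.
have ub M : a <= M -> Kint s d g <= - F1 d +
    (a `^ q / s * M `^ (- (2 * s)) +
    (2 * (1 + a) * (M `^ (- (2 * s)) / (2 * s))
     + 2 * (M `^ (1 - 2 * s) / (2 * s - 1)))).
  move=> aM; have M0 : 0 < M by exact: lt_le_trans aM.
  rewrite (Kint_split hs lg d0 da) (Kint_split hs lg a0 aM) I1 I2// Fa.
  have := F2M _ M0; have := tail _ M0; lra.
have {}ub : Kint s d g <= - F1 d.
  apply/ler_addgt0Pr => e e0.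
  pose h (M : R) := a `^ q / s * M `^ (- (2 * s)) +
    (2 * (1 + a) * (M `^ (- (2 * s)) / (2 * s))
     + 2 * (M `^ (1 - 2 * s) / (2 * s - 1))).
  have ch : h M @[M --> +oo] --> 0.
    have z1 : M `^ (- (2 * s)) @[M --> +oo] --> (0 : R).
      by apply: powR_cvgy0; have := hs; lra.
    have z2 : M `^ (1 - 2 * s) @[M --> +oo] --> (0 : R).
      by apply: powR_cvgy0; have := hs; lra.
    rewrite [X in _ --> X](_ : 0 = a `^ q / s * 0 +
      (2 * (1 + a) * (0 / (2 * s)) + 2 * (0 / (2 * s - 1)))); last by ring.
    apply: cvgD; first by apply: cvgM => //; exact: cvg_cst.
    apply: cvgD; apply: cvgM; try exact: cvg_cst; apply: cvgM => //; exact: cvg_cst.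
  move/cvgr0Pnorm_lt : ch => /(_ _ e0) ch.
  have [M [aM hM]] := filter_ex (filterI (nbhs_pinfty_ge (num_real a)) ch).
  apply: (le_trans (ub M aM)).
  rewrite lerD2l; exact: le_trans (ler_norm _) (ltW hM).
apply: (le_trans ub).
have nrd e : 0 <= a + e * d -> nr a e d =
    d `^ (- (2 * s)) * a `^ (2 * s) * (1 + e * (d / a)) `^ (2 * s).
  move=> p; rewrite /nr ger0_norm ?divr_ge0 ?(ltW d0)//.
  rewrite -mulrA -powRM ?(ltW a0)//; last first.
    by rewrite mulrA -[X in X + _](divff (lt0r_neq0 a0)) -mulrDl divr_ge0 ?(ltW a0).
  rewrite powRM ?invr_ge0 ?(ltW d0)// mulrC; congr (_ * _ `^ _).
    by rewrite -powR_inv1 ?(ltW d0)// -powRrM mulN1r.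
  by field; rewrite gt_eqF.
have p1 : 0 <= a + 1 * d by lra.
have p2 : 0 <= a + -1 * d by lra.
have x0 : 0 <= d / a by rewrite divr_ge0 ?ltW.
have x1 : d / a <= 1 by rewrite ler_pdivrMr// mul1r.
have U1 := @powR_2s_le (1 + 1 * (d / a)) _.
have U2 := @powR_2s_le (1 + - 1 * (d / a)) _.
have {}U1 := U1 ltac:(lra).
have {}U2 := U2 ltac:(lra).
rewrite /F1 !nrd// /E opprD opprK.
have -> : a `^ (2 * s) = a * a `^ q.
  by rewrite /q mulr_powRB1 ?(ltW a0)//; lra.
have -> : d `^ (2 - 2 * s) = d ^+ 2 * d `^ (- (2 * s)).
  by rewrite -powR_mulrn ?(ltW d0)// -powRD// (gt_eqF d0) implybT.
have D0 := powR_gt0 (- (2 * s)) d0.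
have A0 := powR_gt0 q a0.
move: U1 U2 D0 A0; move: (_ `^ (2 * s)) (_ `^ (2 * s)) => w1 w2.
move: (d `^ _) (a `^ _) => D A U1 U2 D0 A0.
have U : w1 + w2 <= 2 + 2 * q * (d / a) ^+ 2.
  by rewrite addrC; apply: (le_trans (lerD U1 U2)); rewrite le_eqVlt; apply/orP; left; apply/eqP; ring.
have -> : c * (D * (a * A) * w2 + D * (a * A) * w1) - A / s * D =
    D * A / (2 * s) * (w1 + w2 - 2).
  by rewrite /c; field; rewrite !gt_eqF.
have -> : q * A / (s * a ^+ 2) * (d ^+ 2 * D) =
    D * A / (2 * s) * (2 * q * (d / a) ^+ 2).
  by field; rewrite !gt_eqF.
by rewrite ler_wpM2l ?lerBlDl// divr_ge0 ?mulr_ge0 ?ltW.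
Qed.
(** With [gam = (2s-1)/2] write the critical cone as the square of the
subcritical one. Since [X^2 + Y^2 - 2 A^2] equals
[2 A (X + Y - 2 A) + (X - A)^2 + (Y - A)^2], the integral of the subcritical
second difference is [1 / (2 A)] times the difference of an integral close to
zero and a positive one. *)
Lemma cone_subcritical a : 0 < a -> exists2 c, 0 < c & exists2 d0, 0 < d0 &
  forall d, 0 < d <= d0 ->
  Kint s d (fun t => `|a + t| `^ (q / 2) + `|a - t| `^ (q / 2)
                     - 2 * `|a| `^ (q / 2)) <= - c.
Proof.
move=> a0; pose A := a `^ (q / 2); have A0 : 0 < A by exact: powR_gt0.
have h0 : 0 < q / 2 by rewrite divr_gt0.
have h1 : q / 2 <= 1 by have := q1; lra.
have s0 : 0 < s by have := hs; lra.
pose g t := `|a + t| `^ (q / 2) + `|a - t| `^ (q / 2) - 2 * `|a| `^ (q / 2).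
pose S t := `|a + t| `^ q + `|a - t| `^ q - 2 * `|a| `^ q.
pose G t := (`|a + t| `^ (q / 2) - A) ^+ 2 + (`|a - t| `^ (q / 2) - A) ^+ 2.
have sq x : `|x| `^ q = (`|x| `^ (q / 2)) ^+ 2.
  by rewrite -powR_mulrn ?powR_ge0// -powRrM divfK.
have lg : lingr g by apply: lingr_cone; rewrite h0.
have lS : lingr S by apply: lingr_cone; rewrite q0 ltW.
have GE t : G t = S t + (- (2 * A)) * g t.
  rewrite /G /S /g !sq (gtr0_norm a0) -/A; ring.
have lG : lingr G.
  have := lingrD lS (lingrZ (- (2 * A)) lg).
  by rewrite (_ : (fun t => _) = G)//; apply/funext => t; rewrite GE.
have KG d : 0 < d -> Kint s d G = Kint s d S - 2 * A * Kint s d g.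
  move=> d0; rewrite -mulNr -KintZ// -KintD//.
    by congr Kint; apply/funext => t; rewrite GE.
  exact: lingrZ.
pose m := ((2 * a) `^ (q / 2) - A) ^+ 2.
have m0 : 0 < m.
  rewrite exprn_even_gt0//= subr_eq0 gt_eqF// gt0_ltr_powR ?nnegrE//.
  - by rewrite ltW.
  - by rewrite mulr_ge0 ?(ltW a0).
  - by rewrite mulrC ltr_pMr// ltr1n.
pose c1 := m * (a `^ (- (2 * s)) / (2 * s)).
have c10 : 0 < c1 by rewrite mulr_gt0// divr_gt0 ?powR_gt0// mulr_gt0.
have KGa : c1 <= Kint s a G.
  rewrite /c1 -Kint_cst//; apply: Kint_le => //; first exact: lingr_cst.
  move=> t at_; rewrite /G -[leLHS]addr0 lerD ?sqr_ge0//.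
  have le1 : A <= (2 * a) `^ (q / 2).
    rewrite /A ge0_ler_powR ?nnegrE ?(ltW h0) ?(ltW a0) ?mulr_ge0 ?(ltW a0)//.
    by rewrite mulrC ler_pMr// ler1n.
  rewrite /m ler_sqr ?nnegrE ?subr_ge0// ?lerD2r.
    rewrite ge0_ler_powR ?nnegrE ?(ltW h0) ?mulr_ge0 ?(ltW a0)//.
    by rewrite ger0_norm; lra.
  apply: (le_trans le1).
  rewrite ge0_ler_powR ?nnegrE ?(ltW h0) ?mulr_ge0 ?(ltW a0)//.
  by rewrite ger0_norm; lra.
have KGd d : 0 < d <= a -> c1 <= Kint s d G.
  move=> /andP[d0 da]; apply: (le_trans KGa).
  have := @Kint_split_ge _ _ hs G d a 0 hs1 lG d0 da.
  rewrite mul0r addr0; apply.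
  by move=> t _; rewrite mulr0 mul0r oppr0 addr_ge0// sqr_ge0.
pose B := q * a `^ q / (s * a ^+ 2).
have B0 : 0 < B by rewrite divr_gt0 ?mulr_gt0 ?exprn_gt0 ?powR_gt0.
have p0 : 0 < 2 - 2 * s by have := hs1; lra.
pose d1 := (c1 / 2 / B) `^ (2 - 2 * s)^-1.
have d10 : 0 < d1 by apply: powR_gt0; rewrite divr_gt0// divr_gt0.
have c20 : 0 < c1 / 2 by exact: divr_gt0.
have A20 : 0 < 2 * A by exact: mulr_gt0.
exists (c1 / 2 / (2 * A)); first exact: divr_gt0.
exists (Num.min d1 a); first by rewrite lt_min d10.
move=> d /andP[d0]; rewrite le_min => /andP[dd1 da].
have H1 := @cone_critical a d a0.
rewrite d0 da in H1; have {}H1 := H1 isT.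
have H2 : B * d `^ (2 - 2 * s) <= c1 / 2.
  rewrite mulrC -ler_pdivlMr//.
  rewrite (_ : c1 / 2 / B = d1 `^ (2 - 2 * s)).
    by rewrite ge0_ler_powR ?nnegrE ?(ltW p0) ?(ltW d0) ?(ltW d10).
  rewrite /d1 -powRrM mulVf ?(gt_eqF p0)// powRr1//.
  by apply: ltW; exact: divr_gt0.
have H3 := KGd d; rewrite d0 da in H3; have {}H3 := H3 isT.
rewrite KG// in H3.
have H4 : Kint s d S <= c1 / 2 by apply: le_trans H2.
rewrite lerNr ler_pdivrMr//; rewrite -/g.
move: H3 H4; move: (Kint s d g) (Kint s d S) => *; lra.
Qed.

End ConeIntegral.

(** * Euclidean geometry of row vectors *)

Section EuclidFacts.
Context {R : realType} {N : nat}.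
Implicit Types (x y z : 'rV[R]_N) (a : R).

Lemma dotvC x y : dotv x y = dotv y x.
Proof. by apply: eq_bigr => i _; rewrite mulrC. Qed.

Lemma dotvDl x y z : dotv (x + y) z = dotv x z + dotv y z.
Proof. by rewrite -big_split; apply: eq_bigr => i _; rewrite !mxE mulrDl. Qed.

Lemma dotvZl a x z : dotv (a *: x) z = a * dotv x z.
Proof. by rewrite mulr_sumr; apply: eq_bigr => i _; rewrite !mxE mulrA. Qed.

Lemma dotvDr x y z : dotv z (x + y) = dotv z x + dotv z y.
Proof. by rewrite !(dotvC z) dotvDl. Qed.

Lemma dotvZr a x z : dotv z (a *: x) = a * dotv z x.
Proof. by rewrite !(dotvC z) dotvZl. Qed.

Lemma dotvNl x z : dotv (- x) z = - dotv x z.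
Proof. by rewrite -scaleN1r dotvZl mulN1r. Qed.

Lemma dotvNr x z : dotv z (- x) = - dotv z x.
Proof. by rewrite !(dotvC z) dotvNl. Qed.

Lemma dotv_ge0 x : 0 <= dotv x x.
Proof. by apply: sumr_ge0 => i _; rewrite -expr2 sqr_ge0. Qed.

Lemma enorm_ge0 x : 0 <= enorm x.
Proof. exact: sqrtr_ge0. Qed.

Lemma enorm_sqr x : enorm x ^+ 2 = dotv x x.
Proof. by rewrite sqr_sqrtr// dotv_ge0. Qed.

Lemma enorm0 : enorm (0 : 'rV[R]_N) = 0.
Proof.
rewrite /enorm /dotv big1 ?sqrtr0// => i _; by rewrite mxE mul0r.
Qed.

Lemma coord_le_enorm x i : `|x 0 i| <= enorm x.
Proof.
rewrite -sqrtr_sqr ler_sqrt ?dotv_ge0//.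
rewrite /dotv (bigD1 i)//= expr2 lerDl sumr_ge0// => j _.
by rewrite -expr2 sqr_ge0.
Qed.

Lemma enorm_eq0 x : enorm x = 0 -> x = 0.
Proof.
move=> x0; apply/rowP => i; rewrite mxE; apply/eqP.
by rewrite -normr_le0 -x0 coord_le_enorm.
Qed.

Lemma enormZ a x : enorm (a *: x) = `|a| * enorm x.
Proof.
by rewrite /enorm dotvZl dotvZr mulrA -expr2 sqrtrM ?sqr_ge0// sqrtr_sqr.
Qed.

Lemma enormN x : enorm (- x) = enorm x.
Proof. by rewrite -scaleN1r enormZ normrN1 mul1r. Qed.

Lemma enormBC x y : enorm (x - y) = enorm (y - x).
Proof. by rewrite -enormN opprB. Qed.

(** The squared norm of the component of [y] orthogonal to [x], scaled by
[enorm x], is nonnegative. *)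
Lemma CauchySchwarz_dotv x y : dotv x y <= enorm x * enorm y.
Proof.
have [->|x0] := eqVneq x 0.
  by rewrite -[0 in leLHS](scale0r (0 : 'rV[R]_N)) dotvZl mul0r mulr_ge0 ?enorm_ge0.
have ex : 0 < enorm x.
  by rewrite lt_neqAle enorm_ge0 andbT eq_sym; apply: contraNN x0 => /eqP/enorm_eq0 ->.
have E a c : dotv (a *: y - c *: x) (a *: y - c *: x) =
    a ^+ 2 * dotv y y - 2 * a * c * dotv x y + c ^+ 2 * dotv x x.
  rewrite !(dotvDl, dotvDr, dotvNl, dotvNr, dotvZl, dotvZr) (dotvC y x).
  by ring.
have := dotv_ge0 (enorm x *: y - (dotv x y / enorm x) *: x).
rewrite E -!enorm_sqr; set d := dotv x y; set a := enorm x; set b := enorm y.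
have -> : a ^+ 2 * b ^+ 2 - 2 * a * (d / a) * d + (d / a) ^+ 2 * a ^+ 2 =
  (a * b) ^+ 2 - d ^+ 2 by field; rewrite gt_eqF.
rewrite subr_ge0 => H; rewrite (le_trans (ler_norm _))//.
by rewrite -(@ler_pXn2r _ 2)// ?nnegrE ?mulr_ge0 ?enorm_ge0// real_normK// num_real.
Qed.

Lemma enormD x y : enorm (x + y) <= enorm x + enorm y.
Proof.
rewrite -(@ler_pXn2r _ 2)// ?nnegrE ?addr_ge0 ?enorm_ge0//.
rewrite enorm_sqr !(dotvDl, dotvDr) (dotvC y x) -!enorm_sqr.
have := CauchySchwarz_dotv x y; nra.
Qed.

Lemma continuous_dotv (T : topologicalType) (f g : T -> 'rV[R]_N) :
  continuous f -> continuous g -> continuous (fun t => dotv (f t) (g t)).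
Proof.
move=> cf cg t.
rewrite /dotv.
have : forall r : seq 'I_N, {for t, continuous
    (fun t => \sum_(i <- r) f t 0 i * g t 0 i)}.
  elim=> [|i r IH].
    under [X in {for _, continuous X}]eq_fun do rewrite big_nil.
    exact: cvg_cst.
  under [X in {for _, continuous X}]eq_fun do rewrite big_cons.
  apply: cvgD => //; apply: cvgM.
    exact: (continuous_comp (cf t) (@coord_continuous _ _ _ 0 i _)).
  exact: (continuous_comp (cg t) (@coord_continuous _ _ _ 0 i _)).
exact.
Qed.

Lemma continuous_enorm (T : topologicalType) (f : T -> 'rV[R]_N) :
  continuous f -> continuous (fun t => enorm (f t)).
Proof.
move=> cf t.
apply: (@continuous_comp _ _ _ (fun t => dotv (f t) (f t)) (@Num.sqrt R)).
  exact: continuous_dotv.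
exact: sqrt_continuous.
Qed.

Lemma nbhs_enorm_lt x (e : R) : 0 < e -> \forall y \near x, enorm (y - x) < e.
Proof.
move=> e0.
have c : continuous (fun y => enorm (y - x)).
  apply: continuous_enorm => t.
  exact: (@cvgD R _ _ (nbhs t) _ (fun y : 'rV[R]_N => y) (fun=> - x) t (- x)
    cvg_id (cvg_cst _)).
have := c x; rewrite /continuous_at subrr enorm0 => /cvgr_lt/(_ _ e0).
exact.
Qed.

Lemma norm_le_enorm x : `|x| <= enorm x.
Proof.
rewrite /Num.norm/= mx_normrE; apply/bigmax_leP; split => //.
  exact: enorm_ge0.
by move=> [i j] _ /=; rewrite ord1 coord_le_enorm.
Qed.

Lemma nbhs_enormP x (A : set 'rV[R]_N) : nbhs x A <->
  exists2 e, 0 < e & forall y, enorm (y - x) < e -> A y.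
Proof.
split=> [/nbhs_ballP[e /= e0 H]|[e e0 H]].
  exists e => // y ye; apply: H; rewrite -ball_normE /= distrC.
  by rewrite (le_lt_trans (norm_le_enorm _)).
by apply: filterS (nbhs_enorm_lt x e0) => y; exact: H.
Qed.

Lemma unit_dir x y : x != y ->
  exists theta, esphere theta /\ y = x + enorm (y - x) *: theta.
Proof.
move=> xy; have e0 : 0 < enorm (y - x).
  rewrite lt_neqAle enorm_ge0 andbT eq_sym; apply: contraNN xy => /eqP/enorm_eq0.
  by move/subr0_eq => ->.
exists ((enorm (y - x))^-1 *: (y - x)); split.
  by rewrite /esphere/= enormZ ger0_norm ?invr_ge0 ?enorm_ge0// mulVf// gt_eqF.
by rewrite scalerA divff ?gt_eqF// scale1r addrC subrK.
Qed.

Lemma enorm_line x th a : esphere th -> enorm (a *: th : 'rV[R]_N) = `|a|.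
Proof. by rewrite enormZ => ->; rewrite mulr1. Qed.

Lemma continuous_line x th : continuous (fun t : R => x + t *: th).
Proof.
move=> t; apply: cvgD; first exact: cvg_cst.
by apply: cvgZl; exact: cvg_id.
Qed.

End EuclidFacts.

(** * Supersolutions along lines and the cone estimate *)

Section LineSupersolutions.
Context {R : realType} {N : nat} (s : R) (hs : 1 / 2 < s) (hs1 : s < 1).
Implicit Types (w : 'rV[R]_N -> R) (x th : 'rV[R]_N) (d r t : R).

Definition bdcont w := continuous w /\ exists B, forall x, `|w x| <= B.

Definition secdiff w x th t : R := w (x + t *: th) + w (x - t *: th) - 2 * w x.

Definition Out w x th d : R := Kint s d (secdiff w x th).

(** The integral of [w] along the line through [x] in direction [th] is at
most [- F], tested with parabolas that touch [w] from below. The last term is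
the contribution of the parabola on the interval of length [2 d], moved to the
right-hand side; so only integrals of [w] away from the singularity occur. *)
Definition SP w x th (F : R) : Prop := forall p C r, 0 < r ->
  (forall t, `|t| <= r -> w x + p * t - C * t ^+ 2 <= w (x + t *: th)) ->
  forall d, 0 < d < r -> Out w x th d <= - F + C * (d `^ (2 - 2 * s) / (1 - s)).

Lemma continuous_secdiff w x th : continuous w -> continuous (secdiff w x th).
Proof.
move=> cw t; apply: cvgB; last exact: cvg_cst.
apply: cvgD.
  by apply: (continuous_comp (f := fun t => x + t *: th)); [exact: continuous_line|exact: cw].
apply: (continuous_comp (f := fun t => x - t *: th)); last exact: cw.
apply: cvgB; first exact: cvg_cst.
by apply: cvgZl; exact: cvg_id.
Qed.

Lemma lingr_secdiff w x th : bdcont w -> lingr (secdiff w x th).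
Proof.
move=> [cw [B wB]]; apply: (@lingr_bounded _ _ (4 * B)).
  by apply: continuous_measurable_fun; exact: continuous_secdiff.
move=> t; rewrite /secdiff; move: (wB (x + t *: th)) (wB (x - t *: th)) (wB x).
by rewrite !ler_norml => /andP[? ?] /andP[? ?] /andP[? ?]; apply/andP; split; lra.
Qed.
Lemma powR_small (c e p : R) : 0 < p -> 0 < e -> exists2 d0, 0 < d0 &
  forall d, 0 < d < d0 -> c * d `^ p <= e.
Proof.
move=> p0 e0; pose b := e / (`|c| + 1).
have c1 : 0 < `|c| + 1 by rewrite ltr_wpDl.
have b0 : 0 < b by exact: divr_gt0.
exists (b `^ p^-1); first exact: powR_gt0.
move=> d /andP[d0 db].
have H : d `^ p <= b.
  rewrite (_ : b = (b `^ p^-1) `^ p); last first.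
    by rewrite -powRrM mulVf ?(gt_eqF p0)// powRr1// ltW.
  by rewrite ge0_ler_powR ?nnegrE ?(ltW p0) ?(ltW d0) ?powR_ge0// ltW.
rewrite (le_trans (ler_norm _))// normrM (ger0_norm (powR_ge0 _ _)).
apply: (@le_trans _ _ (`|c| * b)); first exact: ler_wpM2l.
by rewrite /b mulrA ler_pdivrMr// mulrDr mulr1 mulrC lerDl ltW.
Qed.

(** By [Kint_split_ge] the bound improves as [d] decreases, so arbitrarily
small [d] are enough. This is how [SP] is shown for functions whose
integral is estimated directly. *)
Lemma SP_intro w x th F : bdcont w ->
  (forall p C r, 0 < r ->
    (forall t, `|t| <= r -> w x + p * t - C * t ^+ 2 <= w (x + t *: th)) ->
    forall e d0, 0 < e -> 0 < d0 ->
    exists2 d, 0 < d < d0 & Out w x th d <= - F + e) ->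
  SP w x th F.
Proof.
move=> bw H p C r r0 touch d /andP[d0 dr]; apply/ler_addgt0Pr => e e0.
have s1 : 0 < 1 - s by rewrite subr_gt0.
have p0 : 0 < 2 - 2 * s by have := hs1; lra.
have e20 : 0 < e / 2 by exact: divr_gt0.
have [d1 d10 d1P] := @powR_small (- C / (1 - s)) (e / 2) _ p0 e20.
have md : 0 < Num.min d1 d by rewrite lt_min d10.
have [d' /andP[d'0]] := H p C r r0 touch _ _ e20 md.
rewrite lt_min => /andP[d'd1 d'd] OutF.
have := @Kint_split_ge _ _ hs (secdiff w x th) d' d C hs1
  (lingr_secdiff x th bw) d'0 (ltW d'd).
have d'P := d1P d'; rewrite d'0 d'd1 in d'P; have {}d'P := d'P isT.
move=> K; have {}K : Out w x th d <= Out w x th d' + C *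
   ((d `^ (2 - 2 * s) - d' `^ (2 - 2 * s)) / (1 - s)).
  apply: K => t /andP[d't td].
  have t0 : 0 < t by exact: lt_le_trans d't.
  have T1 := touch t; have T2 := touch (- t).
  rewrite normrN ger0_norm ?(ltW t0)// in T1 T2.
  have tr : t <= r by rewrite (le_trans td)// ltW.
  have {}T1 := T1 tr; have {}T2 := T2 tr.
  rewrite scaleNr sqrrN in T2.
  by rewrite /secdiff; nra.
have E : C * ((d `^ (2 - 2 * s) - d' `^ (2 - 2 * s)) / (1 - s)) =
  C * (d `^ (2 - 2 * s) / (1 - s)) + (- C / (1 - s)) * d' `^ (2 - 2 * s).
  by field; rewrite gt_eqF.
by rewrite E in K; lra.
Qed.

Lemma SP_leF w x th F F' : F' <= F -> SP w x th F -> SP w x th F'.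
Proof.
move=> FF H p C r r0 t d dr; apply: (le_trans (H p C r r0 t d dr)).
by rewrite lerD2r lerN2.
Qed.

Lemma SP_scale w x th F (c : R) : bdcont w -> 0 < c -> SP w x th F ->
  SP (fun y => c * w y) x th (c * F).
Proof.
move=> bw c0 H p C r r0 touch d /andP[d0 dr].
have := H (p / c) (C / c) r r0 _ d.
rewrite d0 dr => /(_ _ isT) K.
have -> : Out (fun y => c * w y) x th d = c * Out w x th d.
  rewrite /Out -KintZ//; last exact: lingr_secdiff.
  by congr Kint; apply/funext => t; rewrite /secdiff; ring.
have -> : - (c * F) + C * (d `^ (2 - 2 * s) / (1 - s)) =
    c * (- F + C / c * (d `^ (2 - 2 * s) / (1 - s))).
  have sn : 1 - s != 0 by rewrite gt_eqF// subr_gt0.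
  by field; rewrite ?sn (gt_eqF c0).
rewrite ler_pM2l//; apply: K => t /touch T.
rewrite -(ler_pM2l c0); apply: le_trans T.
by rewrite le_eqVlt; apply/orP; left; apply/eqP; field; rewrite gt_eqF.
Qed.
Lemma Out_le w w' x x' th th' d e : bdcont w -> bdcont w' -> 0 < d ->
  (forall t, secdiff w x th t <= secdiff w' x' th' t + e) ->
  Out w x th d <= Out w' x' th' d + e * (d `^ (- (2 * s)) / (2 * s)).
Proof.
move=> bw bw' d0 H.
have l1 := lingr_secdiff x th bw; have l2 := lingr_secdiff x' th' bw'.
have l3 : lingr (fun=> e) by exact: lingr_cst.
rewrite /Out -Kint_cst// -KintD//; apply: Kint_le => //.
exact: lingrD.
Qed.

Let gam := (2 * s - 1) / 2.
(** Otherwise [w x - K |t|^gam - w] has a positive maximum on the line, at a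
point of the domain different from [x]. There the cone, shifted by a constant,
touches [w] from below; it is smooth there, so the supersolution inequality
applies, and the comparison of the integrals contradicts [cone_subcritical]. *)
Lemma cone_bound (Om : set 'rV[R]_N) w x th (K T : R) :
  bdcont w -> (forall y, 0 <= w y) -> (forall y, ~ Om y -> w y = 0) ->
  (forall y, Om y -> SP w y th 0) -> 0 < K ->
  (forall t, ~ Om (x + t *: th) -> w x <= K * `|t| `^ gam) ->
  (forall t, T < `|t| -> ~ Om (x + t *: th)) ->
  forall t, w x - K * `|t| `^ gam <= w (x + t *: th).
Proof.
move=> bw w0 wOm wSP K0 bK bT t0.
have q0 : 0 < 2 * s - 1 by have := hs; lra.
have g0 : 0 < gam by exact: divr_gt0.
have g1 : gam < 1 by rewrite /gam; have := hs1; lra.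
rewrite leNgt; apply/negP => neg.
pose g t := w (x + t *: th) - w x + K * `|t| `^ gam.
have cg : continuous g.
  move=> t; apply: cvgD.
    apply: cvgB; last exact: cvg_cst.
    by apply: (continuous_comp (f := fun t => x + t *: th)); [exact: continuous_line|exact: bw.1].
  by apply: cvgM; [exact: cvg_cst|exact: continuous_normpow].
have gout t : ~ Om (x + t *: th) -> 0 <= g t.
  by move=> nO; rewrite /g (wOm _ nO); have := bK _ nO; lra.
have gt0 : g t0 < 0 by rewrite /g; lra.
pose M := `|T| + `|t0|.
have t0M : - M <= t0 <= M by rewrite -ler_norml lerDr.
have MM : - M <= M by rewrite /M; have := normr_ge0 T; have := normr_ge0 t0; lra.
have [a aM amin] := @EVT_min _ g _ _ MM (continuous_subspaceT cg).
have amin' t : g a <= g t.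
  have [tM|tM] := leP `|t| M; first by apply: amin; rewrite in_itv/= -ler_norml.
  apply: (@le_trans _ _ 0).
    by rewrite (le_trans (amin t0 _)) ?(ltW gt0)// in_itv.
  apply: gout; apply: bT; apply: le_lt_trans tM.
  by rewrite (le_trans (ler_norm T))// lerDl.
have ga : g a < 0 by exact: le_lt_trans gt0.
have Oa : Om (x + a *: th).
  by apply/not_notP => /gout; rewrite leNgt ga.
have an0 : a != 0.
  apply: contraTneq ga => ->.
  by rewrite /g scale0r addr0 subrr add0r normr0 powR0 ?gt_eqF// mulr0 ltxx.
have na0 : 0 < `|a| by rewrite normr_gt0.
set y := x + a *: th in Oa *.
have low t : w y + K * (`|a| `^ gam - `|a + t| `^ gam) <= w (y + t *: th).
  have := amin' (a + t); rewrite /g scalerDl addrA -/y; lra.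
have [c c0 [d0 d00 H]] := cone_subcritical hs hs1 na0.
pose d := Num.min d0 (`|a| / 2).
have d0' : 0 < d by rewrite lt_min d00 divr_gt0.
have dd0 : 0 < d <= d0 by rewrite d0' ge_min lexx.
have da : d < `|a|.
  by rewrite gt_min; apply/orP; right; rewrite ltr_pdivrMr// ltr_pMr// ltr1n.
have {H} := H d dd0; rewrite -/gam => H.
have up : Out w y th d <= 0.
  have := wSP y Oa (- (K * `|a| `^ gam * gam / a)) 0 `|a| na0 _ d.
  rewrite d0' da mul0r oppr0 addr0 => /(_ _ isT); apply.
  move=> t ta; rewrite mul0r subr0; apply: le_trans (low t).
  suff key : `|a + t| `^ gam <= `|a| `^ gam + `|a| `^ gam * (gam / a) * t.
    by have := ler_wpM2l (ltW K0) key; lra.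
  have u0 : 0 <= 1 + t / a.
    have : `|t / a| <= 1 by rewrite normrM normfV ler_pdivrMr// mul1r.
    by rewrite ler_norml => /andP[? _]; lra.
  have := powR_Bernoulli (a := gam) (u := 1 + t / a) _ u0.
  rewrite (ltW g0) (ltW g1) => /(_ isT) B.
  have -> : `|a + t| = `|a| * (1 + t / a).
    by rewrite -[in RHS](ger0_norm u0) -normrM mulrDr mulr1 mulrCA divff// mulr1.
  rewrite powRM//; have A0 := powR_gt0 gam na0.
  have -> : `|a| `^ gam + `|a| `^ gam * (gam / a) * t =
    `|a| `^ gam * (1 + gam * (1 + t / a - 1)) by ring.
  by rewrite ler_wpM2l ?(ltW A0).
have : K * c <= Out w y th d.
  rewrite -[leRHS]opprK lerNr -mulrN.
  have lc : lingr (fun t => `| `|a| + t| `^ gam + `| `|a| - t| `^ gam -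
      2 * `| `|a| | `^ gam).
    by apply: lingr_cone; rewrite g0 ltW.
  apply: (@le_trans _ _ (K * (Kint s d (fun t => `| `|a| + t| `^ gam +
      `| `|a| - t| `^ gam - 2 * `| `|a| | `^ gam)))); last by rewrite ler_pM2l.
  rewrite -KintZ// -[leLHS]mulN1r -KintZ//; last exact: lingr_secdiff.
  apply: Kint_le => //; [exact/lingrZ/lingr_secdiff|exact: lingrZ|].
  move=> t _; rewrite normr_id mulN1r /secdiff.
  have L1 := low t; have L2 := low (- t); rewrite scaleNr in L2.
  have -> : `| `|a| + t| `^ gam + `| `|a| - t| `^ gam =
    `|a + t| `^ gam + `|a - t| `^ gam.
    have [ap|an] := leP 0 a; first by rewrite (ger0_norm ap).
    by rewrite (ltr0_norm an) addrC -opprD normrN (addrC (- a)) distrC.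
  lra.
by have := mulr_gt0 K0 c0; lra.
Qed.

End LineSupersolutions.

(** * Barriers for balls *)

Section MinMax.
Context {R : realType} {T : topologicalType}.
Implicit Types f g : T -> R.

Lemma continuous_maxr f g : continuous f -> continuous g ->
  continuous (fun x => Num.max (f x) (g x)).
Proof.
move=> cf cg x; under [X in continuous_at _ X]eq_fun do rewrite maxr_absE.
apply: cvgM; last exact: cvg_cst.
apply: cvgD; first by apply: cvgD; [exact: cf|exact: cg].
by apply: cvg_norm; apply: cvgB; [exact: cf|exact: cg].
Qed.

Lemma continuous_minr f g : continuous f -> continuous g ->
  continuous (fun x => Num.min (f x) (g x)).
Proof.
move=> cf cg x; under [X in continuous_at _ X]eq_fun do rewrite minr_absE.
apply: cvgM; last exact: cvg_cst.
apply: cvgB; first by apply: cvgD; [exact: cf|exact: cg].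
by apply: cvg_norm; apply: cvgB; [exact: cf|exact: cg].
Qed.

Lemma continuous_addf f g : continuous f -> continuous g ->
  continuous (fun x => f x + g x).
Proof. by move=> cf cg x; apply: cvgD; [exact: cf|exact: cg]. Qed.

Lemma continuous_subf f g : continuous f -> continuous g ->
  continuous (fun x => f x - g x).
Proof. by move=> cf cg x; apply: cvgB; [exact: cf|exact: cg]. Qed.

Lemma continuous_scalef (c : R) f : continuous f -> continuous (fun x => c * f x).
Proof. by move=> cf x; apply: cvgM; [exact: cvg_cst|exact: cf]. Qed.

Lemma continuous_compf (U : topologicalType) (h : U -> T) f :
  continuous h -> continuous f -> continuous (fun x => f (h x)).
Proof. by move=> ch cf x; apply: continuous_comp; [exact: ch|exact: cf]. Qed.

Lemma continuous_cstB (c : R) f : continuous f -> continuous (fun x => c - f x).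
Proof. by move=> cf x; apply: cvgB; [exact: cvg_cst|exact: cf]. Qed.

End MinMax.

Lemma chord_range (R : realType) (a e t : R) : 0 <= t -> t <= a -> a <= e ->
  (- a <= t <= e) /\ (- a <= - t <= e).
Proof. by move=> *; split; apply/andP; split; lra. Qed.

Lemma dotv_line (R : realType) N (v th : 'rV[R]_N) (t : R) :
  dotv (v + t *: th) (v + t *: th) =
  dotv v v + 2 * t * dotv v th + t ^+ 2 * dotv th th.
Proof.
by rewrite !(dotvDl, dotvDr, dotvZl, dotvZr) (dotvC th); ring.
Qed.

Lemma continuous_translate (R : realType) N (x : 'rV[R]_N) :
  continuous (fun z : 'rV[R]_N => x + z).
Proof.
move=> z; exact: (@cvgD R _ _ (nbhs z) _ (fun=> x) (fun y : 'rV[R]_N => y)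
  x z (cvg_cst _) cvg_id).
Qed.

Section BallBarrier.
Context {R : realType} {N : nat} (s : R) (hs : 1 / 2 < s) (hs1 : s < 1).
Implicit Types (w : 'rV[R]_N -> R) (x y th : 'rV[R]_N) (d r t : R).

Let gam := (2 * s - 1) / 2.
Let gam0 : 0 < gam. Proof. by rewrite /gam divr_gt0//; have := hs; lra. Qed.
Let gam1 : gam <= 1. Proof. by rewrite /gam; have := hs1; lra. Qed.

(** The function [(rho^2 - |x - y|^2)_+^gam]. On a chord of the ball with end
points at distances [a] and [e] it is the power [gam] of [(a + t)(e - t)]. *)
Definition ballpow y (rho : R) x : R :=
  (Num.max 0 (rho ^+ 2 - dotv (x - y) (x - y))) `^ gam.

Lemma continuous_ballpow y rho : continuous (ballpow y rho).
Proof.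
have -> : ballpow y rho =
    fun x => `|Num.max 0 (rho ^+ 2 - dotv (x - y) (x - y))| `^ gam.
  by apply/funext => x; rewrite ger0_norm// le_max lexx.
apply: continuous_normpow_comp => // x.
have c0 := @cst_continuous 'rV[R]_N R 0.
apply: (continuous_maxr c0 (g := fun x => rho ^+ 2 - dotv (x - y) (x - y))).
apply: continuous_cstB.
have c : continuous (fun z : 'rV[R]_N => z - y).
  move=> z; exact: (@cvgD R _ _ (nbhs z) _ (fun y : 'rV[R]_N => y) (fun=> - y)
    z (- y) cvg_id (cvg_cst _)).
exact: continuous_dotv.
Qed.

Lemma ballpow_ge0 y rho x : 0 <= ballpow y rho x.
Proof. exact: powR_ge0. Qed.

Lemma ballpow_le y rho x : ballpow y rho x <= (rho ^+ 2) `^ gam.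
Proof.
rewrite ge0_ler_powR ?nnegrE ?(ltW gam0) ?sqr_ge0 ?le_max ?lexx//.
by rewrite ge_max sqr_ge0 gerBl dotv_ge0.
Qed.

Lemma bdcont_ballpow y rho : bdcont (ballpow y rho).
Proof.
split; first exact: continuous_ballpow.
by exists ((rho ^+ 2) `^ gam) => x; rewrite ger0_norm ?ballpow_ge0 ?ballpow_le.
Qed.

Lemma ballpow_eq0 y rho x : 0 < rho -> rho <= enorm (x - y) -> ballpow y rho x = 0.
Proof.
move=> r0 rx; rewrite /ballpow max_l ?powR0 ?gt_eqF//.
by rewrite -enorm_sqr subr_le0 ler_pXn2r// ?nnegrE ?enorm_ge0// ltW.
Qed.

(** Hoelder decay at points outside the ball: the distance from [x] to the
sphere is at most [|x - z|]. *)
Lemma ballpow_bound y rho x z : 0 < rho -> rho <= enorm (z - y) ->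
  ballpow y rho x <= (2 * rho) `^ gam * enorm (x - z) `^ gam.
Proof.
move=> r0 rz; rewrite -powRM ?mulr_ge0 ?enorm_ge0 ?(ltW r0)//.
rewrite ge0_ler_powR ?nnegrE ?(ltW gam0) ?mulr_ge0 ?(ltW r0) ?enorm_ge0 ?le_max ?lexx//.
rewrite ge_max mulr_ge0 ?mulr_ge0 ?enorm_ge0 ?(ltW r0)//= -enorm_sqr.
have := enormD (z - x) (x - y); rewrite addrA subrK (enormBC z x).
move: (enorm_ge0 (x - y)) (enorm_ge0 (x - z)) rz.
move: (enorm (x - y)) (enorm (x - z)) (enorm (z - y)) => n e m n0 e0 rm mn.
have re : rho - n <= e by lra.
have -> : rho ^+ 2 - n ^+ 2 = (rho - n) * (rho + n) by ring.
have [nr|nr] := leP n rho; last by nra.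
have : (rho - n) * (rho + n) <= e * (rho + n) by rewrite ler_wpM2r// addr_ge0// ltW.
have : e * (rho + n) <= e * (2 * rho) by rewrite ler_wpM2l//; lra.
lra.
Qed.

Lemma Out_oppdir w x th d : Out s w x (- th) d = Out s w x th d.
Proof.
by congr Kint; apply/funext => t; rewrite /secdiff scalerN opprK [_ + w _]addrC.
Qed.

(** Take the direction for which the nearer end of the chord is at distance
[a], on the side of negative [t]. For [t <= a] the second difference is
nonpositive by concavity. For [t >= a] one of the two points has left the ball,
and Bernoulli's inequality bounds the other value by an affine function of [t],
whose integral is explicit. The bound is uniform because [a <= rho]. *)
Lemma Out_ballpow y rho x th : 0 < rho -> enorm (x - y) < rho -> esphere th ->
  exists2 d0, 0 < d0 & forall d, 0 < d < d0 ->
    Out s (ballpow y rho) x th d <= - ((1 - s) / (2 * s * rho)).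
Proof.
move=> r0 xr.
wlog b0 : th / dotv (x - y) th <= 0.
  move=> H th1; have [b0|/ltW b0] := leP (dotv (x - y) th) 0; first exact: H.
  have th1' : esphere (- th) by rewrite /esphere/= enormN.
  have [|d0 d00 H'] := H (- th) _ th1'; first by rewrite dotvNr oppr_le0.
  exists d0; first exact: d00.
  by move=> d dd; rewrite -(Out_oppdir (ballpow y rho) x th d); exact: H'.
move=> th1; set b := dotv (x - y) th in b0.
pose c := rho ^+ 2 - dotv (x - y) (x - y).
have c0 : 0 < c.
  by rewrite /c -enorm_sqr subr_gt0 ltr_pXn2r// ?nnegrE ?enorm_ge0// ltW.
(* [- a] and [e] are the roots of [rho ^+ 2 - dotv (x + t th - y) (x + t th - y)] *)
pose D := Num.sqrt (b ^+ 2 + c).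
have D2 : D ^+ 2 = b ^+ 2 + c by rewrite sqr_sqrtr// addr_ge0 ?sqr_ge0// ltW.
have D0 : 0 <= D by exact: sqrtr_ge0.
have bD : - b < D by rewrite ltNge; apply/negP => h; nra.
pose a := D + b; pose e := D - b.
have a0 : 0 < a by rewrite /a; lra.
have ae : a <= e by rewrite /a /e; lra.
have e0 : 0 < e by exact: lt_le_trans ae.
have aec : a * e = c by rewrite /a /e; ring: D2.
have thn : dotv th th = 1 by rewrite -enorm_sqr th1 expr1n.
set f := ballpow y rho.
have fE t : f (x + t *: th) = Num.max 0 ((a + t) * (e - t)) `^ gam.
  rewrite /f /ballpow; congr (Num.max 0 _ `^ _).
  have -> : x + t *: th - y = (x - y) + t *: th by rewrite addrAC.
  rewrite dotv_line thn -/b.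
  transitivity (c - 2 * b * t - t ^+ 2); first by rewrite /c; ring.
  by rewrite -aec /a /e; ring.
have f0 : f x = c `^ gam.
  by have := fE 0; rewrite scale0r addr0 addr0 subr0 aec max_r// ltW.
have C0 : 0 < c `^ gam by exact: powR_gt0.
have fu t u : 0 <= u -> Num.max 0 ((a + t) * (e - t)) <= c * u ->
    f (x + t *: th) <= c `^ gam * (1 + gam * (u - 1)).
  move=> u0 H; rewrite fE; apply: (@le_trans _ _ ((c * u) `^ gam)).
    have p1 : 0 <= Num.max 0 ((a + t) * (e - t)) by rewrite le_max lexx.
    have p2 : 0 <= c * u by exact: mulr_ge0 (ltW c0) u0.
    by apply: (ge0_ler_powR (ltW gam0)) => //; rewrite nnegrE.
  rewrite powRM ?(ltW c0)// ler_wpM2l ?(ltW C0)//.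
  by apply: powR_Bernoulli; rewrite ?gam1 ?(ltW gam0).
have cn : c != 0 by rewrite gt_eqF.
have fchord t : - a <= t <= e ->
   f (x + t *: th) <= c `^ gam * (1 + gam * ((a + t) * (e - t) / c - 1)).
  move=> /andP[at_ te]; have p0 : 0 <= (a + t) * (e - t).
    by rewrite mulr_ge0//; lra.
  apply: fu; first by rewrite divr_ge0 ?(ltW c0).
  by rewrite mulrCA divff// mulr1 max_r.
have near0 t : 0 <= t <= a -> secdiff f x th t <= 0.
  move=> /andP[t0 ta].
  have H1 := @fchord t _; have H2 := @fchord (- t) _.
  have [b1 b2] := chord_range t0 ta ae.
  have {}H1 := H1 b1; have {}H2 := H2 b2.
  rewrite scaleNr in H2; rewrite /secdiff f0.
  have E : (a + t) * (e - t) / c + (a - t) * (e - - t) / c - 2 =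
      - (2 * (t ^+ 2 / c)).
    by rewrite -aec; field; rewrite !gt_eqF.
  have K0 : 0 <= t ^+ 2 / c by rewrite divr_ge0 ?sqr_ge0 ?(ltW c0).
  have : f (x + t *: th) + f (x - t *: th) <= c `^ gam * (2 + gam *
     ((a + t) * (e - t) / c + (a - t) * (e - - t) / c - 2)).
    move: H1 H2; move: (f _) (f _) (c `^ gam) (_ / c) (_ / c).
    by clear; move=> *; lra.
  rewrite E => H; rewrite subr_le0 (le_trans H)// mulrC ler_wpM2r ?(ltW C0)//.
  by rewrite gerDl mulrN oppr_le0 mulr_ge0 ?(ltW gam0)// mulr_ge0.
have far t : a <= t -> secdiff f x th t <= - c `^ gam + (c `^ gam * (gam / a)) * t.
  move=> at_; have t0 : 0 < t by exact: lt_le_trans at_.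
  have -> : secdiff f x th t = f (x + t *: th) - 2 * c `^ gam.
    rewrite /secdiff f0 -scaleNr (fE (- t)) max_l ?powR0 ?gt_eqF ?addr0//.
    by apply: mulr_le0_ge0; lra.
  have u0 : 0 <= 1 + t / a by rewrite addr_ge0// divr_ge0 ?(ltW t0) ?(ltW a0).
  have := @fu t _ u0.
  have -> : c * (1 + t / a) = (a + t) * e by rewrite -aec; field; rewrite gt_eqF.
  have M : Num.max 0 ((a + t) * (e - t)) <= (a + t) * e.
    have at0 : 0 <= a + t by lra.
    rewrite ge_max mulr_ge0 ?(ltW e0)//= ler_wpM2l//; lra.
  move=> /(_ M) H.
  have E : c `^ gam * (1 + gam * (1 + t / a - 1)) =
     c `^ gam + c `^ gam * (gam / a) * t by ring.
  rewrite E in H; lra.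
exists a => // d /andP[d0 da].
have bf := bdcont_ballpow y rho.
have lf := lingr_secdiff x th bf.
have s0 : 0 < s by have := hs; lra.
have q0 : 0 < 2 * s - 1 by have := hs; lra.
have S1 : Out s f x th d <= Out s f x th a.
  have := @Kint_split_le _ _ hs _ d a 0 hs1 lf d0 (ltW da).
  rewrite mul0r addr0; apply => t /andP[dt ta].
  by rewrite mulr0 mul0r near0// ta andbT (le_trans (ltW d0)).
apply: (le_trans S1).
apply: (@le_trans _ _ (Kint s a (fun t => - c `^ gam + (c `^ gam * (gam / a)) * t))).
  by apply: Kint_le => //; exact: lingr_affine.
rewrite Kint_affine//.
have -> : a `^ (1 - 2 * s) = a * a `^ (- (2 * s)).
  by rewrite powRD ?(gt_eqF a0) ?implybT// powRr1// ltW.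
set A := a `^ (- (2 * s)); have A0 : 0 < A by exact: powR_gt0.
have -> : - c `^ gam * (A / (2 * s)) + c `^ gam * (gam / a) * (a * A / (2 * s - 1))
   = - (c `^ gam * A * ((1 - s) / (2 * s))).
  by rewrite /gam; field; rewrite !gt_eqF.
rewrite lerN2.
have H1 : a^-1 <= c `^ gam * A.
  have -> : a^-1 = a `^ (2 * gam) * A.
    rewrite -powRD ?(gt_eqF a0) ?implybT// -powR_inv1 ?(ltW a0)//.
    by congr (_ `^ _); rewrite /gam; field.
  rewrite ler_wpM2r ?(ltW A0)// powRrM powR_mulrn ?(ltW a0)//.
  rewrite ge0_ler_powR ?nnegrE ?(ltW gam0) ?sqr_ge0 ?(ltW c0)//.
  by rewrite -aec expr2 ler_wpM2l// ltW.
have ar : a <= rho.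
  rewrite -(@ler_pXn2r _ 2)// ?nnegrE ?(ltW a0) ?(ltW r0)//.
  apply: (@le_trans _ _ c); first by rewrite -aec expr2 ler_wpM2l// ltW.
  by rewrite /c gerBl dotv_ge0.
apply: (@le_trans _ _ (a^-1 * ((1 - s) / (2 * s)))); last first.
  rewrite ler_wpM2r//.
  by apply: divr_ge0; [rewrite subr_ge0 ltW|rewrite mulr_ge0 ?(ltW s0)].
rewrite [2 * s * rho]mulrC invfM mulrCA ler_wpM2r//.
  by apply: divr_ge0; [rewrite subr_ge0 ltW|rewrite mulr_ge0 ?(ltW s0)].
by rewrite lef_pV2 ?posrE.
Qed.

Lemma SP_ballpow y rho x th : 0 < rho -> enorm (x - y) < rho -> esphere th ->
  SP s (ballpow y rho) x th ((1 - s) / (2 * s * rho)).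
Proof.
move=> r0 xr th1; apply: SP_intro => //; first exact: bdcont_ballpow.
move=> p C r _ _ e d1 e0 d10.
have [d0 d00 H] := Out_ballpow r0 xr th1.
exists (Num.min d0 d1 / 2).
  have m0 : 0 < Num.min d0 d1 by rewrite lt_min d00.
  rewrite divr_gt0//=; apply: (@lt_le_trans _ _ (Num.min d0 d1)).
    by rewrite ltr_pdivrMr// ltr_pMr// ltr1n.
  by rewrite ge_min lexx orbT.
apply: (@le_trans _ _ (- ((1 - s) / (2 * s * rho)))); last by rewrite lerDl ltW.
apply: H; have m0 : 0 < Num.min d0 d1 by rewrite lt_min d00.
rewrite divr_gt0//=; apply: (@lt_le_trans _ _ (Num.min d0 d1)).
  by rewrite ltr_pdivrMr// ltr_pMr// ltr1n.
by rewrite ge_min lexx.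
Qed.

End BallBarrier.

(** * Stability under uniform convergence *)

Section Stability.
Context {R : realType} {N : nat} (s : R) (hs : 1 / 2 < s) (hs1 : s < 1).
Implicit Types (u w : 'rV[R]_N -> R) (x y z th : 'rV[R]_N) (d r t : R).

Let gam := (2 * s - 1) / 2.
Let gam0 : 0 < gam. Proof. by rewrite /gam divr_gt0//; have := hs; lra. Qed.
Let gam1 : gam <= 1. Proof. by rewrite /gam; have := hs1; lra. Qed.

Definition hol (L : R) u := forall x y, `|u x - u y| <= L * enorm (x - y) `^ gam.

Lemma hol_continuous L u : hol L u -> continuous u.
Proof.
move=> hu x A /nbhs_ballP[e /= e0 HA]; apply/nbhs_enormP.
have e20 : 0 < e / 2 by exact: divr_gt0.
have [d0 d00 dP] := @powR_small _ L (e / 2) gam gam0 e20.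
exists d0 => // y yd; apply: HA; rewrite -ball_normE /=.
have [->|xy] := eqVneq y x; first by rewrite subrr normr0.
rewrite (le_lt_trans (hu x y))// enormBC; apply: (@le_lt_trans _ _ (e / 2)).
  rewrite dP// yd andbT lt_neqAle eq_sym enorm_ge0 andbT.
  by apply: contraNN xy => /eqP/enorm_eq0/subr0_eq ->.
by rewrite ltr_pdivrMr// ltr_pMr// ltr1n.
Qed.

(** Some direction almost reaches the value [- F], tested with paraboloids that
touch [w] from above. *)
Definition SB w x (F : R) : Prop := forall p C r, 0 < r ->
  (forall z, enorm z <= r -> w (x + z) <= w x + dotv p z + C * dotv z z) ->
  forall d e, 0 < d < r -> 0 < e ->
  exists2 th, esphere th &
    - F - e <= Out s w x th d + C * (d `^ (2 - 2 * s) / (1 - s)).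

(** If [w <= u] with equality at [x], then the parabolas below [w] are
below [u], and the integral of [w] is the smaller one. So minima of
supersolutions are supersolutions. *)
Lemma SP_touch_le u w x th F : bdcont u -> bdcont w ->
  (forall y, w y <= u y) -> w x = u x -> SP s u x th F -> SP s w x th F.
Proof.
move=> bu bw wu wx H p C r r0 touch d dr.
have d0 : 0 < d by case/andP: dr.
apply: (le_trans _ (H p C r r0 _ d dr)); last first.
  by move=> t tr; rewrite -wx (le_trans (touch t tr)).
have := @Out_le _ _ s hs w u x x th th d 0 bw bu d0.
rewrite mul0r addr0; apply => t; rewrite addr0 /secdiff wx lerD2r.
by rewrite lerD.
Qed.

(* linear arithmetic on the goal alone, as the contexts of the next proofs are large *)
Local Ltac lra_here := clear - hs hs1 gam0 gam1; move=> *; lra.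

(** Bend the parabola by [rho t^2]. A function [w] close to [u] is touched
from below by a translate of the bent parabola, at a point [x + a th] near [x].
The condition on [w] there gives the one on [u] at [x] up to errors controlled
by the Hoelder modulus. The parameters are chosen so that each error is at most
a quarter of [e]. *)
Lemma SP_stab (L F : R) u x th : bdcont u -> hol L u -> 0 <= L -> esphere th ->
  (forall e, 0 < e -> exists2 r0, 0 < r0 & forall e', 0 < e' ->
     exists w, [/\ bdcont w, (forall y, u y - e' <= w y), w x <= u x + e' &
       forall t, `|t| < r0 -> SP s w (x + t *: th) th (F - e)]) ->
  SP s u x th F.
Proof.
move=> bu hu L0 th1 H p C r r0 touch d /andP[d0 dr].
apply/ler_addgt0Pr => e e0.
have s1 : 0 < 1 - s by rewrite subr_gt0.
have s0 : 0 < s by have := hs; lra.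
pose dd := d `^ (2 - 2 * s) / (1 - s).
have dd0 : 0 < dd by rewrite divr_gt0 ?powR_gt0.
pose k := d `^ (- (2 * s)) / (2 * s).
have k0 : 0 < k by rewrite divr_gt0 ?powR_gt0 ?mulr_gt0.
have e40 : 0 < e / 4 by rewrite divr_gt0.
(* the bending contributes [rho * dd = e / 4] *)
pose rho := e / 4 / dd; have rho0 : 0 < rho by rewrite divr_gt0.
have [r1 r10 H1] := H _ e40.
have [r2 r20 r2P] := @powR_small _ (4 * L * k) (e / 4) gam gam0 e40.
pose m := Num.min (Num.min r1 r2) (r - d).
have m0 : 0 < m by rewrite !lt_min r10 r20 subr_gt0.
pose sig := m / 2.
have sig0 : 0 < sig by rewrite divr_gt0.
have sigm : sig < m by rewrite ltr_pdivrMr// ltr_pMr// ltr1n.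
have [s_r1 s_r2 s_rd] : [/\ sig < r1, sig < r2 & sig < r - d].
  by move: sigm; rewrite !lt_min => /andP[/andP[-> ->] ->].
have eps1 : 0 < e / 32 / k by apply: (divr_gt0 _ k0); exact: divr_gt0.
have eps2 : 0 < rho * sig ^+ 2 / 4.
  by apply: divr_gt0 => //; apply: mulr_gt0; [exact: rho0|exact: exprn_gt0].
pose e' := Num.min (e / 32 / k) (rho * sig ^+ 2 / 4).
have e'0 : 0 < e' by rewrite lt_min eps1.
have e'k : e' * k <= e / 32.
  by rewrite -ler_pdivlMr// ge_min lexx.
have e'r : e' <= rho * sig ^+ 2 / 4 by rewrite ge_min lexx orbT.
have [w [bw wu wx wSP]] := H1 _ e'0.
pose h t := w (x + t *: th) - (p * t - (C + rho) * t ^+ 2).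
have ch : continuous h.
  move=> t; apply: cvgB.
    by apply: (continuous_comp (f := fun t => x + t *: th)); [exact: continuous_line|exact: bw.1].
  apply: cvgB; first by apply: cvgM; [exact: cvg_cst|exact: cvg_id].
  by apply: cvgM; [exact: cvg_cst|exact: exprn_continuous].
have rr : - r <= r by lra.
have [a ar amin] := @EVT_min _ h _ _ rr (continuous_subspaceT ch).
have {}ar : `|a| <= r by rewrite ler_norml; move: ar; rewrite in_itv.
have {}amin t : `|t| <= r -> h a <= h t.
  by move=> tr; apply: amin; rewrite in_itv/= -ler_norml.
have ha0 := amin 0; rewrite normr0 in ha0; have {}ha0 := ha0 (ltW r0).
rewrite /h scale0r addr0 mulr0 expr0n mulr0 subr0 subr0 in ha0.
have tcha := touch _ ar.
have wa := wu (x + a *: th).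
have a2 : rho * a ^+ 2 <= 2 * e' by move: ha0 tcha wa wx; lra_here.
have asig : `|a| < sig.
  rewrite -(@ltr_pXn2r _ 2)// ?nnegrE ?(ltW sig0)// real_normK ?num_real//.
  rewrite -(ltr_pM2l rho0); apply: (le_lt_trans a2).
  have : 0 < rho * sig ^+ 2 by rewrite mulr_gt0// exprn_gt0.
  by move: e'r; lra_here.
set x1 := x + a *: th in wa tcha ha0.
have Lsig : L * `|a| `^ gam <= L * sig `^ gam.
  rewrite ler_wpM2l// ge0_ler_powR ?nnegrE ?(ltW gam0) ?(ltW sig0)//.
  exact: ltW.
have eqx t : enorm (x + t *: th - (x1 + t *: th)) = `|a|.
  by rewrite opprD addrACA subrr addr0 /x1 opprD addrA subrr sub0r enormN enormZ th1 mulr1.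
have eqx0 : enorm (x1 - x) = `|a|.
  by rewrite /x1 addrAC subrr add0r enormZ th1 mulr1.
have wx1 : w x1 <= u x1 + e'.
  by move: (mulr_ge0 (ltW rho0) (sqr_ge0 a)) ha0 tcha wx; lra_here.
have ux1 : u x1 <= u x + L * sig `^ gam.
  have := hu x1 x; rewrite eqx0 ler_norml => /andP[_].
  by move: Lsig; lra_here.
have SPw := wSP a (lt_trans asig s_r1).
have rs0 : 0 < r - sig by move: s_rd d0; lra_here.
have dsr : 0 < d < r - sig by rewrite d0/=; move: s_rd; lra_here.
have U := SPw (p - 2 * (C + rho) * a) (C + rho) (r - sig) rs0 _ d dsr.
rewrite -/x1 in U.
have {}U : Out s w x1 th d <= - (F - e / 4) + (C + rho) * dd.
  apply: U => t tr.
  have tar : `|a + t| <= r by rewrite (le_trans (ler_normD _ _))//; move: asig tr; lra_here.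
  have := amin _ tar; rewrite /h scalerDl addrA -/x1; lra_here.
have O : Out s u x th d <= Out s w x1 th d + (4 * e' + 4 * (L * sig `^ gam)) * k.
  apply: Out_le => // t; rewrite /secdiff.
  have A1 := hu (x + t *: th) (x1 + t *: th).
  have A2 := hu (x - t *: th) (x1 - t *: th).
  have B1 := wu (x1 + t *: th); have B2 := wu (x1 - t *: th).
  have e2 := eqx (- t); rewrite scaleNr in e2.
  rewrite eqx in A1; rewrite e2 in A2.
  move: A1 A2; rewrite !ler_norml => /andP[_ A1] /andP[_ A2].
  by move: A1 A2 B1 B2 wx1 ux1 Lsig; lra_here.
have r2s := r2P sig; rewrite sig0 s_r2 in r2s; have {}r2s := r2s isT.
have rd : rho * dd = e / 4 by rewrite /rho divfK// gt_eqF.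
rewrite -/dd; move: O U r2s rd e'k e0.
by move: (Out s u x th d) (Out s w x1 th d); lra_here.
Qed.

Lemma compact_closed_eball r : compact [set z : 'rV[R]_N | enorm z <= r].
Proof.
apply: bounded_closed_compact.
  exists r; split; first exact: num_real.
  by move=> M rM z /= zr; rewrite (le_trans (norm_le_enorm _))// (le_trans zr)// ltW.
have c : continuous (fun z : 'rV[R]_N => enorm z).
  by apply: (@continuous_enorm _ _ _ id) => z; exact: cvg_id.
have -> : [set z : 'rV[R]_N | enorm z <= r] =
    (fun z : 'rV[R]_N => enorm z) @^-1` [set t | t <= r] by [].
by apply: closed_comp => //; exact: closed_le.
Qed.

(** The argument of [SP_stab] with a paraboloid from above and all directions
at once; the direction provided for [w] at the nearby point serves for [u]. *)
Lemma SB_stab (L F : R) u x : bdcont u -> hol L u -> 0 <= L ->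
  (forall e, 0 < e -> exists2 r0, 0 < r0 & forall e', 0 < e' ->
     exists w, [/\ bdcont w, (forall y, `|w y - u y| <= e') &
       forall z, enorm z < r0 -> SB w (x + z) (F + e)]) ->
  SB u x F.
Proof.
move=> bu hu L0 H p C r r0 touch d e /andP[d0 dr] e0.
have s1 : 0 < 1 - s by rewrite subr_gt0.
have s0 : 0 < s by have := hs; lra.
pose dd := d `^ (2 - 2 * s) / (1 - s).
have dd0 : 0 < dd by rewrite divr_gt0 ?powR_gt0.
pose k := d `^ (- (2 * s)) / (2 * s).
have k0 : 0 < k by rewrite divr_gt0 ?powR_gt0 ?mulr_gt0.
have e50 : 0 < e / 5 by rewrite divr_gt0.
(* five errors: bending, Hoelder modulus, distance to [w], right-hand side and
   choice of the direction *)
pose rho := e / 5 / dd; have rho0 : 0 < rho by rewrite divr_gt0.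
have [r1 r10 H1] := H _ e50.
have [r2 r20 r2P] := @powR_small _ (4 * L * k) (e / 5) gam gam0 e50.
pose m := Num.min (Num.min r1 r2) (r - d).
have m0 : 0 < m by rewrite !lt_min r10 r20 subr_gt0.
pose sig := m / 2.
have sig0 : 0 < sig by rewrite divr_gt0.
have sigm : sig < m by rewrite ltr_pdivrMr// ltr_pMr// ltr1n.
have [s_r1 s_r2 s_rd] : [/\ sig < r1, sig < r2 & sig < r - d].
  by move: sigm; rewrite !lt_min => /andP[/andP[-> ->] ->].
have eps1 : 0 < e / 40 / k by apply: (divr_gt0 _ k0); exact: divr_gt0.
have eps2 : 0 < rho * sig ^+ 2 / 4.
  by apply: divr_gt0 => //; apply: mulr_gt0; [exact: rho0|exact: exprn_gt0].
pose e' := Num.min (e / 40 / k) (rho * sig ^+ 2 / 4).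
have e'0 : 0 < e' by rewrite lt_min eps1.
have e'k : e' * k <= e / 40.
  by rewrite -ler_pdivlMr// ge_min lexx.
have e'r : e' <= rho * sig ^+ 2 / 4 by rewrite ge_min lexx orbT.
have [w [bw wu wSB]] := H1 _ e'0.
have wu1 y : w y <= u y + e' by have := wu y; rewrite ler_norml => /andP[_]; lra.
have wu2 y : u y - e' <= w y by have := wu y; rewrite ler_norml => /andP[? _]; lra.
pose h z := w (x + z) - (dotv p z + (C + rho) * dotv z z).
have cid : continuous (fun z : 'rV[R]_N => z) by move=> z; exact: cvg_id.
have cp : continuous (fun z : 'rV[R]_N => p) by exact: cst_continuous.
have ch : continuous h.
  apply: (@continuous_subf _ _ (fun z => w (x + z))).
    exact: (continuous_compf (@continuous_translate _ _ x) bw.1).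
  apply: (@continuous_addf _ _ (fun z => dotv p z)).
    exact: (continuous_dotv cp cid).
  by apply: continuous_scalef; exact: (continuous_dotv cid cid).
have A0 : [set z : 'rV[R]_N | enorm z <= r] !=set0.
  by exists 0; rewrite /= enorm0 ltW.
have [a ar amax] := @EVT_max_rV _ _ h _ A0 (@compact_closed_eball r)
  (continuous_subspaceT ch).
have {}ar : enorm a <= r by move: ar; rewrite inE.
have {}amax z : enorm z <= r -> h z <= h a by move=> zr; apply: amax; rewrite inE.
have ha0 := amax 0; rewrite enorm0 in ha0; have {}ha0 := ha0 (ltW r0).
have d00 y : dotv y (0 : 'rV[R]_N) = 0.
  by rewrite -[0 in LHS](scale0r (0 : 'rV[R]_N)) dotvZr mul0r.
rewrite /h addr0 !d00 mulr0 addr0 subr0 in ha0.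
have tcha := touch _ ar.
have a2 : rho * dotv a a <= 2 * e'.
  by move: ha0 tcha (wu1 (x + a)) (wu2 x); lra_here.
have asig : enorm a < sig.
  rewrite -(@ltr_pXn2r _ 2)// ?nnegrE ?(ltW sig0) ?enorm_ge0// enorm_sqr.
  rewrite -(ltr_pM2l rho0); apply: (le_lt_trans a2).
  have : 0 < rho * sig ^+ 2 by rewrite mulr_gt0// exprn_gt0.
  by move: e'r; lra_here.
set x1 := x + a in tcha ha0.
have Lsig : L * enorm a `^ gam <= L * sig `^ gam.
  rewrite ler_wpM2l// ge0_ler_powR ?nnegrE ?(ltW gam0) ?(ltW sig0) ?enorm_ge0//.
  exact: ltW.
have rs0 : 0 < r - sig by move: s_rd d0; lra_here.
have dsr : 0 < d < r - sig by rewrite d0/=; move: s_rd; lra_here.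
have touchw z : enorm z <= r - sig ->
    w (x1 + z) <= w x1 + dotv (p + (2 * (C + rho)) *: a) z + (C + rho) * dotv z z.
  move=> zr; have tar : enorm (a + z) <= r by rewrite (le_trans (enormD _ _))//; move: asig zr; lra_here.
  have := amax _ tar; rewrite /h addrA -/x1.
  have -> : dotv (a + z) (a + z) = dotv a a + 2 * dotv a z + dotv z z.
    by rewrite !(dotvDl, dotvDr) (dotvC z a); ring.
  by rewrite dotvDr dotvDl dotvZl; lra_here.
have SBw := wSB a (lt_trans asig s_r1).
have [th th1 U] := SBw _ _ _ rs0 touchw d (e / 5) dsr e50.
exists th => //.
have O : Out s w x1 th d <= Out s u x th d + (4 * e' + 4 * (L * sig `^ gam)) * k.
  apply: Out_le => // t; rewrite /secdiff.
  have eqx v : enorm (x1 + v - (x + v)) = enorm a.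
    by congr enorm; rewrite opprD addrACA subrr addr0 /x1 addrAC subrr add0r.
  have A1 := hu (x1 + t *: th) (x + t *: th).
  have A2 := hu (x1 - t *: th) (x - t *: th).
  have A3 := hu x1 x.
  rewrite eqx in A1; rewrite eqx in A2.
  have e3 : enorm (x1 - x) = enorm a by rewrite /x1 addrAC subrr add0r.
  rewrite e3 in A3.
  have B1 := wu1 (x1 + t *: th); have B2 := wu1 (x1 - t *: th).
  have B3 := wu2 x1.
  move: A1 A2 A3; rewrite !ler_norml => /andP[_ A1] /andP[_ A2] /andP[A3 _].
  by move: A1 A2 A3 B1 B2 B3 Lsig; lra_here.
have r2s := r2P sig; rewrite sig0 s_r2 in r2s; have {}r2s := r2s isT.
have rd : rho * dd = e / 5 by rewrite /rho divfK// gt_eqF.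
rewrite -/x1 -/dd in U; rewrite -/dd; move: O U r2s rd e'k e0.
by move: (Out s u x th d) (Out s w x1 th d); lra_here.
Qed.

End Stability.

(** * The least supersolution *)

Section Perron.
Context {R : realType} {N : nat} (s : R) (hs : 1 / 2 < s) (hs1 : s < 1).
Implicit Types (u w : 'rV[R]_N -> R) (x y z th : 'rV[R]_N) (d r t : R).

Let gam := (2 * s - 1) / 2.
Let gam0 : 0 < gam. Proof. by rewrite /gam divr_gt0//; have := hs; lra. Qed.
Let gam1 : gam <= 1. Proof. by rewrite /gam; have := hs1; lra. Qed.
Let s0 : 0 < s. Proof. by have := hs; lra. Qed.
Let s1 : 0 < 1 - s. Proof. by rewrite subr_gt0. Qed.

(** The cone bound on the line through two points, in both directions; outside
the domain the hypothesis on the growth of [w] is exactly what is needed. *)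
Lemma hol_of_SP (O : set 'rV[R]_N) y0 rho w L : O `<=` eball y0 rho ->
  bdcont w -> (forall x, 0 <= w x) -> (forall x, ~ O x -> w x = 0) ->
  (forall x th, O x -> esphere th -> SP s w x th 0) -> 0 < L ->
  (forall x z, ~ O z -> w x <= L * enorm (x - z) `^ gam) -> hol s L w.
Proof.
move=> Oy bw w0 wO wSP L0 wL x y.
have cone a b : w a - L * enorm (b - a) `^ gam <= w b.
  have [->|ab] := eqVneq a b.
    by rewrite subrr enorm0 powR0 ?gt_eqF// mulr0 subr0.
  have [th [th1 bE]] := unit_dir ab.
  rewrite {2}bE.
  have := @cone_bound _ _ s hs hs1 O w a th L (rho + enorm (a - y0)) bw w0 wO _ L0 _ _
     (enorm (b - a)).
  rewrite (ger0_norm (enorm_ge0 _)); apply.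
  - by move=> z Oz; exact: wSP.
  - move=> t Ot; apply: (le_trans (wL a _ Ot)).
    by rewrite opprD addrA subrr sub0r enormN enormZ th1 mulr1.
  - move=> t tT /Oy; rewrite /eball/= => H.
    have := enormD (a + t *: th - y0) (y0 - a).
    rewrite addrA subrK addrAC subrr add0r enormZ th1 mulr1 (enormBC y0 a).
    by lra.
have := cone x y; have := cone y x; rewrite (enormBC y x).
by rewrite ler_norml => *; apply/andP; split; lra.
Qed.

Definition finf (W : set ('rV[R]_N -> R)) x : R :=
  inf [set v | exists2 w, W w & v = w x].

Section Infimum.
Context (W : set ('rV[R]_N -> R)) (W0 : W !=set0)
  (Wge0 : forall w, W w -> forall x, 0 <= w x).

Lemma finf_le w x : W w -> finf W x <= w x.
Proof.
move=> Ww; apply: ge_inf; last by exists w.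
by exists 0 => v [w' Ww' ->]; exact: Wge0.
Qed.

Lemma finf_ge x a : (forall w, W w -> a <= w x) -> a <= finf W x.
Proof.
move=> H; apply: lb_le_inf.
  by case: W0 => w Ww; exists (w x); exists w.
by move=> v [w Ww ->]; exact: H.
Qed.

Lemma finf_adherent x e : 0 < e -> exists2 w, W w & w x <= finf W x + e.
Proof.
move=> e0; have hi : has_inf [set v | exists2 w, W w & v = w x].
  split; first by case: W0 => w Ww; exists (w x); exists w.
  by exists 0 => v [w' Ww' ->]; exact: Wge0.
by have [v [w Ww ->] /ltW ?] := inf_adherent e0 hi; exists w.
Qed.

Lemma hol_finf L : (forall w, W w -> hol s L w) -> hol s L (finf W).
Proof.
move=> H x y.
have aux a b : finf W a - finf W b <= L * enorm (a - b) `^ gam.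
  apply/ler_addgt0Pr => e e0; have [w Ww wb] := finf_adherent b e0.
  have := finf_le a Ww; have := H _ Ww a b; rewrite ler_norml => /andP[_]; lra.
have := aux x y; have := aux y x; rewrite (enormBC y x).
by rewrite ler_norml => *; apply/andP; split; lra.
Qed.

(** Apply [SP_stab]: near [x], an element of the family that almost attains the
infimum at [x] stays close to it because the family is equi-Hoelder. *)
Lemma SP_finf (Om : set 'rV[R]_N) L lam c : open Om -> 0 <= L -> 0 <= lam ->
  (forall w, W w -> bdcont w) -> (forall w, W w -> hol s L w) ->
  (forall w x th, W w -> Om x -> esphere th -> SP s w x th (lam * w x + c)) ->
  forall x th, Om x -> esphere th -> SP s (finf W) x th (lam * finf W x + c).
Proof.
move=> oOm L0 lam0 Wbd Whol WSP x th Ox th1.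
have hu := hol_finf Whol.
have bu : bdcont (finf W).
  split; first exact: (hol_continuous hs hu).
  case: W0 => w Ww; have [_ [B wB]] := Wbd _ Ww; exists B => y.
  rewrite ger0_norm; last by apply: finf_ge => w' Ww'; exact: Wge0.
  by rewrite (le_trans (finf_le y Ww))// (le_trans (ler_norm _)).
apply: (SP_stab hs hs1 bu hu L0 th1) => e e0.
have /nbhs_enormP [r1 r10 Hr] : nbhs x Om by exact: open_nbhs_nbhs.
have [r2 r20 r2P] := @powR_small _ (lam * L) e gam gam0 e0.
exists (Num.min r1 r2); first by rewrite lt_min r10.
move=> e' e'0; have [w Ww wx] := finf_adherent x e'0.
exists w; split => //.
- exact: Wbd.
- by move=> y; rewrite (le_trans _ (finf_le y Ww))// gerBl ltW.
move=> t; rewrite lt_min => /andP[tr1 tr2].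
have Ot : Om (x + t *: th).
  by apply: Hr; rewrite addrAC subrr add0r enormZ th1 mulr1.
apply: SP_leF (WSP _ _ _ Ww Ot th1).
have H1 := finf_le (x + t *: th) Ww.
have := hu x (x + t *: th).
rewrite opprD addrA subrr sub0r enormN enormZ th1 mulr1 ler_norml => /andP[_ H2].
have H3 : lam * L * `|t| `^ gam <= e.
  have [->|t0] := eqVneq t 0; first by rewrite normr0 powR0 ?gt_eqF// mulr0 ltW.
  by apply: r2P; rewrite normr_gt0 t0.
have H4 : lam * (finf W x - L * `|t| `^ gam) <= lam * w (x + t *: th).
  by rewrite ler_wpM2l//; lra.
lra.
Qed.

End Infimum.

Context (Om Y : set 'rV[R]_N) (rho : R).
Context (N0 : (0 < N)%N) (oOm : open Om) (rho0 : 0 < rho) (Y0 : Y !=set0).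
Context (HY : forall y, Y y -> Om `<=` eball y rho).
Context (HG : forall x, ~ Om x -> exists2 y, Y y & rho <= enorm (x - y)).

(** The class of the Perron method. The source term [1] makes nonzero solutions
possible below the critical value of [lam]; the bound by the barriers makes the
class equi-Hoelder and forces zero values outside the domain. *)
Definition wclass (lam K : R) w := [/\ continuous w, (forall x, 0 <= w x),
  (forall y x, Y y -> w x <= K * ballpow s y rho x) &
  (forall x th, Om x -> esphere th -> SP s w x th (lam * w x + 1))].

Let Bm : R := (rho ^+ 2) `^ gam.
Let F0 : R := (1 - s) / (2 * s * rho).
Let Cb : R := (2 * rho) `^ gam.

Let Bm0 : 0 < Bm. Proof. by rewrite powR_gt0// exprn_gt0. Qed.
Let F00 : 0 < F0. Proof. by rewrite divr_gt0// mulr_gt0// mulr_gt0. Qed.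
Let Cb0 : 0 < Cb. Proof. by rewrite powR_gt0// mulr_gt0. Qed.

Section ClassFacts.
Context (lam K : R) (lam0 : 0 <= lam) (K0 : 0 < K).

Lemma wclass_bdcont w : wclass lam K w -> bdcont w.
Proof.
move=> [cw w0 wK _]; split => //; exists (K * Bm) => x.
rewrite ger0_norm//; case: Y0 => y Yy; rewrite (le_trans (wK y x Yy))//.
by rewrite ler_wpM2l ?(ltW K0)// ballpow_le.
Qed.

Lemma wclass_out w x : wclass lam K w -> ~ Om x -> w x = 0.
Proof.
move=> [cw w0 wK _] /HG[y Yy yx]; apply/eqP; rewrite eq_le w0 andbT.
by rewrite (le_trans (wK y x Yy))// ballpow_eq0// mulr0.
Qed.

Lemma wclass_bound w x z : wclass lam K w -> ~ Om z ->
  w x <= K * Cb * enorm (x - z) `^ gam.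
Proof.
move=> [cw w0 wK _] /HG[y Yy yz]; rewrite (le_trans (wK y x Yy))//.
by rewrite -mulrA ler_wpM2l ?(ltW K0)// ballpow_bound.
Qed.

Lemma wclass_SP0 w x th : wclass lam K w -> Om x -> esphere th -> SP s w x th 0.
Proof.
move=> [cw w0 wK wSP] Ox th1; apply: SP_leF (wSP _ _ Ox th1).
by rewrite addr_ge0// mulr_ge0.
Qed.

Lemma wclass_hol w : wclass lam K w -> hol s (K * Cb) w.
Proof.
move=> cw; case: Y0 => y Yy; apply: (hol_of_SP (HY Yy)) => //.
- exact: wclass_bdcont cw.
- by case: cw.
- by move=> x; exact: wclass_out.
- by move=> x th; exact: wclass_SP0.
- exact: mulr_gt0.
- by move=> x z; exact: wclass_bound.
Qed.
(** The pointwise infimum of the class is in the class: continuity comes from the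
common modulus, the inequality on lines from [SP_finf]. *)
Lemma perron : wclass lam K !=set0 -> exists2 u, wclass lam K u &
  forall w, wclass lam K w -> forall x, u x <= w x.
Proof.
move=> W0; exists (finf (wclass lam K)); last first.
  by move=> w Ww x; apply: finf_le Ww => w' [].
have Wge0 w : wclass lam K w -> forall x, 0 <= w x by case.
have KC : 0 <= K * Cb by rewrite mulr_ge0 ?ltW.
split.
- apply: (hol_continuous hs (L := K * Cb)); apply: hol_finf => //.
  by move=> w; exact: wclass_hol.
- by move=> x; apply: finf_ge => // w /Wge0.
- move=> y x Yy; case: (W0) => w Ww; apply: (le_trans (finf_le Wge0 x Ww)).
  by case: Ww => _ _ + _; exact.
- apply: (SP_finf W0 Wge0 oOm KC lam0).
  + by move=> w; exact: wclass_bdcont.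
  + by move=> w; exact: wclass_hol.
  + by move=> w x th [_ _ _]; exact.
Qed.

Lemma ex_unit : exists th : 'rV[R]_N, esphere th.
Proof.
have /unit_dir[th [th1 _]] : (0 : 'rV[R]_N) != const_mx 1.
  apply/eqP => /matrixP/(_ 0 (Ordinal N0)); rewrite !mxE => /eqP.
  by rewrite eq_sym oner_eq0.
by exists th.
Qed.

(** At a zero of a nonnegative function the constant zero touches from below,
and the integral is nonnegative. *)
Lemma SP_zero w x th F : bdcont w -> (forall x, 0 <= w x) -> w x = 0 ->
  SP s w x th F -> 0 < F -> False.
Proof.
move=> bw w0 wx H F1.
have := H 0 0 1 ltr01 _ (1 / 2).
rewrite mul0r addr0 => K1.
have {}K1 : Out s w x th (1 / 2) <= - F.
  apply: K1; last by apply/andP; split; lra.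
  by move=> t _; rewrite wx !mul0r subr0 addr0.
have : 0 <= Out s w x th (1 / 2).
  have l0 : lingr (fun=> 0 : R) by exact: lingr_cst.
  rewrite (_ : 0 = Kint s (1 / 2) (fun=> 0 : R)); last first.
    by rewrite Kint_cst// mul0r.
  apply: Kint_le => //; first exact: lingr_secdiff.
  by move=> t _; rewrite /secdiff wx mulr0 subr0 addr_ge0.
lra.
Qed.

Lemma wclass_pos w x : wclass lam K w -> Om x -> 0 < w x.
Proof.
move=> cw Ox; have [_ w0 _ wSP] := cw.
rewrite lt_neqAle w0 andbT; apply/eqP => /esym wx.
have [th th1] := ex_unit.
apply: (SP_zero (wclass_bdcont cw) w0 wx (wSP _ _ Ox th1)).
by rewrite wx mulr0 add0r.
Qed.

Context (u : 'rV[R]_N -> R) (cu : wclass lam K u)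
  (umin : forall w, wclass lam K w -> forall x, u x <= w x).

(** If [u <= m], the multiple of the barrier on the right is a supersolution
with source [lam m + 1], which dominates [lam u + 1]. So the minimum with [u]
belongs to the class, and minimality gives the bound; it does not involve [K]. *)
Lemma perron_barrier m y x : (forall x, u x <= m) -> Y y ->
  u x <= (lam * m + 1) / F0 * ballpow s y rho x.
Proof.
move=> um Yy; pose B := (lam * m + 1) / F0.
have m0 : 0 <= m by case: cu => _ /(_ 0) + _ _ => /le_trans; apply.
have B0 : 0 < B by rewrite divr_gt0// ltr_wpDl// mulr_ge0.
pose b x := B * ballpow s y rho x.
have bpy := bdcont_ballpow hs y rho.
have cb : continuous b by apply: continuous_scalef; exact: bpy.1.
have bge z : 0 <= b z by apply: (mulr_ge0 (ltW B0)); exact: ballpow_ge0.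
have bb : bdcont b.
  split => //; exists (B * Bm) => z.
  rewrite ger0_norm//; apply: (ler_wpM2l (ltW B0)); exact: ballpow_le.
pose w x := Num.min (u x) (b x).
have [cu1 u0 uK uSP] := cu.
have wu z : w z <= u z by rewrite /w ge_min lexx.
have wb z : w z <= b z by rewrite /w ge_min lexx orbT.
have cw : continuous w by exact: continuous_minr.
have w0 z : 0 <= w z.
  by rewrite le_min u0 bge.
have bw : bdcont w.
  split => //; have [_ [M uM]] := wclass_bdcont cu; exists M => z.
  by rewrite ger0_norm// (le_trans (wu z))// (le_trans (ler_norm _)).
have W : wclass lam K w.
  split; [exact: cw|exact: w0| |].
    by move=> y' x' Yy'; rewrite (le_trans (wu _))// uK.
  move=> x' th Ox' th1; have [ub|bu] := leP (u x') (b x').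
    have wx : w x' = u x' by rewrite /w min_l.
    by rewrite wx; apply: (SP_touch_le hs (wclass_bdcont cu) bw wu wx); exact: uSP.
  have wx : w x' = b x' by rewrite /w min_r// ltW.
  apply: (SP_touch_le hs bb bw wb wx).
  have HSP := SP_scale hs hs1 bpy B0
     (SP_ballpow hs hs1 rho0 (HY Yy Ox') th1).
  apply: SP_leF HSP; rewrite /B divfK ?gt_eqF//.
  by rewrite lerD2r ler_wpM2l// (le_trans (wu _)).
exact: le_trans (umin W x) (wb x).
Qed.

(* linear arithmetic on the goal alone, as the context of the next proof is large *)
Local Ltac lra_here :=
  clear - umin cu hs hs1 lam0 K0 HG HY Y0 N0 oOm rho0 gam0 gam1 s0 s1 Bm0 F00
    Cb0; lra.

(** If all directions stay below [- (lam u x + 1) - eta], then [u] lies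
globally below a paraboloid [P] touching at [x], lowered by [e0^2]. The
minimum [w] of [u] and [P] still belongs to the class: where [P] is the smaller
one, which happens only within [e0] of [x], the integral of [w] is at most that
of [P] for small [t] and is close to that of [u] at [x] otherwise. But
[w x < u x]. *)
Lemma perron_SB x : Om x -> SB s u x (lam * u x + 1).
Proof.
move=> Ox p C r r0 touch d eta /andP[d0 dr] eta0.
have [cu1 u0 uK uSP] := cu.
have bu := wclass_bdcont cu; have hu := wclass_hol cu.
have ux0 := wclass_pos cu Ox.
have L0 : 0 <= K * Cb by rewrite mulr_ge0 ?ltW.
set L := K * Cb in hu L0.
pose dd := d `^ (2 - 2 * s) / (1 - s).
apply: contrapT => nex.
have neg th : esphere th -> Out s u x th d + C * dd < - (lam * u x + 1) - eta.
  by move=> th1; rewrite ltNge; apply/negP => H; apply: nex; exists th.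
have [_ [B uB]] := bu.
have uB' z : u z <= B by rewrite (le_trans (ler_norm _)).
have B0 : 0 <= B by exact: le_trans (u0 x) (uB' x).
have r2 : 0 < r ^+ 2 by rewrite exprn_gt0.
(* the last two terms take over where the paraboloid no longer touches *)
pose C2 := `|C| + enorm p / r + B / r ^+ 2.
have C20 : 0 <= C2 by rewrite !addr_ge0 ?divr_ge0 ?enorm_ge0 ?(ltW r0) ?(ltW r2).
have glob z : u (x + z) <= u x + dotv p z + C2 * dotv z z.
  have zz := dotv_ge0 z.
  have [zr|zr] := leP (enorm z) r.
    apply: (le_trans (touch z zr)); rewrite lerD2l ler_wpM2r//.
    rewrite /C2 -addrA (le_trans (ler_norm C))// lerDl addr_ge0//.
      by rewrite divr_ge0 ?enorm_ge0 ?(ltW r0).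
    by rewrite divr_ge0 ?(ltW r2).
  have H1 : - (enorm p * enorm z) <= dotv p z.
    by rewrite lerNl -dotvNl -(enormN p) CauchySchwarz_dotv.
  rewrite -enorm_sqr /C2 !mulrDl.
  have H2 : enorm p * enorm z <= enorm p / r * enorm z ^+ 2.
    have -> : enorm p / r * enorm z ^+ 2 = enorm p * (enorm z * (enorm z / r)).
      by ring.
    by rewrite ler_wpM2l ?enorm_ge0// ler_peMr ?enorm_ge0// ler_pdivlMr// mul1r ltW.
  have H3 : B <= B / r ^+ 2 * enorm z ^+ 2.
    rewrite -mulrA ler_peMr// mulrC ler_pdivlMr// mul1r ler_pXn2r// ?nnegrE ?(ltW r0) ?enorm_ge0//.
    exact: ltW.
  have H4 : 0 <= `|C| * enorm z ^+ 2 by rewrite mulr_ge0// sqr_ge0.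
  by move: H1 H2 H3 H4 (uB' (x + z)) (u0 x); lra_here.
(* opening larger by one, so that lowering by [e0 ^+ 2] acts within [e0] of [x] *)
pose C1 := C2 + 1.
have C10 : 0 < C1 by rewrite ltr_wpDl.
have p0 : 0 < 2 - 2 * s by have := s1; lra.
have e40 : 0 < eta / 4 by exact: divr_gt0.
(* scale on which the second differences of the paraboloid are negligible *)
have [q1 q10 q1P] := @powR_small _ ((C1 + `|C|) / (1 - s)) (eta / 4) _ p0 e40.
pose q := Num.min q1 d / 2.
have md0 : 0 < Num.min q1 d by rewrite lt_min q10.
have q0 : 0 < q by exact: divr_gt0.
have qm : q < Num.min q1 d by rewrite ltr_pdivrMr// ltr_pMr// ltr1n.
have [qq1 qd] : q < q1 /\ q < d by move: qm; rewrite lt_min => /andP.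
have qP := q1P q; rewrite q0 qq1 in qP; have {}qP := qP isT.
pose qq := q `^ (2 - 2 * s) / (1 - s).
have qq0 : 0 <= qq by rewrite divr_ge0 ?powR_ge0 ?(ltW s1).
have {}qP : (C1 + `|C|) * qq <= eta / 4 by rewrite /qq mulrA mulrAC.
pose k := q `^ (- (2 * s)) / (2 * s).
have k0 : 0 < k by rewrite divr_gt0 ?powR_gt0 ?mulr_gt0.
have /nbhs_enormP [r1 r10 Hr] : nbhs x Om by exact: open_nbhs_nbhs.
have np0 : 0 <= enorm p by exact: enorm_ge0.
have e16 : 0 < eta / 16 by exact: divr_gt0.
have [a1 a10 a1P] := @powR_small _ (2 * L * k) (eta / 16) gam gam0 e16.
have [a2 a20 a2P] := @powR_small _ (2 * (enorm p + 1) * k) (eta / 8) 1 ltr01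
  (divr_gt0 eta0 (ltr0Sn _ 7)).
have [a3 a30 a3P] := @powR_small _ (enorm p + 1) (u x) 1 ltr01 ux0.
have [a4 a40 a4P] := @powR_small _ (lam * L) (eta / 4) gam gam0 e40.
pose m := Num.min (Num.min (Num.min a1 a2) (Num.min a3 a4)) (Num.min 1 r1).
have m0 : 0 < m by rewrite !lt_min a10 a20 a30 a40 r10 ltr01.
pose e0 := m / 2.
have e00 : 0 < e0 by exact: divr_gt0.
have e0m : e0 < m by rewrite ltr_pdivrMr// ltr_pMr// ltr1n.
have [[ea1 ea2] [ea3 ea4] [e01 er1]] :
   [/\ e0 < a1 /\ e0 < a2, e0 < a3 /\ e0 < a4 & e0 < 1 /\ e0 < r1].
  by move: e0m; rewrite !lt_min => /andP[/andP[/andP[-> ->] /andP[-> ->]] /andP[-> ->]].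
have {}a1P := a1P e0; rewrite e00 ea1 in a1P; have {}a1P := a1P isT.
have {}a2P := a2P e0; rewrite e00 ea2 (powRr1 (ltW e00)) in a2P; have {}a2P := a2P isT.
have {}a3P := a3P e0; rewrite e00 ea3 (powRr1 (ltW e00)) in a3P; have {}a3P := a3P isT.
have {}a4P := a4P e0; rewrite e00 ea4 in a4P; have {}a4P := a4P isT.
have e02 : e0 ^+ 2 <= e0 by rewrite expr2 ler_piMr// ltW.
pose P z := u x + dotv p z + C1 * dotv z z - e0 ^+ 2.
pose P' y := P (- x + y).
pose w y := Num.min (u y) (P' y).
have cw : continuous w.
  apply: continuous_minr => //.
  have cid := @continuous_translate R N (- x).
  have cp : continuous (fun z : 'rV[R]_N => p) by exact: cst_continuous.
  apply: continuous_subf; last exact: cst_continuous.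
  apply: (@continuous_addf _ _ (fun y => u x + dotv p (- x + y))).
    apply: continuous_addf; first exact: cst_continuous.
    exact: (continuous_dotv cp cid).
  by apply: continuous_scalef; exact: (continuous_dotv cid cid).
have P'E z : P' (x + z) = P z by rewrite /P' addrA addNr add0r.
have wu y : w y <= u y by rewrite /w ge_min lexx.
have wP y : w y <= P' y by rewrite /w ge_min lexx orbT.
have near0 z : P z < u (x + z) -> enorm z < e0.
  move=> Pu; have := glob z; rewrite /P /C1 in Pu.
  move=> G; have : dotv z z < e0 ^+ 2 by move: Pu G; lra_here.
  by rewrite -enorm_sqr ltr_pXn2r// ?nnegrE ?enorm_ge0// ltW.
have Plow z : enorm z < e0 -> u x - (enorm p + 1) * e0 <= P z.
  move=> ze; have H1 : - (enorm p * enorm z) <= dotv p z.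
    by rewrite lerNl -dotvNl -(enormN p) CauchySchwarz_dotv.
  have H2 : enorm p * enorm z <= enorm p * e0 by rewrite ler_wpM2l// ltW.
  have H3 : 0 <= C1 * dotv z z by rewrite mulr_ge0 ?dotv_ge0 ?(ltW C10).
  by rewrite /P; move: H1 H2 H3 e02; lra_here.
have w0 y : 0 <= w y.
  rewrite le_min u0/=; have [uP|Pu] := leP (u y) (P' y).
    by rewrite (le_trans (u0 y)).
  have {}Pu : P (- x + y) < u (x + (- x + y)) by rewrite addrA addrN add0r.
  by have := Plow _ (near0 _ Pu); move: a3P; rewrite /P'; lra_here.
have bw : bdcont w.
  split => //; exists B => z.
  by rewrite ger0_norm// (le_trans (wu z)).
have W : wclass lam K w.
  split; [exact: cw|exact: w0| |].
    by move=> y' x' Yy'; rewrite (le_trans (wu _))// uK.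
  move=> x' th Ox' th1; have [uP|Pu] := leP (u x') (P' x').
    have wx : w x' = u x' by rewrite /w min_l.
    by rewrite wx; apply: (SP_touch_le hs bu bw wu wx); exact: uSP.
  have wx : w x' = P' x' by rewrite /w min_r// ltW.
  have [z x'E] : exists z, x' = x + z by exists (- x + x'); rewrite addrA addrN add0r.
  subst x'; rewrite P'E in Pu wx.
  have ze := near0 _ Pu.
  have Lz : L * enorm z `^ gam <= L * e0 `^ gam.
    rewrite ler_wpM2l// ge0_ler_powR ?nnegrE ?(ltW gam0) ?(ltW e00) ?enorm_ge0//.
    exact: ltW.
  have wlam : lam * w (x + z) + 1 <= lam * u x + 1 + eta / 4.
    have H1 := wu (x + z); have := hu (x + z) x.
    rewrite addrAC subrr add0r ler_norml => /andP[_ H2].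
    have : lam * w (x + z) <= lam * (u x + L * e0 `^ gam).
      by rewrite ler_wpM2l//; move: H1 H2 Lz; lra_here.
    by move: a4P; lra_here.
  apply: SP_intro => // p' C' r' _ _ e d1 e0' d10.
  pose d' := Num.min d1 q / 2.
  have md1 : 0 < Num.min d1 q by rewrite lt_min d10.
  have d'0 : 0 < d' by exact: divr_gt0.
  have d'm : d' < Num.min d1 q by rewrite ltr_pdivrMr// ltr_pMr// ltr1n.
  have [d'd1 d'q] : d' < d1 /\ d' < q by move: d'm; rewrite lt_min => /andP.
  exists d'; first by rewrite d'0.
  have lw := lingr_secdiff (x + z) th bw.
  have lu := lingr_secdiff x th bu.
  have thn : dotv th th = 1 by rewrite -enorm_sqr th1 expr1n.
  have I1 : Out s w (x + z) th d' <= Out s w (x + z) th q + C1 * qq.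
    have := @Kint_split_le _ _ hs _ d' q C1 hs1 lw d'0 (ltW d'q).
    move=> H; apply: le_trans (H _) _.
      move=> t _; rewrite /secdiff wx -!addrA.
      have := wP (x + (z + t *: th)); have := wP (x + (z - t *: th)).
      rewrite !P'E /P dotv_line -scaleNr dotv_line thn !dotvDr !dotvZr.
      by lra_here.
    rewrite lerD2l ler_wpM2l ?(ltW C10)// ler_wpM2r ?invr_ge0 ?(ltW s1)//.
    by rewrite gerBl powR_ge0.
  pose E := 2 * (L * e0 `^ gam) + 2 * ((enorm p + 1) * e0).
  have I2 : Out s w (x + z) th q <= Out s u x th q + E * k.
    apply: Out_le => // t; rewrite /secdiff wx.
    have eqx v : enorm (x + z + v - (x + v)) = enorm z.
      by congr enorm; rewrite opprD addrACA subrr addr0 addrAC subrr add0r.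
    have A1 := hu (x + z + t *: th) (x + t *: th).
    have A2 := hu (x + z - t *: th) (x - t *: th).
    rewrite eqx in A1; rewrite eqx in A2.
    have B1 := wu (x + z + t *: th); have B2 := wu (x + z - t *: th).
    have B3 := Plow _ ze.
    move: A1 A2; rewrite !ler_norml => /andP[_ A1] /andP[_ A2].
    rewrite /E; move: A1 A2 B1 B2 B3 Lz; lra_here.
  have I3 : Out s u x th q <= Out s u x th d + C * (dd - qq).
    have := @Kint_split_le _ _ hs _ q d C hs1 lu q0 (ltW qd).
    rewrite mulrBl -/dd -/qq; apply => t /andP[qt td].
    have t0 : 0 < t by exact: lt_le_trans qt.
    have T1 := touch (t *: th); have T2 := touch ((- t) *: th).
    rewrite enormZ th1 mulr1 (gtr0_norm t0) in T1.
    rewrite enormZ th1 mulr1 normrN (gtr0_norm t0) in T2.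
    have tr : t <= r by rewrite (le_trans td)// ltW.
    have {}T1 := T1 tr; have {}T2 := T2 tr.
    move: T1 T2; rewrite !dotvZr !dotvZl thn scaleNr /secdiff; lra_here.
  have I4 := neg th th1.
  have I5 : - (C * qq) <= `|C| * qq.
    by rewrite -mulNr ler_wpM2r// (le_trans (ler_norm _))// normrN.
  have Ek : E * k <= eta / 4 + eta / 16.
    by move: a1P a2P eta0; rewrite /E; lra_here.
  by move: I1 I2 I3 I4 I5 Ek wlam qP eta0 e0'; lra_here.
have := umin W x; rewrite le_min lexx /P' addNr /P.
have d00 y : dotv y (0 : 'rV[R]_N) = 0.
  by rewrite -[0 in LHS](scale0r (0 : 'rV[R]_N)) dotvZr mul0r.
rewrite !d00 mulr0 !addr0/=.
by move: (exprn_gt0 2 e00); lra_here.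
Qed.

End ClassFacts.

End Perron.

(** * Uniform limits of equi-Hoelder functions *)

Section UniformLimit.
Context {R : realType} {N : nat} (s : R) (hs : 1 / 2 < s).
Implicit Types (x y z : 'rV[R]_N).
Let gam := (2 * s - 1) / 2.
Let gam0 : 0 < gam. Proof. by rewrite /gam divr_gt0//; have := hs; lra. Qed.

Lemma compact_cball y r : compact [set z : 'rV[R]_N | enorm (z - y) <= r].
Proof.
have -> : [set z : 'rV[R]_N | enorm (z - y) <= r] =
    (fun z => y + z) @` [set z : 'rV[R]_N | enorm z <= r].
  apply/seteqP; split => z /=.
    by move=> zr; exists (z - y) => //; rewrite addrC subrK.
  by move=> [z' z'r <-]; rewrite addrAC subrr add0r.
apply: continuous_compact; last exact: compact_closed_eball.
by apply: continuous_subspaceT; exact: continuous_translate.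
Qed.
(** The pointwise limit along an ultrafilter exists by boundedness; it
inherits the modulus, and a finite covering of the ball makes the convergence
uniform. *)
Lemma equiholder_cluster (v : nat -> 'rV[R]_N -> R) (L r : R) y0 : 0 <= L ->
  (forall n, hol s L (v n)) -> (forall n x, 0 <= v n x <= 1) ->
  (forall n x, r < enorm (x - y0) -> v n x = 0) ->
  exists v', hol s L v' /\ forall (e : R) m, 0 < e ->
    exists2 n, (m <= n)%N & forall x, `|v n x - v' x| <= e.
Proof.
move=> L0 vh v01 vout.
have [G [UG oG]] := ultraFilterLemma (eventually_filter : ProperFilter \oo).
pose A x := [set a : R | G [set n | a <= v n x]].
have A0 x : A x 0.
  by apply: filterS (@filterT _ G _) => n _ /=; case/andP: (v01 n x).
have A1 x a : A x a -> a <= 1.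
  move=> Aa; have [n /= an] := @filter_ex _ G _ _ Aa.
  by rewrite (le_trans an)//; case/andP: (v01 n x).
have hA x : has_sup (A x) by split; [exists 0|exists 1 => a; exact: A1].
pose v' x := sup (A x).
have near1 x e : 0 < e -> G [set n | `|v n x - v' x| <= e].
  move=> e0; have [a Aa ae] := sup_adherent e0 (hA x).
  have : G [set n | v n x < v' x + e].
    have [//|/= H] := in_ultra_setVsetC [set n | v n x < v' x + e] UG.
    have : A x (v' x + e).
      by apply: filterS H => n /= /negP; rewrite -leNgt.
    move/(sup_upper_bound (hA x)); rewrite -/(v' x) => H'; exfalso; lra.
  move=> G2; apply: filterS (filterI Aa G2) => n [/= an nv].
  by rewrite ler_norml; apply/andP; split; rewrite /v'; rewrite /v' in nv; lra.
have hv' : hol s L v'.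
  move=> x y; apply/ler_addgt0Pr => e e0.
  have e20 : 0 < e / 2 by exact: divr_gt0.
  have [n /= [nx ny]] := @filter_ex _ G _ _ (filterI (near1 x _ e20) (near1 y _ e20)).
  have := vh n x y; move: nx ny; rewrite !ler_norml.
  by move=> /andP[? ?] /andP[? ?] /andP[? ?]; apply/andP; split; lra.
have v'out x : r < enorm (x - y0) -> v' x = 0.
  move=> xr; apply/eqP; rewrite -normr_le0; apply/ler_addgt0Pr => e e0.
  have [n /=] := @filter_ex _ G _ _ (near1 x _ e0).
  by rewrite vout// sub0r normrN add0r.
exists v'; split => // e m e0.
have e20 : 0 < e / 2 by exact: divr_gt0.
have e80 : 0 < e / 8 by exact: divr_gt0.
have [d0 d00 dP] := @powR_small _ L (e / 8) gam gam0 e80.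
have /compact_near_coveringP/(_ nat G
    (fun n x => `|v n x - v' x| <= e) _) H := @compact_cball y0 r.
have : \forall n \near G, [set z | enorm (z - y0) <= r] `<=`
    (fun x => `|v n x - v' x| <= e).
  apply: H => x _.
  exists ([set x' | enorm (x' - x) < d0], [set n | `|v n x - v' x| <= e / 2]).
    by split => /=; [exact: nbhs_enorm_lt|exact: near1].
  move=> [x' n] [/= xd nx].
  have Ls : L * enorm (x' - x) `^ gam <= e / 8.
    have [->|xx] := eqVneq x' x.
      by rewrite subrr enorm0 powR0 ?gt_eqF// mulr0 ltW.
    apply: dP; rewrite xd andbT lt_neqAle eq_sym enorm_ge0 andbT.
    by apply: contraNN xx => /eqP/enorm_eq0/subr0_eq ->.
  have := vh n x' x; have := hv' x' x; move: nx; rewrite !ler_norml.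
  by move=> /andP[? ?] /andP[? ?] /andP[? ?]; apply/andP; split; lra.
move=> GH; have Gm : G [set n | (m <= n)%N] by apply: oG; exists m.
have [n /= [Hn mn]] := @filter_ex _ G _ _ (filterI GH Gm).
exists n => // x; have [xr|xr] := leP (enorm (x - y0)) r; first exact: Hn.
by rewrite vout// v'out// subrr normr0 ltW.
Qed.

End UniformLimit.

(** * The critical coefficient and the eigenfunction *)

Section Eigen.
Context {R : realType} {N : nat} (s : R) (hs : 1 / 2 < s) (hs1 : s < 1).
Implicit Types (u w : 'rV[R]_N -> R) (x y z th : 'rV[R]_N) (d r t : R).

Let gam := (2 * s - 1) / 2.
Let gam0 : 0 < gam. Proof. by rewrite /gam divr_gt0//; have := hs; lra. Qed.
Let s0 : 0 < s. Proof. by have := hs; lra. Qed.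
Let s1 : 0 < 1 - s. Proof. by rewrite subr_gt0. Qed.

Lemma SB_scale w x F (c : R) : bdcont w -> 0 < c -> SB s w x F ->
  SB s (fun y => c * w y) x (c * F).
Proof.
move=> bw c0 H p C r r0 touch d e /andP[d0 dr] e0.
have ec0 : 0 < e / c by exact: divr_gt0.
have drp : 0 < d < r by rewrite d0.
have [|th th1 K] := H (c^-1 *: p) (C / c) r r0 _ d (e / c) drp ec0.
  move=> z /touch T; rewrite -(ler_pM2l c0); apply: (le_trans T).
  rewrite dotvZl le_eqVlt; apply/orP; left; apply/eqP; field.
  by rewrite gt_eqF.
exists th => //.
have -> : Out s (fun y => c * w y) x th d = c * Out s w x th d.
  rewrite /Out -KintZ//; last exact: lingr_secdiff.
  by congr Kint; apply/funext => t; rewrite /secdiff; ring.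
have sn : 1 - s != 0 by rewrite gt_eqF.
have -> : - (c * F) - e = c * (- F - e / c) by field; rewrite gt_eqF.
have -> : c * Out s w x th d + C * (d `^ (2 - 2 * s) / (1 - s)) =
    c * (Out s w x th d + C / c * (d `^ (2 - 2 * s) / (1 - s))).
  by field; rewrite sn (gt_eqF c0).
by rewrite ler_pM2l.
Qed.

Context (Om Y : set 'rV[R]_N) (rho : R).
Context (N0 : (0 < N)%N) (oOm : open Om) (rho0 : 0 < rho) (Y0 : Y !=set0).
Context (Om0 : Om !=set0).
Context (HY : forall y, Y y -> Om `<=` eball y rho).
Context (HG : forall x, ~ Om x -> exists2 y, Y y & rho <= enorm (x - y)).

Let Bm : R := (rho ^+ 2) `^ gam.
Let F0 : R := (1 - s) / (2 * s * rho).
Let Cb : R := (2 * rho) `^ gam.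

Let Bm0 : 0 < Bm. Proof. by rewrite powR_gt0// exprn_gt0. Qed.
Let F00 : 0 < F0. Proof. by rewrite divr_gt0// mulr_gt0// mulr_gt0. Qed.
Let Cb0 : 0 < Cb. Proof. by rewrite powR_gt0// mulr_gt0. Qed.

Local Notation wcl := (wclass s Om Y rho).

(** The infimum of the ball barriers has source [F0] and is at most [Bm]; so
twice its multiple by [1/F0] has source [2], which is at least [lam w + 1] for
this value of [lam]. *)
Lemma SP_class_small : wcl (F0 / (2 * Bm)) (2 / F0) !=set0.
Proof.
pose W := [set w | exists2 y, Y y & w = ballpow s y rho].
have W0 : W !=set0 by case: Y0 => y Yy; exists (ballpow s y rho); exists y.
have Wge0 w : W w -> forall x, 0 <= w x.
  by move=> [y Yy ->] x; exact: ballpow_ge0.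
have Wbd w : W w -> bdcont w by move=> [y Yy ->]; exact: bdcont_ballpow.
have Whol w : W w -> hol s Cb w.
  move=> [y Yy ->]; have sb : eball y rho `<=` eball y rho by [].
  apply: (hol_of_SP hs hs1 sb) => //.
  - exact: bdcont_ballpow.
  - by move=> x; exact: ballpow_ge0.
  - by move=> x /negP; rewrite -leNgt => xr; apply: ballpow_eq0.
  - move=> x th xr th1; apply: SP_leF (SP_ballpow hs hs1 rho0 xr th1).
    exact: ltW.
  - move=> x z /negP; rewrite -leNgt => zr; exact: ballpow_bound.
have WSP w x th : W w -> Om x -> esphere th -> SP s w x th (0 * w x + F0).
  move=> [y Yy ->] Ox th1; rewrite mul0r add0r.
  exact: (SP_ballpow hs hs1 rho0 (HY Yy Ox) th1).
have K0 : 0 < 2 / F0 by exact: divr_gt0.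
have SPf := @SP_finf _ _ s hs hs1 W W0 Wge0 Om Cb 0 F0 oOm (ltW Cb0) (lexx 0) Wbd Whol WSP.
have hf := hol_finf W0 Wge0 Whol.
have cf := hol_continuous hs hf.
have f0 x : 0 <= finf W x by apply: finf_ge => // w /Wge0.
have fle y x : Y y -> finf W x <= ballpow s y rho x.
  by move=> Yy; apply: finf_le => //; exists y.
have fB x : finf W x <= Bm.
  by case: Y0 => y Yy; rewrite (le_trans (fle y x Yy))// ballpow_le.
have bf : bdcont (finf W) by split => //; exists Bm => x; rewrite ger0_norm.
exists (fun x => 2 / F0 * finf W x); split.
- exact: continuous_scalef.
- by move=> x; rewrite mulr_ge0// ltW.
- by move=> y x Yy; rewrite ler_wpM2l ?(ltW K0)// fle.
- move=> x th Ox th1.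
  apply: SP_leF (SP_scale hs hs1 bf K0 (SPf x th Ox th1)).
  rewrite mul0r add0r divfK ?gt_eqF// mulrA.
  have -> : F0 / (2 * Bm) * (2 / F0) = Bm^-1 by field; rewrite !gt_eqF.
  by rewrite -[2]/(1 + 1) lerD2r ler_pdivrMl// mulr1.
Qed.
(** Doubling doubles the source; of the [2] thus obtained, [1] is spent on
[u / m <= 1]. *)
Lemma wclass_grow lam K u m : 0 <= lam -> 0 < K -> wcl lam K u ->
  (forall x, u x <= m) -> 0 < m ->
  wcl (lam + (2 * m)^-1) (2 * K) (fun x => 2 * u x).
Proof.
move=> lam0 K0 cu um m0; have bu := wclass_bdcont hs Y0 K0 cu.
have [cu1 u0 uK uSP] := cu.
split.
- exact: continuous_scalef.
- by move=> x; rewrite mulr_ge0.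
- by move=> y x Yy; rewrite -mulrA ler_wpM2l// uK.
- move=> x th Ox th1.
  apply: SP_leF (SP_scale hs hs1 bu (ltr0Sn _ 1) (uSP x th Ox th1)).
  have -> : (lam + (2 * m)^-1) * (2 * u x) = 2 * (lam * u x) + u x / m.
    by field; rewrite gt_eqF.
  have : u x / m <= 1 by rewrite ler_pdivrMr// mul1r.
  by lra.
Qed.

(** The cone bound is a Harnack inequality: on a segment of fixed length [2 r]
around a point of the domain, [w] is at least half of its central value [a]. The
parabola of opening [a / r^2] touches [w] from below within this segment. At the
contact point [lam w] is bounded by the explicit opening and the mass of the
kernel outside, both of them multiples of [w]. *)
Lemma wclass_lam_bound : exists B, forall lam K, 0 <= lam -> 0 < K ->
  wcl lam K !=set0 -> lam <= B.
Proof.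
case: Om0 => x0 Ox0; have [th th1] := ex_unit (R := R) N0.
have /nbhs_enormP [D D0 HD] : nbhs x0 Om by exact: open_nbhs_nbhs.
(* at distance [r] the cone of height [a] and base [D] has height [a / 2] *)
pose r := D * (2^-1) `^ gam^-1.
have h0 : 0 < (2^-1 : R) by rewrite invr_gt0.
have r0 : 0 < r by rewrite mulr_gt0// powR_gt0.
have rD : (r / D) `^ gam = 2^-1.
  rewrite /r mulrAC divff ?gt_eqF// mul1r -powRrM mulVf ?gt_eqF// powRr1//.
have rlt : r < D.
  rewrite ltNge; apply/negP => Dr.
  have : 1 <= (r / D) `^ gam.
    have e1 : (1 : R) `^ gam = 1 by rewrite powR1.
    rewrite -[leLHS]e1 ge0_ler_powR ?nnegrE ?(ltW gam0) ?divr_ge0 ?(ltW r0) ?(ltW D0)//.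
    by rewrite ler_pdivlMr// mul1r.
  by rewrite rD; lra.
exists (2 * (r `^ (2 - 2 * s) / (1 - s)) / r ^+ 2 + r `^ (- (2 * s)) / s).
move=> lam K lam0 K0 [w cw].
have bw := wclass_bdcont hs Y0 K0 cw.
have a0 := wclass_pos hs N0 Y0 K0 cw Ox0; set a := w x0 in a0.
have [cw1 w0 wK wSP] := cw.
have r20 : 0 < r ^+ 2 by rewrite exprn_gt0.
have aD0 : 0 < a / D `^ gam by rewrite divr_gt0// powR_gt0.
have harnack t : `|t| <= r -> a / 2 <= w (x0 + t *: th).
  move=> tr; case: Y0 => y Yy.
  have := @cone_bound _ _ s hs hs1 Om w x0 th (a / D `^ gam)
     (rho + enorm (x0 - y)) bw w0 _ _ aD0 _ _ t.
  rewrite -/gam -/a => H; apply: le_trans (H _ _ _ _).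
  - have : a / D `^ gam * `|t| `^ gam <= a / 2.
      have -> : a / D `^ gam * `|t| `^ gam = a * (`|t| / D) `^ gam.
        rewrite powRM ?invr_ge0 ?(ltW D0)// -(powR_inv1 (ltW D0)) -powRrM.
        by rewrite mulN1r powRN; ring.
      rewrite ler_wpM2l ?(ltW a0)// -rD.
      rewrite ge0_ler_powR ?nnegrE ?(ltW gam0) ?divr_ge0 ?(ltW r0) ?(ltW D0)//.
      by rewrite ler_wpM2r ?invr_ge0 ?(ltW D0).
    by lra.
  - by move=> z; exact: (wclass_out hs rho0 HG cw).
  - by move=> z Oz; exact: (wclass_SP0 lam0 cw Oz th1).
  - move=> t' nO; have Dt : D <= `|t'|.
      rewrite leNgt; apply/negP => tD; apply: nO; apply: HD.
      by rewrite addrAC subrr add0r enormZ th1 mulr1.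
    rewrite mulrAC ler_pdivlMr ?powR_gt0// ler_wpM2l ?(ltW a0)//.
    by rewrite ge0_ler_powR ?nnegrE ?(ltW gam0) ?(ltW D0).
  - move=> t' tT /(HY Yy); rewrite /eball/= => H'.
    have := enormD (x0 + t' *: th - y) (y - x0).
    rewrite addrA subrK addrAC subrr add0r enormZ th1 mulr1 (enormBC y x0).
    by lra.
pose A := a / r ^+ 2.
have A0 : 0 < A by exact: divr_gt0.
pose h t := w (x0 + t *: th) + A * t ^+ 2.
have ch : continuous h.
  apply: continuous_addf.
    exact: (continuous_compf (@continuous_line _ _ x0 th) cw1).
  by apply: continuous_scalef; exact: exprn_continuous.
have rr : - r <= r by lra.
have [t1 t1r t1min] := @EVT_min _ h _ _ rr (continuous_subspaceT ch).
have {}t1r : `|t1| <= r by rewrite ler_norml; move: t1r; rewrite in_itv.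
have gmin t : h t1 <= h t.
  have [tr|tr] := leP `|t| r; first by apply: t1min; rewrite in_itv/= -ler_norml.
  apply: (@le_trans _ _ (h 0)).
    by apply: t1min; rewrite in_itv/= -ler_norml normr0 ltW.
  rewrite /h scale0r addr0 expr0n mulr0 addr0 -/a.
  have : a <= A * t ^+ 2.
    rewrite /A mulrAC ler_pdivlMr// ler_wpM2l ?(ltW a0)//.
    by rewrite -(real_normK (num_real t)) ler_pXn2r// ?nnegrE ?(ltW r0)// ltW.
  by have := w0 (x0 + t *: th); lra.
set x1 := x0 + t1 *: th.
have Ox1 : Om x1.
  by apply: HD; rewrite /x1 addrAC subrr add0r enormZ th1 mulr1 (le_lt_trans t1r).
have wx1 := harnack t1 t1r; rewrite -/x1 in wx1.
have r20' : 0 < 2 * r by rewrite mulr_gt0.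
have rr2 : 0 < r < 2 * r by rewrite r0 mulrC ltr_pMr// ltr1n.
have := wSP x1 th Ox1 th1 (- (2 * A * t1)) A (2 * r) r20' _ r rr2.
move=> H; have {}H : Out s w x1 th r <= - (lam * w x1 + 1) +
    A * (r `^ (2 - 2 * s) / (1 - s)).
  apply: H => t _; have := gmin (t1 + t); rewrite /h scalerDl addrA -/x1.
  by lra.
have low : - (2 * w x1) * (r `^ (- (2 * s)) / (2 * s)) <= Out s w x1 th r.
  rewrite -Kint_cst//; apply: Kint_le => //; first exact: lingr_cst.
    exact: lingr_secdiff.
  by move=> t _; rewrite /secdiff; have := w0 (x1 + t *: th); have := w0 (x1 - t *: th); lra.
have w10 : 0 < w x1 by apply: lt_le_trans wx1; exact: divr_gt0.
rewrite -(ler_pM2r w10).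
pose E := r `^ (2 - 2 * s) / (1 - s).
have E0 : 0 <= E by rewrite divr_ge0 ?powR_ge0 ?(ltW s1).
have AE : A * E <= 2 * w x1 / r ^+ 2 * E.
  by rewrite ler_wpM2r// /A ler_wpM2r ?invr_ge0 ?(ltW r20)//; lra.
rewrite -/E in H *.
have e1 : 2 * w x1 / r ^+ 2 * E = 2 * E / r ^+ 2 * w x1 by ring.
have e2 : - (2 * w x1) * (r `^ (- (2 * s)) / (2 * s)) = - (r `^ (- (2 * s)) / s * w x1).
  by field; rewrite gt_eqF.
rewrite mulrDl; lra.
Qed.
(** Normalize the least element [u] for [lam] close to [mu] by its supremum [m].
By [wclass_grow] the number [lam + 1/(2m)] is at most [mu], so the remaining
source [1/m] is small. The Hoelder constant comes from [perron_barrier] and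
depends only on [mu]. *)
Lemma approx_eigen : exists2 mu, 0 < mu & exists2 L, 0 <= L &
  forall e, 0 < e -> exists lam e' v,
    [/\ [/\ `|lam - mu| <= e, 0 < e' <= e & 0 <= lam],
       [/\ hol s L v, (forall x, 0 <= v x <= 1),
           (forall x, ~ Om x -> v x = 0) & exists x, 2^-1 <= v x],
       (forall x th, Om x -> esphere th -> SP s v x th (lam * v x + e')) &
       (forall x, Om x -> SB s v x (lam * v x + e'))].
Proof.
pose S := [set lam : R | 0 <= lam /\ exists2 K, 0 < K & wcl lam K !=set0].
pose lam0 := F0 / (2 * Bm).
have lam00 : 0 < lam0 by rewrite divr_gt0// mulr_gt0.
have S0 : S lam0.
  by split; [exact: ltW|exists (2 / F0); [exact: divr_gt0|exact: SP_class_small]].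
have [B HB] := wclass_lam_bound.
have hS : has_sup S.
  by split; [exists lam0|exists B => lam [l0 [K K0 W]]; exact: HB K0 W].
pose mu := sup S.
have lam0mu : lam0 <= mu by exact: sup_upper_bound.
exists mu; first exact: lt_le_trans lam0mu.
pose Kv := (mu + 1) / F0.
have Kv0 : 0 < Kv by rewrite divr_gt0// ltr_wpDl// (le_trans (ltW lam00)).
exists (Kv * Cb); first by rewrite mulr_ge0 ?ltW.
move=> e e0; pose h := Num.min (e / 2) (1 / 2).
have h0 : 0 < h by rewrite lt_min !divr_gt0.
have he : 2 * h <= e by rewrite mulrC -ler_pdivlMr// ge_min lexx.
have h1 : 2 * h <= 1 by rewrite mulrC -ler_pdivlMr// ge_min lexx orbT.
have [lam [lamp [K K0 W]] lamh] := sup_adherent h0 hS; rewrite -/mu in lamh.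
have lammu : lam <= mu by apply: sup_upper_bound => //; split => //; exists K.
have [u cu umin] := perron hs hs1 oOm rho0 Y0 HY HG lamp K0 W.
have bu := wclass_bdcont hs Y0 K0 cu.
have [cu1 u0 uK uSP] := cu.
pose I := range u.
have hI : has_sup I.
  split; first by case: Om0 => x _; exists (u x); exists x.
  by case: bu => _ [M uM]; exists M => _ [x _ <-]; rewrite (le_trans (ler_norm _)).
pose m := sup I.
have um x : u x <= m by apply: sup_upper_bound => //; exists x.
have m0 : 0 < m.
  case: Om0 => x Ox; apply: lt_le_trans (um x).
  exact: (wclass_pos hs N0 Y0 K0 cu Ox).
have mV0 : 0 < m^-1 by rewrite invr_gt0.
have mh : m^-1 <= 2 * h.
  have : S (lam + (2 * m)^-1).
    split; first by rewrite addr_ge0// invr_ge0 mulr_ge0// ltW.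
    exists (2 * K); first exact: mulr_gt0.
    by exists (fun x => 2 * u x); exact: wclass_grow.
  move=> /(sup_upper_bound hS); rewrite -/mu invfM => H.
  by lra.
pose v x := m^-1 * u x.
have vE x F : m^-1 * (F * u x + 1) = F * v x + m^-1 by rewrite /v; ring.
have v0 x : 0 <= v x by rewrite mulr_ge0// ltW.
have v1 x : v x <= 1 by rewrite ler_pdivrMl// mulr1.
have vSP x th : Om x -> esphere th -> SP s v x th (lam * v x + m^-1).
  move=> Ox th1; rewrite -vE.
  exact: (SP_scale hs hs1 bu mV0 (uSP x th Ox th1)).
have vbar y x : Y y -> v x <= Kv * ballpow s y rho x.
  move=> Yy; have := perron_barrier hs hs1 rho0 Y0 HY lamp K0 cu umin x um Yy.
  rewrite -/F0 => H; rewrite /v mulrC ler_pdivrMr//; apply: (le_trans H).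
  have -> : Kv * ballpow s y rho x * m = (mu + 1) * m / F0 * ballpow s y rho x.
    by rewrite /Kv; ring.
  apply: ler_wpM2r; first exact: ballpow_ge0.
  rewrite ler_wpM2r ?invr_ge0 ?(ltW F00)// mulrDl mul1r lerD//.
    by rewrite ler_wpM2r ?(ltW m0).
  rewrite -(ler_pM2l mV0) mulVf ?gt_eqF// mulr1; lra.
have vout x : ~ Om x -> v x = 0.
  by move=> Ox; rewrite /v (wclass_out hs rho0 HG cu Ox) mulr0.
have cv : continuous v by exact: continuous_scalef.
have bv : bdcont v by split => //; exists 1 => x; rewrite ger0_norm.
have vh : hol s (Kv * Cb) v.
  case: Y0 => y Yy; apply: (hol_of_SP hs hs1 (HY Yy)) => //.
  - move=> x th Ox th1; apply: SP_leF (vSP x th Ox th1).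
    by rewrite addr_ge0 ?mulr_ge0// ltW.
  - exact: mulr_gt0.
  - move=> x z /HG[y' Yy' yz]; apply: (le_trans (vbar y' x Yy')).
    rewrite -[leRHS]mulrA; apply: (ler_wpM2l (ltW Kv0)).
    exact: (ballpow_bound hs).
exists lam, m^-1, v; split => //.
- split => //; last by rewrite mV0 (le_trans mh).
  by rewrite ler_norml; apply/andP; split; lra.
- split => //; first by move=> x; rewrite v0 v1.
  have m20 : 0 < m / 2 by exact: divr_gt0.
  have [_ [x _ <-] ux] := sup_adherent m20 hI; rewrite -/m in ux.
  by exists x; rewrite /v ler_pdivlMl//; lra.
- move=> x Ox; rewrite -vE; apply: SB_scale => //.
  exact: (perron_SB hs hs1 N0 oOm rho0 Y0 HY HG lamp K0 cu umin Ox).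
Qed.
(** At a zero the second differences of [v] are nonnegative and their integral
is nonpositive, on every line; so [v] cannot be positive anywhere. *)
Lemma SP_strong_max v x : bdcont v -> (forall y, 0 <= v y) ->
  (forall th, esphere th -> SP s v x th 0) -> v x = 0 -> forall y, v y = 0.
Proof.
move=> bv v0 vSP vx y; apply/eqP; rewrite eq_le v0 andbT leNgt; apply/negP => vy.
have xy : x != y by apply: contraTneq vy => <-; rewrite vx ltxx.
have [th [th1 yE]] := unit_dir xy.
set r := enorm (y - x) in yE.
have r0 : 0 < r.
  rewrite lt_neqAle enorm_ge0 andbT eq_sym; apply: contraNN xy => /eqP/enorm_eq0.
  by move/subr0_eq => ->.
pose c := v y / 2; have c0 : 0 < c by exact: divr_gt0.
have ct := continuous_compf (@continuous_line _ _ x th) bv.1.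
have : \forall t \near r, c < v (x + t *: th).
  apply: (@cvgr_gt _ _ _ _ (fun t => v (x + t *: th)) _ (ct r)).
  by rewrite -yE /c; lra.
move=> /nbhs_ballP[d0 /= d00 Hd].
pose d := r - Num.min d0 r / 2.
have md : 0 < Num.min d0 r by rewrite lt_min d00.
have [md1 md2] : Num.min d0 r <= d0 /\ Num.min d0 r <= r.
  by rewrite !ge_min !lexx orbT.
have dd : 0 < d by rewrite /d; lra.
have dr : d <= r by rewrite /d; lra.
have dlt : d < r by rewrite /d; lra.
have drr : 0 < d < r + 1 by rewrite dd/=; lra.
have r10 : 0 < r + 1 by lra.
have := vSP th th1 0 0 (r + 1) r10 _ d drr; rewrite mul0r addr0 oppr0.
move=> H; have {}H : Out s v x th d <= 0.
  by apply: H => t _; rewrite vx !mul0r subr0 addr0.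
have lv := lingr_secdiff x th bv.
have sge t : 0 <= secdiff v x th t by rewrite /secdiff vx mulr0 subr0 addr_ge0.
have sgc t : d <= t <= r -> c <= secdiff v x th t.
  move=> /andP[dt tr]; rewrite /secdiff vx mulr0 subr0.
  have : c < v (x + t *: th).
    apply: Hd; rewrite -ball_normE/= ger0_norm; last by lra.
    by rewrite /d in dt; lra.
  by have := v0 (x - t *: th); lra.
have K1 := @Kint_split_ge _ _ hs _ d r (- (c / (2 * r ^+ 2))) hs1 lv dd dr.
have {}K1 : Kint s r (secdiff v x th) <= Out s v x th d + - (c / (2 * r ^+ 2)) *
   ((r `^ (2 - 2 * s) - d `^ (2 - 2 * s)) / (1 - s)).
  apply: K1 => t /andP[dt tr]; apply: le_trans (sgc t _); last by rewrite dt.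
  have t0 : 0 < t by exact: lt_le_trans dt.
  have -> : - (2 * - (c / (2 * r ^+ 2)) * t ^+ 2) = c * (t / r) ^+ 2.
    by field; rewrite gt_eqF.
  rewrite ler_piMr ?(ltW c0)// exprn_ile1 ?divr_ge0 ?(ltW t0) ?(ltW r0)//.
  by rewrite ler_pdivrMr// mul1r.
have K2 : 0 <= Kint s r (secdiff v x th).
  have l0 : lingr (fun=> 0 : R) by exact: lingr_cst.
  rewrite (_ : 0 = Kint s r (fun=> 0 : R)); last by rewrite Kint_cst// mul0r.
  by apply: Kint_le.
have p0 : 0 < 2 - 2 * s by have := s1; lra.
have K3 : 0 < (r `^ (2 - 2 * s) - d `^ (2 - 2 * s)) / (1 - s).
  by rewrite divr_gt0// subr_gt0 gt0_ltr_powR ?nnegrE ?(ltW dd) ?(ltW r0).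
have K4 : 0 < c / (2 * r ^+ 2) by rewrite divr_gt0// mulr_gt0// exprn_gt0.
have := mulr_gt0 K4 K3; lra.
Qed.

Theorem line_eigenfunction : exists2 mu, 0 < mu & exists v,
  [/\ bdcont v, (forall x, Om x -> 0 < v x), (forall x, ~ Om x -> v x = 0),
    (forall x th, Om x -> esphere th -> SP s v x th (mu * v x)) &
    (forall x, Om x -> SB s v x (mu * v x))].
Proof.
have [mu mu0 [L L0 Happ]] := approx_eigen.
exists mu => //.
have en n : 0 < (n.+1%:R : R)^-1 by rewrite invr_gt0.
have /choice[f Hf] : forall n, exists p : R * R * ('rV[R]_N -> R),
    [/\ [/\ `|p.1.1 - mu| <= n.+1%:R^-1, 0 < p.1.2 <= n.+1%:R^-1 & 0 <= p.1.1],
       [/\ hol s L p.2, (forall x, 0 <= p.2 x <= 1),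
           (forall x, ~ Om x -> p.2 x = 0) & exists x, 2^-1 <= p.2 x],
       (forall x th, Om x -> esphere th ->
          SP s p.2 x th (p.1.1 * p.2 x + p.1.2)) &
       (forall x, Om x -> SB s p.2 x (p.1.1 * p.2 x + p.1.2))].
  by move=> n; have [lam [e' [v H]]] := Happ _ (en n); exists (lam, e', v).
have vh n : hol s L (f n).2 by case: (Hf n) => _ [].
have v01 n x : 0 <= (f n).2 x <= 1 by case: (Hf n) => _ [].
have vout n x : ~ Om x -> (f n).2 x = 0.
  by case: (Hf n) => _ [_ _ + _] _ _; exact.
have [y0 Yy0] := Y0.
have vout' n x : rho < enorm (x - y0) -> (f n).2 x = 0.
  move=> xr; apply: vout => /(HY Yy0); rewrite /eball/= => H.
  by have := lt_trans xr H; rewrite ltxx.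
have [v [hv vlim]] := equiholder_cluster hs L0 vh v01 vout'.
have close (e : R) : 0 < e -> exists n, [/\ (n.+1%:R)^-1 <= e &
    forall x, `|(f n).2 x - v x| <= e].
  move=> e0; have [m me] : exists m, e^-1 < m.+1%:R.
    exists (Num.bound e^-1); rewrite (lt_le_trans (archi_boundP _))//.
      by rewrite invr_ge0 ltW.
    by rewrite ler_nat.
  have [n mn Hn] := vlim e m e0; exists n; split => //.
  rewrite invf_ple ?posrE//; apply: (le_trans (ltW me)).
  by rewrite ler_nat ltnS.
have v0 x : 0 <= v x.
  apply/ler_addgt0Pl => e e0; have [n [_ Hn]] := close e e0.
  by have := Hn x; have := v01 n x; rewrite ler_norml => /andP[? ?] /andP[? ?]; lra.
have v1 x : v x <= 1.
  apply/ler_addgt0Pl => e e0; have [n [_ Hn]] := close e e0.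
  by have := Hn x; have := v01 n x; rewrite ler_norml => /andP[? ?] /andP[? ?]; lra.
have vo x : ~ Om x -> v x = 0.
  move=> Ox; apply/eqP; rewrite eq_le v0 andbT; apply/ler_addgt0Pl => e e0.
  have [n [_ Hn]] := close e e0; have := Hn x; rewrite (vout n x Ox) ler_norml.
  by move=> /andP[? ?]; lra.
have cv := hol_continuous hs hv.
have bv : bdcont v by split => //; exists 1 => x; rewrite ger0_norm.
have bf n : bdcont (f n).2.
  split; first exact: (hol_continuous hs (vh n)).
  by exists 1 => x; have /andP[? ?] := v01 n x; rewrite ger0_norm.
(* the right-hand sides converge, uniformly near each point, as required by the
   stability lemmas *)
have rhs x e : Om x -> 0 < e -> exists2 r0, 0 < r0 & forall e', 0 < e' ->
    exists n, [/\ (forall y, `|(f n).2 y - v y| <= e') &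
      forall z, enorm z < r0 -> Om (x + z) /\
       `|(f n).1.1 * (f n).2 (x + z) + (f n).1.2 - mu * v x| <= e].
  move=> Ox e0; have /nbhs_enormP [r1 r10 Hr] : nbhs x Om by exact: open_nbhs_nbhs.
  have e40 : 0 < e / 4 by exact: divr_gt0.
  have [r2 r20 r2P] := @powR_small _ (mu * L) (e / 4) gam gam0 e40.
  exists (Num.min r1 r2); first by rewrite lt_min r10.
  move=> e' e'0; pose e1 := Num.min e' (e / 4 / (mu + 2)).
  have mu20 : 0 < mu + 2 by rewrite addr_gt0.
  have e10 : 0 < e1 by rewrite lt_min e'0 divr_gt0.
  have e1e : e1 * (mu + 2) <= e / 4 by rewrite -ler_pdivlMr// ge_min lexx orbT.
  have e1e' : e1 <= e' by rewrite ge_min lexx.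
  have [n [ne Hn]] := close e1 e10.
  exists n; split; first by move=> y; rewrite (le_trans (Hn y)).
  move=> z; rewrite lt_min => /andP[zr1 zr2].
  split; first by apply: Hr; rewrite addrAC subrr add0r.
  have [[H1 H2 H3] _ _ _] := Hf n.
  have A1 := Hn (x + z); have A2 := hv (x + z) x.
  have A3 : mu * L * enorm z `^ gam <= e / 4.
    have [->|z0] := eqVneq (enorm z) 0; first by rewrite powR0 ?gt_eqF// mulr0 ltW.
    by apply: r2P; rewrite zr2 lt_neqAle eq_sym z0 enorm_ge0.
  rewrite addrAC subrr add0r -/gam in A2.
  have A4 : `|mu * (v (x + z) - v x)| <= e / 4.
    rewrite normrM (gtr0_norm mu0) (le_trans _ A3)// -mulrA ler_wpM2l//.
    exact: ltW.
  have A5 : `|mu * ((f n).2 (x + z) - v (x + z))| <= mu * e1.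
    by rewrite normrM (gtr0_norm mu0) ler_wpM2l// ltW.
  have A6 : `|((f n).1.1 - mu) * (f n).2 (x + z)| <= e1.
    have /andP[b0 b1] := v01 n (x + z).
    rewrite normrM (ger0_norm b0) (le_trans _ (le_trans H1 ne))//.
    by rewrite ler_piMr.
  have /andP[A7 A8] := H2.
  have A9 : (f n).1.2 <= e1 by rewrite (le_trans A8).
  move: A4 A5 A6 e1e A9 A7 e10 mu0; rewrite !ler_norml.
  clear - hs hs1 HY HG Om0 Y0 oOm N0 rho0 gam0 s0 s1 Bm0 F00 Cb0.
  by move=> /andP[? ?] /andP[? ?] /andP[? ?] *; apply/andP; split; lra.
have vSP x th : Om x -> esphere th -> SP s v x th (mu * v x).
  move=> Ox th1; apply: (SP_stab hs hs1 bv hv L0 th1) => e e0.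
  have [r0 r00 Hr] := rhs x e Ox e0; exists r0 => // e' e'0.
  have [n [Hn Hz]] := Hr e' e'0; exists (f n).2; split => //.
  - by move=> y; have := Hn y; rewrite ler_norml => /andP[? ?]; lra.
  - by have := Hn x; rewrite ler_norml => /andP[? ?]; lra.
  - move=> t tr; have [|Oz] := Hz (t *: th); first by rewrite enormZ th1 mulr1.
    rewrite ler_norml => /andP[Fz _].
    have [_ _ SPn _] := Hf n.
    by apply: SP_leF (SPn _ th Oz th1); lra.
exists v; split => //.
  move=> x Ox; rewrite lt_neqAle v0 andbT; apply/eqP => /esym vx.
  have vz : forall y, v y = 0.
    apply: (SP_strong_max bv v0 _ vx) => th th1.
    by have := vSP x th Ox th1; rewrite vx mulr0.
  have q0 : 0 < (4^-1 : R) by rewrite invr_gt0.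
  have [n [_ Hn]] := close _ q0; have [_ [_ _ _ [y vy]] _ _] := Hf n.
  by have := Hn y; rewrite vz ler_norml => /andP[? ?]; lra.
move=> x Ox; apply: (SB_stab hs hs1 bv hv L0) => e e0.
have [r0 r00 Hr] := rhs x e Ox e0; exists r0 => // e' e'0.
have [n [Hn Hz]] := Hr e' e'0; exists (f n).2; split => //.
move=> z zr; have [Oz] := Hz z zr; rewrite ler_norml => /andP[_ Fz].
have [_ _ _ SBn] := Hf n.
move=> p C r r1 tch d eta dr eta0.
have [th th1 O] := SBn _ Oz p C r r1 tch d eta dr eta0.
by exists th => //; apply: le_trans O; lra.
Qed.

End Eigen.

Lemma addrKAC2 (V : zmodType) (x a b : V) : x + a + b - x = a + b.
Proof. by rewrite addrC !addrA addNr add0r. Qed.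

Lemma dist_half_le (R : realType) (a b c e : R) :
  `|a - c| < e / 2 -> `|b - c| < e / 2 -> `|a - b| <= e.
Proof.
rewrite !ltr_norml ler_norml => /andP[? ?] /andP[? ?].
by apply/andP; split; lra.
Qed.

(** * Second order calculus along lines *)

Section LineCalculus.
Context {R : realType} {n : nat}.
Implicit Types (f : 'rV[R]_n -> R) (x y d v : 'rV[R]_n).

Local Notation e_ i := (delta_mx 0 i : 'rV[R]_n).

Lemma is_derive_line f y v (t : R) : derivable f (y + t *: v) v ->
  is_derive t 1 (fun t => f (y + t *: v)) ('D_v f (y + t *: v)).
Proof.
move=> df.
have E : (fun h : R => h^-1 *: ((fun t => f (y + t *: v)) (h *: 1 + t)
     - (fun t => f (y + t *: v)) t)) =
  (fun h : R => h^-1 *: (f (h *: v + (y + t *: v)) - f (y + t *: v))).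
  apply/funext => h; congr (_ *: (f _ - _)).
  by rewrite scalerDl [h *: 1]mulr1 addrCA.
by split; rewrite /derivable /derive E.
Qed.

(** A first order expansion with error [e |h|] for each [e]
characterizes the derivative. *)
Lemma is_derive_small (g : R -> R) (t l : R) :
  (forall e, 0 < e -> exists2 d, 0 < d & forall h, `|h| < d ->
     `|g (t + h) - g t - h * l| <= e * `|h|) -> is_derive t 1 g l.
Proof.
move=> H.
have c : (fun h : R => h^-1 *: (g (h *: 1 + t) - g t)) @ 0^' --> l.
  apply/cvgrPdist_le => e e0; have [d d0 Hd] := H _ e0.
  near=> h; have h0 : h != 0 by near: h; exact: nbhs_dnbhs_neq.
  have hd : `|h| < d by near: h; apply: dnbhs0_lt.
  rewrite [h *: 1]mulr1 (addrC h).
  have hn : 0 < `|h| by rewrite normr_gt0.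
  rewrite distrC -(ler_pM2r hn) -normrM (le_trans _ (Hd h hd))//.
  rewrite le_eqVlt; apply/orP; left; apply/eqP; congr `| _ |.
  by rewrite /GRing.scale/=; field.
by split; [apply/cvg_ex; exists l|exact: cvg_lim].
Unshelve. all: by end_near. Qed.

(** A function with continuous partial derivatives has the expected directional
increments: move along one coordinate after the other and use the mean value
theorem on each piece. *)
Lemma line_increment f : Ck 1 f -> forall (r : seq 'I_n) d x e, 0 < e ->
  exists2 del, 0 < del & forall h : R, `|h| < del ->
   `|f (x + h *: \sum_(i <- r) d 0 i *: e_ i) - f x
       - h * \sum_(i <- r) d 0 i * partial i f x| <= e * `|h|.
Proof.
move=> [cf Hf]; elim=> [|i r IH] d x e e0.
  exists 1 => // h _; rewrite !big_nil scaler0 addr0 mulr0 subrr subr0 normr0.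
  by rewrite mulr_ge0// ltW.
have e20 : 0 < e / 2 by exact: divr_gt0.
have [d1 d10 H1] := IH d x _ e20.
have [dfi ci] := Hf i.
pose c := `|d 0 i| + 1; have c0 : 0 < c by rewrite ltr_wpDl.
have e2c : 0 < e / 2 / c by exact: divr_gt0.
pose D := \sum_(i <- r) d 0 i *: e_ i.
have /nbhs_enormP[d2 d20 H2] : \forall y \near x, `|partial i f x - partial i f y| < e / 2 / c.
  have /(@cvgr_dist_lt _ _ _) := ci x.
  by move=> H; exact: (H _ e2c).
pose M := enorm D + `|d 0 i| + 1.
have M0 : 0 < M by rewrite /M -addrA ltr_wpDl ?enorm_ge0// ltr_wpDl.
exists (Num.min d1 (d2 / M)); first by rewrite lt_min d10 divr_gt0.
move=> h; rewrite lt_min => /andP[hd1 hd2].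
have {}H1 := H1 h hd1; rewrite -/D in H1.
rewrite !big_cons -/D.
pose y := x + h *: D.
have -> : x + h *: (d 0 i *: e_ i + D) = y + (h * d 0 i) *: e_ i.
  by rewrite /y scalerDr scalerA addrCA addrA [in RHS]addrC addrA.
have key : `|f (y + (h * d 0 i) *: e_ i) - f y - h * (d 0 i * partial i f x)|
    <= e / 2 * `|h|.
  pose a := h * d 0 i.
  have dphi (t : R) : is_derive t 1 (fun t => f (y + t *: e_ i)) (partial i f (y + t *: e_ i)).
    by apply: is_derive_line; exact: dfi.
  have mvt : exists2 t, `|t| <= `|a| &
      f (y + a *: e_ i) - f y = partial i f (y + t *: e_ i) * a.
    have [a0|a0] := leP 0 a.
      have [|t /itvP ta E] := @MVT_segment _ (fun t => f (y + t *: e_ i))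
        (fun t => partial i f (y + t *: e_ i)) _ _ a0 (fun t _ => dphi t).
        by apply: derivable_within_continuous => t _; case: (dphi t).
      exists t; first by rewrite !ger0_norm ?ta.
      by rewrite scale0r addr0 subr0 in E.
    have [|t /itvP ta E] := @MVT_segment _ (fun t => f (y + t *: e_ i))
        (fun t => partial i f (y + t *: e_ i)) _ _ (ltW a0) (fun t _ => dphi t).
      by apply: derivable_within_continuous => t _; case: (dphi t).
    exists t; first by rewrite !ler0_norm ?ta ?(ltW a0)// lerN2 ta.
    rewrite scale0r addr0 sub0r in E.
    by apply: oppr_inj; rewrite opprB E mulrN.
  have [t ta E] := mvt; rewrite -/a E mulrA -/a.
  have -> : partial i f (y + t *: e_ i) * a - a * partial i f x =
     - (partial i f x - partial i f (y + t *: e_ i)) * a by ring.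
  rewrite normrM normrN.
  have near : `|partial i f x - partial i f (y + t *: e_ i)| < e / 2 / c.
    apply: H2; rewrite /y addrKAC2.
    rewrite (le_lt_trans (enormD _ _))// !enormZ.
    have -> : enorm (e_ i) = 1.
      rewrite /enorm /dotv (bigD1 i)//= big1 ?addr0.
        by rewrite !mxE !eqxx mulr1 sqrtr1.
      by move=> j ji; rewrite !mxE (negPf ji) andbF mulr0.
    rewrite mulr1; apply: (@le_lt_trans _ _ (`|h| * M)).
      rewrite /M !mulrDr -addrA lerD2l (le_trans ta)// /a normrM lerDl.
      by rewrite mulr1.
    by rewrite -ltr_pdivlMr.
  apply: (@le_trans _ _ (e / 2 / c * `|a|)).
    by rewrite ler_wpM2r// ltW.
  rewrite /a normrM mulrA mulrAC ler_wpM2r//.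
  rewrite mulrAC -mulrA ler_piMr ?(ltW e20)//.
  by rewrite ler_pdivrMr// mul1r /c lerDl.
have -> : f (y + (h * d 0 i) *: e_ i) - f x - h * (d 0 i * partial i f x +
   \sum_(j <- r) d 0 j * partial j f x) =
   (f (y + (h * d 0 i) *: e_ i) - f y - h * (d 0 i * partial i f x)) +
   (f y - f x - h * \sum_(j <- r) d 0 j * partial j f x) by ring.
rewrite (le_trans (ler_normD _ _))//.
have -> : e * `|h| = e / 2 * `|h| + e / 2 * `|h| by field.
exact: lerD.
Qed.

Definition dirder f d x : R := \sum_(i < n) d 0 i * partial i f x.

Lemma is_derive_dir f x d (t : R) : Ck 1 f ->
  is_derive t 1 (fun t => f (x + t *: d)) (dirder f d (x + t *: d)).
Proof.
move=> cf; apply: is_derive_small => e e0.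
have [del del0 H] := line_increment cf (index_enum 'I_n) d (x + t *: d) e0.
exists del => // h hd; have := H h hd.
have -> : \sum_(i <- index_enum 'I_n) d 0 i *: delta_mx 0 i = d.
  by rewrite [RHS]row_sum_delta.
by rewrite scalerDl addrA.
Qed.

Definition hessform f d x : R :=
  \sum_(i < n) d 0 i * \sum_(j < n) d 0 j * partial j (partial i f) x.

Lemma is_derive_dir2 f x d (t : R) : Ck 2 f ->
  is_derive t 1 (fun t => dirder f d (x + t *: d)) (hessform f d (x + t *: d)).
Proof.
move=> [cf Hf].
have -> : (fun t => dirder f d (x + t *: d)) =
    \sum_(i < n) (d 0 i \*: (fun t => partial i f (x + t *: d))).
  by apply/funext => u; rewrite fct_sumE.
apply: is_derive_sum => i; apply: is_deriveZ.
by have := is_derive_dir x d t (Hf i).2.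
Qed.

Lemma Ck1 f : Ck 2 f -> Ck 1 f.
Proof. by move=> [cf Hf]; split => // i; have [d [c _]] := Hf i. Qed.

Lemma Taylor_ge (g g1 g2 : R -> R) (m : R) :
  (forall t : R, is_derive t 1 g (g1 t)) -> (forall t : R, is_derive t 1 g1 (g2 t)) ->
  (forall t, 0 <= t <= 1 -> m <= g2 t) -> g 0 + g1 0 + m / 2 <= g 1.
Proof.
move=> d1 d2 gm.
have g1m t : 0 <= t <= 1 -> g1 0 + m * t <= g1 t.
  move=> /andP[t0 t1].
  have [|x /itvP xt E] := @MVT_segment _ g1 g2 _ _ t0 (fun t _ => d2 t).
    by apply: derivable_within_continuous => u _; case: (d2 u).
  have : m <= g2 x by apply: gm; rewrite xt (le_trans _ t1)// xt.
  by rewrite subr0 in E; nra.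
pose h t := g t - (m / 2) * t ^+ 2.
have dh (t : R) : is_derive t 1 h (g1 t - m * t).
  have D := is_deriveB (d1 t) (is_deriveZ (m / 2) (is_deriveX 2 (is_derive_id t 1))).
  by apply: (is_derive_eq D); rewrite /GRing.scale/= expr1; field.
have [|x /itvP x01 E] := @MVT_segment _ h (fun t => g1 t - m * t) _ _ (@ler01 R)
    (fun t _ => dh t).
  by apply: derivable_within_continuous => u _; case: (dh u).
have := g1m x; rewrite !x01 => /(_ isT).
by move: E; rewrite /h expr0n/= expr1n mulr0 mulr1 subr0 subr0 mulr1; lra.
Qed.

Lemma dirder0 f d x : dirder f d x = dotv d (grad f x).
Proof. by apply: eq_bigr => i _; rewrite !mxE. Qed.

Lemma Taylor_line_ge f x d m : Ck 2 f ->
  (forall t : R, 0 <= t <= 1 -> m <= hessform f d (x + t *: d)) ->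
  f x + dotv d (grad f x) + m / 2 <= f (x + d).
Proof.
move=> cf H.
have := @Taylor_ge (fun t => f (x + t *: d)) (fun t => dirder f d (x + t *: d))
  (fun t => hessform f d (x + t *: d)) m
  (fun t => is_derive_dir x d t (Ck1 cf)) (fun t => is_derive_dir2 x d t cf) H.
by rewrite scale0r addr0 scale1r dirder0.
Qed.
Lemma hessform_near f x e : Ck 2 f -> 0 < e ->
  \forall y \near x, forall d, `|hessform f d y - hessform f d x| <= e * dotv d d.
Proof.
move=> [cf Hf] e0.
pose c : R := n%:R ^+ 2 + 1.
have c0 : 0 < c by rewrite ltr_wpDl// sqr_ge0.
have ec0 : 0 < e / c by exact: divr_gt0.
have H i j : \forall y \near x,
    `|partial j (partial i f) x - partial j (partial i f) y| < e / c.
  have [_ [_ Hi]] := Hf i; have [_ cij] := Hi j.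
  by have /(@cvgr_dist_lt _ _ _) K := cij x; exact: (K _ ec0).
have : \forall y \near x, forall ij : 'I_n * 'I_n,
    `|partial ij.2 (partial ij.1 f) x - partial ij.2 (partial ij.1 f) y| < e / c.
  apply: (@filter_forall _ _ (fun (ij : 'I_n * 'I_n) y =>
    `|partial ij.2 (partial ij.1 f) x - partial ij.2 (partial ij.1 f) y| < e / c)
    (nbhs x) _).
  by move=> -[i j]; exact: H.
apply: filterS => y Hy d.
have dd := dotv_ge0 d.
rewrite /hessform -sumrB.
have -> : \sum_(i < n) (d 0 i * (\sum_(j < n) d 0 j * partial j (partial i f) y) -
   d 0 i * (\sum_(j < n) d 0 j * partial j (partial i f) x)) =
   \sum_(i < n) \sum_(j < n) d 0 i * d 0 j *
      (partial j (partial i f) y - partial j (partial i f) x).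
  apply: eq_bigr => i _; rewrite -mulrBr -sumrB mulr_sumr.
  by apply: eq_bigr => j _; rewrite -mulrBr mulrA.
apply: (@le_trans _ _ (\sum_(i < n) \sum_(j < n) e / c * dotv d d)).
  rewrite (le_trans (ler_norm_sum _ _ _))// ler_sum// => i _.
  rewrite (le_trans (ler_norm_sum _ _ _))// ler_sum// => j _.
  rewrite !normrM mulrC ler_pM ?mulr_ge0//.
    by rewrite distrC ltW// (Hy (i, j)).
  by rewrite -enorm_sqr expr2 ler_pM// coord_le_enorm.
rewrite !sumr_const !card_ord -mulrnA -[leLHS]mulr_natr natrM -expr2.
rewrite mulrAC ler_wpM2r// -mulrA ler_piMr ?(ltW e0)//.
by rewrite mulrC ler_pdivrMr// mul1r /c lerDl.
Qed.

(** Both mixed derivatives, at points close to [x], equal the double difference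
quotient of [f]; then use their continuity. *)
Lemma Schwarz f x (i j : 'I_n) : Ck 2 f ->
  partial j (partial i f) x = partial i (partial j f) x.
Proof.
move=> cf; have [cf0 Hf] := cf.
have mvt (g : 'rV[R]_n -> R) y k (h : R) : 0 <= h -> (forall x, derivable g x (e_ k)) ->
    exists2 t, 0 <= t <= h & g (y + h *: e_ k) - g y = partial k g (y + t *: e_ k) * h.
  move=> h0 dg.
  have dphi (t : R) : is_derive t 1 (fun t => g (y + t *: e_ k)) (partial k g (y + t *: e_ k)).
    by apply: is_derive_line; exact: dg.
  have [|t /itvP th E] := @MVT_segment _ (fun t => g (y + t *: e_ k))
        (fun t => partial k g (y + t *: e_ k)) _ _ h0 (fun t _ => dphi t).
    by apply: derivable_within_continuous => t _; case: (dphi t).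
  by exists t; rewrite ?th//; rewrite scale0r addr0 subr0 in E.
have DD k l (h : R) : 0 < h -> exists a b : R, [/\ 0 <= a <= h, 0 <= b <= h &
    f (x + h *: e_ k + h *: e_ l) - f (x + h *: e_ k) - f (x + h *: e_ l) + f x =
    h ^+ 2 * partial l (partial k f) (x + a *: e_ k + b *: e_ l)].
  move=> h0.
  have [dk [ck dlk]] := Hf k.
  pose g y := f (y + h *: e_ l) - f y.
  have dg y : derivable g y (e_ k) /\ partial k g y =
      partial k f (y + h *: e_ l) - partial k f y.
    have dT : derivable (fun y => f (y + h *: e_ l)) y (e_ k) /\
        'D_(e_ k) (fun y => f (y + h *: e_ l)) y = 'D_(e_ k) f (y + h *: e_ l).
      have E : (fun t : R => t^-1 *: (((fun y => f (y + h *: e_ l)) \o shift y)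
           (t *: e_ k) - (fun y => f (y + h *: e_ l)) y)) =
         (fun t : R => t^-1 *: ((f \o shift (y + h *: e_ l)) (t *: e_ k)
            - f (y + h *: e_ l))).
        by apply/funext => t; rewrite /= addrA.
      by split; rewrite /derivable /derive E//; exact: dk.
    split; first exact: (derivableB dT.1 (dk y)).
    by rewrite /partial (deriveB dT.1 (dk y)) dT.2.
  have [a ah E1] := mvt g x k h (ltW h0) (fun y => (dg y).1).
  have [b bh E2] := mvt (partial k f) (x + a *: e_ k) l h (ltW h0) (fun y => (dlk l).1 y).
  exists a, b; split => //.
  rewrite (dg _).2 E2 /g in E1.
  have -> : h ^+ 2 * partial l (partial k f) (x + a *: e_ k + b *: e_ l) =
    partial l (partial k f) (x + a *: e_ k + b *: e_ l) * h * h by ring.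
  by rewrite -E1; ring.
have ekn k : enorm (e_ k) = 1.
  rewrite /enorm /dotv (bigD1 k)//= big1 ?addr0.
    by rewrite !mxE !eqxx mulr1 sqrtr1.
  by move=> l lk; rewrite !mxE (negPf lk) andbF mulr0.
have small k l a b h : 0 <= a <= h -> 0 <= b <= h ->
    enorm (x + a *: e_ k + b *: e_ l - x) <= 2 * h.
  move=> /andP[a0 ah] /andP[b0 bh].
  rewrite addrKAC2 (le_trans (enormD _ _))//.
  by rewrite !enormZ !ekn !mulr1 !ger0_norm//; lra.
apply/eqP; rewrite -subr_eq0 -normr_le0; apply/ler_addgt0Pr => e e0; rewrite add0r.
have e20 : 0 < e / 2 by exact: divr_gt0.
have cont k l : exists2 d, 0 < d & forall y, enorm (y - x) < d ->
    `|partial l (partial k f) x - partial l (partial k f) y| < e / 2.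
  apply/nbhs_enormP; have [_ [_ Hk]] := Hf k; have [_ c] := Hk l.
  by have /(@cvgr_dist_lt _ _ _) K := c x; exact: (K _ e20).
have [d1 d10 H1] := cont i j; have [d2 d20 H2] := cont j i.
pose h := Num.min d1 d2 / 4.
have m0 : 0 < Num.min d1 d2 by rewrite lt_min d10.
have h0 : 0 < h by exact: divr_gt0.
have [h1 h2] : 2 * h < d1 /\ 2 * h < d2.
  have : Num.min d1 d2 <= d1 /\ Num.min d1 d2 <= d2 by rewrite !ge_min !lexx orbT.
  by rewrite /h => -[? ?]; split; lra.
have [a [b [ah bh E1]]] := DD i j h h0.
have [a' [b' [ah' bh' E2]]] := DD j i h h0.
have E : partial j (partial i f) (x + a *: e_ i + b *: e_ j) =
   partial i (partial j f) (x + a' *: e_ j + b' *: e_ i).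
  have h20 : h ^+ 2 != 0 by rewrite expf_neq0// gt_eqF.
  have S : h ^+ 2 * partial j (partial i f) (x + a *: e_ i + b *: e_ j) =
      h ^+ 2 * partial i (partial j f) (x + a' *: e_ j + b' *: e_ i).
    have comm : f (x + h *: e_ j + h *: e_ i) = f (x + h *: e_ i + h *: e_ j).
      by congr f; exact: addrAC.
    rewrite comm in E2; apply: (etrans (esym E1)); apply: (etrans _ E2).
    by congr (_ + _); exact: addrAC.
  exact: (mulfI h20 S).
have K1 := H1 _ (le_lt_trans (small i j _ _ _ ah bh) h1).
have K2 := H2 _ (le_lt_trans (small j i _ _ _ ah' bh') h2).
exact: (dist_half_le (eq_ind _ (fun z => `|_ - z| < e / 2) K1 _ E) K2).
Qed.

End LineCalculus.

Lemma continuous_mulf (R : realType) (T : topologicalType) (f g : T -> R) :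
  continuous f -> continuous g -> continuous (fun x => f x * g x).
Proof. by move=> cf cg x; apply: cvgM; [exact: cf|exact: cg]. Qed.

Lemma continuous_at_div (R : realType) (T : topologicalType) (f g : T -> R) x :
  continuous f -> continuous g -> g x != 0 -> {for x, continuous (fun y => f y / g y)}.
Proof.
by move=> cf cg g0; apply: cvgM; [exact: cf|apply: cvgV => //; exact: cg].
Qed.

(** * Principal curvatures and the Hessian *)

Section Rayleigh.
Context {R : realType} {n : nat}.
Implicit Types (v w : 'rV[R]_n) (A G H : 'M[R]_n).

Definition qform A v w : R := dotv (v *m A) w.

Lemma dotvE v w : dotv v w = (v *m w^T) 0 0.
Proof. by rewrite mxE; apply: eq_bigr => i _; rewrite !mxE. Qed.

Lemma qformC A v w : A^T = A -> qform A v w = qform A w v.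
Proof.
move=> As; rewrite /qform !dotvE -[in LHS](trmxK (v *m A *m w^T)) mxE.
by rewrite !trmx_mul trmxK As mulmxA.
Qed.

Lemma qformDl A v v' w : qform A (v + v') w = qform A v w + qform A v' w.
Proof. by rewrite /qform mulmxDl dotvDl. Qed.
Lemma qformDr A v w w' : qform A v (w + w') = qform A v w + qform A v w'.
Proof. by rewrite /qform dotvDr. Qed.
Lemma qformZl A a v w : qform A (a *: v) w = a * qform A v w.
Proof. by rewrite /qform -scalemxAl dotvZl. Qed.
Lemma qformZr A a v w : qform A v (a *: w) = a * qform A v w.
Proof. by rewrite /qform dotvZr. Qed.

Lemma continuous_qform A : continuous (fun v => qform A v v).
Proof.
have -> : (fun v => qform A v v) =
    (fun v => \sum_(i < n) (\sum_(k < n) v 0 k * A k i) * v 0 i).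
  by apply/funext => v; apply: eq_bigr => i _; rewrite mxE.
have cc i : continuous (fun v : 'rV[R]_n => v 0 i) by exact: coord_continuous.
apply: continuous_big => [|i _]; first exact: add_continuous.
apply: (@continuous_mulf _ _ (fun v : 'rV[R]_n => \sum_(k < n) v 0 k * A k i));
  last exact: cc.
apply: continuous_big => [|k _]; first exact: add_continuous.
apply: (@continuous_mulf _ _ (fun v : 'rV[R]_n => v 0 k)); first exact: cc.
exact: cst_continuous.
Qed.

Lemma compact_esphere : compact [set v : 'rV[R]_n | enorm v = 1].
Proof.
apply: (@subclosed_compact _ _ [set v : 'rV[R]_n | enorm v <= 1]).
- have -> : [set v : 'rV[R]_n | enorm v = 1] =
    (fun v : 'rV[R]_n => enorm v) @^-1` [set 1] by [].
  apply: closed_comp; last exact: closed_eq.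
  move=> v _; apply: (@continuous_enorm _ _ _ id) => z; exact: cvg_id.
- exact: compact_closed_eball.
- by move=> v /= ->.
Qed.

(** The minimizer [v] of the Rayleigh quotient on the sphere is a generalized
eigenvector: the quadratic form [H - k G] is nonnegative and vanishes at [v], so
its polar form vanishes there too. *)
Lemma rayleigh H G : (0 < n)%N -> H^T = H -> G^T = G ->
  (forall v, dotv v v <= qform G v v) ->
  exists k v, [/\ v != 0, v *m H = k *: (v *m G) &
    forall w, k * qform G w w <= qform H w w].
Proof.
move=> n0 Hs Gs G1.
pose S := [set v : 'rV[R]_n | enorm v = 1].
have Gpos v : v != 0 -> 0 < qform G v v.
  move=> v0; apply: lt_le_trans (G1 v); rewrite -enorm_sqr exprn_gt0//.
  rewrite lt_neqAle enorm_ge0 andbT eq_sym.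
  by apply: contraNN v0 => /eqP/enorm_eq0 ->.
have Sn0 v : S v -> v != 0.
  by move=> Sv; apply/eqP => v0; move: Sv; rewrite /S/= v0 enorm0 => /esym/eqP; rewrite oner_eq0.
have [u Su] : exists u, S u.
  have xy : (0 : 'rV[R]_n) != const_mx 1.
    apply/eqP => /matrixP/(_ 0 (Ordinal n0)); rewrite !mxE => /eqP.
    by rewrite eq_sym oner_eq0.
  by have [th [th1 _]] := unit_dir xy; exists th.
pose r v := qform H v v / qform G v v.
have cr : {within S, continuous r}.
  apply: continuous_in_subspaceT => v; rewrite inE => Sv.
  have Gn : qform G v v != 0 by rewrite gt_eqF// Gpos// Sn0.
  exact: (continuous_at_div (@continuous_qform H) (@continuous_qform G) Gn).
have [v vS vmin] := @EVT_min_rV _ _ r S (ex_intro _ u Su) compact_esphere cr.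
have {}vS : S v by move: vS; rewrite inE.
have v0 := Sn0 _ vS.
pose k := r v.
have kmin w : k * qform G w w <= qform H w w.
  have [->|w0] := eqVneq w 0.
    have z A : qform A 0 0 = 0.
      by rewrite -[0 in LHS](scale0r (0 : 'rV[R]_n)) qformZl mul0r.
    by rewrite !z mulr0.
  have ew : 0 < enorm w.
    rewrite lt_neqAle enorm_ge0 andbT eq_sym.
    by apply: contraNN w0 => /eqP/enorm_eq0 ->.
  pose w' := (enorm w)^-1 *: w.
  have Sw' : S w'.
    by rewrite /S/= enormZ ger0_norm ?invr_ge0 ?enorm_ge0// mulVf// gt_eqF.
  have := vmin w'; rewrite inE => /(_ Sw'); rewrite -/k /r.
  rewrite !qformZl !qformZr !mulrA -!invfM.
  rewrite ler_pdivlMr ?mulr_gt0 ?invr_gt0 ?Gpos//; last by rewrite mulr_gt0.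
  have a0 : 0 < (enorm w * enorm w)^-1 by rewrite invr_gt0 mulr_gt0.
  by rewrite mulrCA ler_pM2l.
have kv : qform H v v = k * qform G v v.
  by rewrite /k /r divfK// gt_eqF// Gpos.
exists k, v; split => //.
(* a nonnegative quadratic polynomial in [t] without constant term has no
   linear term either; [- b / (c + 1)] is a value of [t] that shows it *)
have crit w : qform H v w = k * qform G v w.
  pose b := qform H v w - k * qform G v w.
  pose c := qform H w w - k * qform G w w.
  have c0 : 0 <= c by rewrite subr_ge0.
  have pos t : 0 <= 2 * t * b + t ^+ 2 * c.
    have := kmin (v + t *: w).
    rewrite !(qformDl, qformDr, qformZl, qformZr) (qformC w v Hs) (qformC w v Gs).
    by rewrite kv /b /c; lra.
  suff : b = 0 by rewrite /b => /subr0_eq.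
  have c1 : 0 < c + 1 by rewrite ltr_wpDl.
  have := pos (- b / (c + 1)).
  have -> : 2 * (- b / (c + 1)) * b + (- b / (c + 1)) ^+ 2 * c =
     - (b ^+ 2 * ((c + 2) / (c + 1) ^+ 2)) by field; rewrite gt_eqF.
  have q0 : 0 < (c + 2) / (c + 1) ^+ 2 by rewrite divr_gt0 ?exprn_gt0//; lra.
  rewrite oppr_ge0 pmulr_lle0// => b2.
  by apply/eqP; rewrite -sqrf_eq0 eq_le b2 sqr_ge0.
have e0 : dotv (v *m H - k *: (v *m G)) (v *m H - k *: (v *m G)) = 0.
  have := crit (v *m H - k *: (v *m G)).
  by rewrite /qform [LHS in _ -> LHS = _]dotvDl dotvNl dotvZl => ->; rewrite subrr.
apply/subr0_eq/enorm_eq0; apply/eqP.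
by rewrite -sqrf_eq0 enorm_sqr e0.
Qed.

Lemma hessform_qform (f : 'rV[R]_n -> R) v x : hessform f v x = qform (hessian f x) v v.
Proof.
rewrite /hessform /qform /dotv.
under [RHS]eq_bigr do rewrite mxE mulr_suml.
rewrite exchange_big; apply: eq_bigr => i _.
by rewrite mulr_sumr; apply: eq_bigr => j _; rewrite !mxE; ring.
Qed.

(** The least eigenvalue of the Hessian relative to the first fundamental form is,
up to the positive factor in the second form, a principal curvature; hence it is
positive, and the first form dominates the Euclidean one. *)
Lemma hess_posdef (f : 'rV[R]_n -> R) : (0 < n)%N -> Ck 2 f ->
  (forall k, eigenvalue (shape_operator f 0) k -> 0 < k) ->
  exists2 c, 0 < c & forall v, c * dotv v v <= hessform f v 0.
Proof.
move=> n0 cf Hk.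
set H := hessian f 0; set G := first_form f 0.
have Hs : H^T = H.
  by apply/matrixP => i j; rewrite !mxE; exact: Schwarz.
have Gs : G^T = G by rewrite /G /first_form linearD/= trmx_mul trmxK trmx1.
have GE v : qform G v v = dotv v v + (dotv v (grad f 0)) ^+ 2.
  rewrite /qform /G /first_form mulmxDr mulmx1 dotvDl; congr (_ + _).
  rewrite mulmxA.
  have -> : v *m (grad f 0)^T = (dotv v (grad f 0))%:M.
    by rewrite [LHS]mx11_scalar -dotvE.
  by rewrite mul_scalar_mx dotvZl dotvC expr2.
have G1 v : dotv v v <= qform G v v by rewrite GE lerDl sqr_ge0.
have [k [v [v0 vH kmin]]] := rayleigh n0 Hs Gs G1.
pose c' := (Num.sqrt (1 + dotv (grad f 0) (grad f 0)))^-1.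
have c'0 : 0 < c'.
  by rewrite invr_gt0 sqrtr_gt0 ltr_wpDr// dotv_ge0.
have Gu : G \in unitmx.
  rewrite -row_free_unit -kermx_eq0; apply/rowV0P => w /sub_kermxP wG.
  have := G1 w; rewrite /qform wG.
  have -> : dotv (0 : 'rV[R]_n) w = 0.
    by rewrite -[0 in LHS](scale0r (0 : 'rV[R]_n)) dotvZl mul0r.
  rewrite -enorm_sqr => w0; apply/enorm_eq0/eqP.
  by rewrite -sqrf_eq0 eq_le w0 sqr_ge0.
have k0 : 0 < k.
  have : eigenvalue (shape_operator f 0) (c' * k).
    apply/eigenvalueP; exists v => //.
    rewrite /shape_operator /second_form -/c' -/H -/G -scalemxAl -scalemxAr.
    by rewrite mulmxA vH -scalemxAl mulmxK// scalerA.
  by move/Hk; rewrite pmulr_rgt0.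
exists k => // w; rewrite hessform_qform; apply: le_trans (kmin w).
by rewrite ler_pM2l.
Qed.

End Rayleigh.

(** * Balls containing a strictly convex domain *)

Lemma orthogonal_trC (R : realType) p q (A : 'M[R]_(p, q)) : p = q ->
  A *m A^T = 1%:M -> A^T *m A = 1%:M.
Proof. by move=> e; subst q; move/mulmx1C. Qed.

Lemma half_lower_bound (R : realFieldType) (u a b k : R) :
  - (k / 2 * u) <= b - a -> k * u <= a -> k / 2 * u <= b.
Proof. by move=> *; lra. Qed.

Section Geometry.
Context {R : realType} {N : nat}.
Implicit Types (x y z w : 'rV[R]_N) (Om : set 'rV[R]_N).

(** The rows of [E] together with [nu] form an orthonormal basis. *)
Lemma frame_norm (E : 'M[R]_(N.-1, N)) (nu w : 'rV[R]_N) : (0 < N)%N ->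
  E *m E^T = 1%:M -> nu *m nu^T = 1%:M -> E *m nu^T = 0 ->
  dotv w w = dotv (w *m E^T) (w *m E^T) + dotv w nu ^+ 2.
Proof.
move=> N0 EE nn En.
have e : (N.-1 + 1 = N)%N by rewrite addn1 prednK.
have A1 : col_mx E nu *m (col_mx E nu)^T = 1%:M.
  rewrite tr_col_mx mul_col_row EE nn En.
  have -> : nu *m E^T = 0 by apply: trmx_inj; rewrite trmx_mul trmxK En trmx0.
  by rewrite -scalar_mx_block.
have := orthogonal_trC e A1.
rewrite tr_col_mx mul_row_col => I.
rewrite dotvE -[w in w *m _]mulmx1 -I mulmxDr mulmxDl mxE; congr (_ + _).
  by rewrite dotvE trmx_mul trmxK !mulmxA.
have -> : w *m (nu^T *m nu) *m w^T = (w *m nu^T) *m (w *m nu^T)^T.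
  by rewrite trmx_mul trmxK !mulmxA.
by rewrite -dotvE /dotv big_ord1 -dotvE expr2.
Qed.

Lemma boundaryE Om z : open Om -> boundary Om z <-> closure Om z /\ ~ Om z.
Proof.
by move=> oOm; rewrite /boundary; have /interior_id -> := oOm.
Qed.

Lemma closure_enormP Om z : closure Om z <->
  forall e : R, 0 < e -> exists2 w, Om w & enorm (w - z) < e.
Proof.
split=> [cz e e0|H B /nbhs_enormP[e e0 HB]].
  have [w [Ow wz]] := cz _ (nbhs_enorm_lt z e0); by exists w.
by have [w Ow we] := H e e0; exists w; split => //; exact: HB.
Qed.

(** All points [w] of the set lie in the closed ball through [z] with inner
normal [nu] and radius [1 / (2 c)]. *)
Definition supports Om z nu (c : R) :=
  enorm nu = 1 /\ forall w, Om w -> c * dotv (w - z) (w - z) <= dotv nu (w - z).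

Section Local.
Context (Om : set 'rV[R]_N) (N1 : (1 < N)%N) (oOm : open Om)
  (cOm : C2_boundary Om)
  (pOm : forall x0 kappa, boundary Om x0 -> principal_curvature Om x0 kappa ->
     0 < kappa).

Let N0 : (0 < N)%N. Proof. exact: ltnW. Qed.

(** In the chart the set is the epigraph of a function whose Hessian is bounded
below by a positive constant near the origin. By Taylor's formula each nearby
graph point has a supporting paraboloid there; normalizing the normal
[(- grad gamma, 1)] turns it into a ball. *)
Lemma local_support z0 : boundary Om z0 -> exists2 rho : R, 0 < rho &
  exists2 c : R, 0 < c & forall z, boundary Om z -> enorm (z - z0) < rho ->
    exists nu, supports [set w | closure Om w /\ enorm (w - z0) < rho] z nu c.
Proof.
move=> bz0; have [E [nu [gamma ch]]] := cOm bz0.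
have [EE nn En Cg [r r0 Hr]] := ch.
have n0 : (0 < N.-1)%N by case: (N) N1 => [|[|]].
have [c0 c00 Hc0] := hess_posdef n0 Cg (fun k ek => pOm bz0
  (ex_intro _ E (ex_intro _ nu (ex_intro _ gamma (conj ch ek))))).
pose pr w := (w - z0) *m E^T.
have nrm w : dotv w w = dotv (w *m E^T) (w *m E^T) + dotv w nu ^+ 2.
  exact: frame_norm.
have prle w w' : enorm (pr w - pr w') <= enorm (w - w').
  rewrite /pr -mulmxBl opprB addrA subrK.
  rewrite -(@ler_pXn2r _ 2)// ?nnegrE ?enorm_ge0// !enorm_sqr (nrm (w - w')).
  by rewrite lerDl sqr_ge0.
have prz0 : pr z0 = 0 by rewrite /pr subrr mul0mx.
have prle0 w : enorm (pr w) <= enorm (w - z0).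
  by have := prle w z0; rewrite prz0 subr0.
pose G := enorm (grad gamma 0) + 1.
have G0 : 0 < G by rewrite ltr_wpDl ?enorm_ge0.
have cgr : continuous (fun y : 'rV[R]_(N.-1) => enorm (grad gamma y)).
  have -> : (fun y : 'rV[R]_(N.-1) => enorm (grad gamma y)) = fun y : 'rV[R]_(N.-1) =>
      Num.sqrt (\sum_(i < N.-1) partial i gamma y * partial i gamma y).
    by apply/funext => y; congr Num.sqrt; apply: eq_bigr => i _; rewrite !mxE.
  have cs : continuous (fun y : 'rV[R]_(N.-1) => \sum_(i < N.-1) partial i gamma y * partial i gamma y).
    apply: continuous_big => [|i _]; first exact: add_continuous.
    have [_ Hi] := Cg; have [_ [ci _]] := Hi i.
    exact: continuous_mulf.
  exact: (continuous_compf cs (@sqrt_continuous R)).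
have /nbhs_enormP[r1 r10 H1] : \forall y \near (0 : 'rV[R]_(N.-1)), enorm (grad gamma y) < G.
  have /(@cvgr_lt _ _ _) K := cgr 0; apply: K.
  by rewrite /G ltrDl.
have c02 : 0 < c0 / 2 by exact: divr_gt0.
have /nbhs_enormP[r2 r20 H2] := hessform_near 0 Cg c02.
pose rho := Num.min (Num.min r r1) (Num.min r2 1) / 2.
have m0 : 0 < Num.min (Num.min r r1) (Num.min r2 1).
  by rewrite !lt_min r0 r10 r20 ltr01.
have rho0 : 0 < rho by exact: divr_gt0.
have rhom : rho < Num.min (Num.min r r1) (Num.min r2 1).
  by rewrite ltr_pdivrMr// ltr_pMr// ltr1n.
have [[rr rr1] [rr2 rr3]] : (rho < r /\ rho < r1) /\ (rho < r2 /\ rho < 1).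
  by move: rhom; rewrite !lt_min => /andP[/andP[-> ->] /andP[-> ->]].
exists rho => //.
pose F w := gamma (pr w) - dotv (w - z0) nu.
have OmF w : enorm (w - z0) < r -> (Om w <-> F w < 0).
  by move=> wr; rewrite /F subr_lt0; exact: Hr.
have cpr (e : R) w : 0 < e -> exists2 d : R, 0 < d & forall w', enorm (w' - w) < d ->
    `|F w' - F w| < e.
  move=> e0; have e20 : 0 < e / 2 by exact: divr_gt0.
  have cg : continuous gamma by case: Cg.
  have /nbhs_enormP[d1 d10 D1] : \forall y \near pr w, `|gamma (pr w) - gamma y| < e / 2.
    by have /(@cvgr_dist_lt _ _ _) K := cg (pr w); exact: (K _ e20).
  exists (Num.min d1 (e / 2)); first by rewrite lt_min d10.
  move=> w'; rewrite lt_min => /andP[w1 w2].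
  have A := D1 (pr w') (le_lt_trans (prle w' w) w1).
  have nu1 : enorm nu = 1.
    apply/eqP; rewrite -(@eqrXn2 _ 2)// ?enorm_ge0// enorm_sqr dotvE nn mxE expr1n.
    by [].
  have B1 : dotv (w' - w) nu <= enorm (w' - w).
    by have := CauchySchwarz_dotv (w' - w) nu; rewrite nu1 mulr1.
  have B2 : - dotv (w' - w) nu <= enorm (w' - w).
    by have := CauchySchwarz_dotv (- (w' - w)) nu; rewrite nu1 mulr1 enormN dotvNl.
  have e1 : dotv (w' - z0) nu - dotv (w - z0) nu = dotv (w' - w) nu.
    by rewrite -dotvNl -dotvDl opprB addrA subrK.
  move: A; rewrite /F !ltr_norml => /andP[? ?]; apply/andP; split; lra.
have F0 z : boundary Om z -> enorm (z - z0) < rho -> F z = 0.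
  move=> /(boundaryE z oOm)[cz nz] zr.
  have zr' : enorm (z - z0) < r by exact: lt_trans rr.
  apply/eqP; rewrite eq_le; apply/andP; split; last first.
    by rewrite leNgt; apply/negP => /(OmF z zr').
  rewrite leNgt; apply/negP => Fz.
  have [d d0 Hd] := cpr _ z Fz.
  have rz0 : 0 < r - enorm (z - z0) by rewrite subr_gt0.
  have md : 0 < Num.min d (r - enorm (z - z0)) by rewrite lt_min d0.
  have [w Ow] := (closure_enormP Om z).1 cz _ md.
  rewrite lt_min => /andP[wd wr].
  have wr' : enorm (w - z0) < r.
    by have := enormD (w - z) (z - z0); rewrite addrA subrK; lra.
  have := Hd w wd; have := (OmF w wr').1 Ow.
  rewrite ltr_norml => Fw /andP[+ _]; rewrite ltrBrDr addNr => /(lt_trans Fw).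
  by rewrite ltxx.
have Fle w : closure Om w -> enorm (w - z0) < rho -> F w <= 0.
  move=> cw wr.
  have wr' : enorm (w - z0) < r by exact: lt_trans rr.
  have [bw|Ow] := pselect (Om w); first exact/ltW/(OmF w wr').
  by rewrite F0//; apply/(boundaryE w oOm).
pose c1 := c0 / 4.
have c10 : 0 < c1 by exact: divr_gt0.
pose K := (1 + 2 * G ^+ 2) / c1 + 4 * (1 + G).
have G20 : 0 < G ^+ 2 by rewrite exprn_gt0.
have G1 : 0 < 1 + G by exact: addr_gt0 ltr01 G0.
have G21 : 0 < 1 + 2 * G ^+ 2.
  exact: addr_gt0 ltr01 (mulr_gt0 (ltr0n R 2) G20).
have K0 : 0 < K by exact: addr_gt0 (divr_gt0 G21 c10) (mulr_gt0 (ltr0n R 4) G1).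
exists ((K * (1 + G))^-1).
  by rewrite invr_gt0; exact: mulr_gt0 K0 G1.
move=> z bz zr; have Fz := F0 z bz zr.
have Egrad : enorm (grad gamma (pr z)) < G.
  by apply: H1; rewrite subr0 (le_lt_trans (prle0 z))// (lt_trans zr).
pose g := grad gamma (pr z).
pose nt := nu - g *m E.
have gE w : dotv (g *m E) w = dotv g (w *m E^T).
  by rewrite !dotvE trmx_mul trmxK mulmxA.
have ntE w : dotv nt w = dotv w nu - dotv g (w *m E^T).
  by rewrite /nt dotvDl dotvNl gE dotvC.
have nu1 : dotv nu nu = 1 by rewrite dotvE nn mxE.
have EEt v : dotv ((v : 'rV[R]_(N.-1)) *m E) (v *m E) = dotv v v.
  by rewrite !dotvE trmx_mul mulmxA -(mulmxA v) EE mulmx1.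
have gEn : enorm (g *m E) = enorm g by rewrite /enorm EEt.
have en1 : enorm nu = 1 by rewrite /enorm nu1 sqrtr1.
have nt1 : enorm nt <= 1 + G.
  by rewrite (le_trans (enormD _ _))// enormN gEn en1 lerD2l ltW.
have nt0 : 0 < enorm nt.
  rewrite lt_neqAle enorm_ge0 andbT eq_sym; apply/eqP => /enorm_eq0 nt0.
  have := ntE nu; rewrite nt0 nu1.
  have -> : nu *m E^T = 0 by apply: trmx_inj; rewrite trmx_mul trmxK En trmx0.
  have z0' (m : nat) (v : 'rV[R]_m) : dotv v 0 = 0.
    by rewrite -[0 in LHS](scale0r (0 : 'rV[R]_m)) dotvZr mul0r.
  by rewrite (dotvC 0) !z0' subr0 => /esym/eqP; rewrite oner_eq0.
exists ((enorm nt)^-1 *: nt); split.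
  by rewrite enormZ ger0_norm ?invr_ge0 ?enorm_ge0// mulVf// gt_eqF.
move=> w [cw wr].
set a := pr w - pr z.
have aE : a = (w - z) *m E^T.
  by rewrite /a /pr -mulmxBl opprB addrA subrK.
(* Taylor in the convex ball of radius r2 *)
have tay : gamma (pr z) + dotv a g + c1 * dotv a a <= gamma (pr w).
  have -> : pr w = pr z + a by rewrite /a addrC subrK.
  have -> : c1 * dotv a a = (c0 / 2 * dotv a a) / 2 by rewrite /c1; field.
  apply: Taylor_line_ge => // t /andP[t0 t1].
  have tr : enorm (pr z + t *: a - 0) < r2.
    rewrite subr0; apply: lt_trans rr2.
    have -> : pr z + t *: a = (1 - t) *: pr z + t *: pr w.
      by rewrite /a scalerBr scalerBl scale1r addrAC addrA.
    rewrite (le_lt_trans (enormD _ _))// !enormZ !ger0_norm ?subr_ge0//.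
    have z1 := le_lt_trans (prle0 z) zr; have w1 := le_lt_trans (prle0 w) wr.
    have [->|tn] := eqVneq t 0; first by rewrite subr0 mul1r mul0r addr0.
    have tp : 0 < t by rewrite lt_neqAle eq_sym tn.
    by have := enorm_ge0 (pr z); nra.
  have := H2 _ tr a; rewrite ler_norml => /andP[h1 _].
  exact: half_lower_bound h1 (Hc0 a).
pose t := dotv nt (w - z).
have tge : c1 * dotv a a <= t.
  have := Fle w cw wr; rewrite /t ntE -aE (dotvC g) /F.
  move: Fz; rewrite /F => Fz.
  have e1 : dotv (w - z) nu = dotv (w - z0) nu - dotv (z - z0) nu.
    by rewrite -dotvNl -dotvDl opprB addrA subrK.
  rewrite e1; lra.
have aa := dotv_ge0 a.
have t0 : 0 <= t by apply: le_trans tge; rewrite mulr_ge0// ltW.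
have wz2 : enorm (w - z) <= 2.
  by have := enormD (w - z0) (z0 - z); rewrite addrA subrK (enormBC z0 z); lra.
have tle : t <= (1 + G) * 2.
  rewrite (le_trans (CauchySchwarz_dotv _ _))// ler_pM ?enorm_ge0//.
have ag : dotv g a ^+ 2 <= G ^+ 2 * dotv a a.
  have h1 := CauchySchwarz_dotv g a; have h2 := CauchySchwarz_dotv (- g) a.
  rewrite enormN dotvNl in h2.
  have h3 : `|dotv g a| <= G * enorm a.
    rewrite ler_norml; have : enorm g * enorm a <= G * enorm a.
      by rewrite ler_wpM2r ?enorm_ge0// ltW.
    by move=> h3; apply/andP; split; lra.
  rewrite -enorm_sqr -exprMn -(real_normK (num_real (dotv g a))).
  by rewrite ler_pXn2r// nnegrE mulr_ge0 ?enorm_ge0// ltW.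
have main : dotv (w - z) (w - z) <= K * t.
  rewrite nrm -aE.
  have e2 : dotv (w - z) nu = t + dotv g a by rewrite /t ntE -aE subrK.
  rewrite e2.
  have s1 : (t + dotv g a) ^+ 2 <= 2 * t ^+ 2 + 2 * dotv g a ^+ 2.
    by have := sqr_ge0 (t - dotv g a); nra.
  have s2 : dotv a a <= t / c1 by rewrite ler_pdivlMr// mulrC.
  have s3 : t ^+ 2 <= (1 + G) * 2 * t by rewrite expr2 ler_wpM2r.
  have s4 : (1 + 2 * G ^+ 2) * dotv a a <= (1 + 2 * G ^+ 2) * (t / c1).
    by rewrite ler_wpM2l// addr_ge0// mulr_ge0// ltW.
  have -> : K * t = (1 + 2 * G ^+ 2) * (t / c1) + 2 * ((1 + G) * 2 * t).
    by rewrite /K; ring.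
  lra.
rewrite dotvZl -/t invfM -mulrA mulrCA.
have s5 : K^-1 * dotv (w - z) (w - z) <= t by rewrite ler_pdivrMl.
apply: (@le_trans _ _ ((1 + G)^-1 * t)).
  by rewrite ler_wpM2l// invr_ge0 addr_ge0// ltW.
rewrite ler_wpM2r// lef_pV2 ?posrE//.
Qed.

End Local.
End Geometry.

Section Global.
Context {R : realType} {N : nat}.
Implicit Types (x y z w p : 'rV[R]_N) (Om : set 'rV[R]_N).

Lemma enorm_le_norm w : enorm w <= Num.sqrt (`|w| ^+ 2 *+ N).
Proof.
apply: ler_wsqrtr; rewrite /dotv.
rewrite (@le_trans _ _ (\sum_(i < N) `|w| ^+ 2))//; last first.
  by rewrite sumr_const card_ord.
apply: ler_sum => i _; rewrite -expr2 -(real_normK (num_real (w 0 i))).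
rewrite ler_pXn2r ?nnegrE// /Num.norm/= mx_normrE.
exact: (le_bigmax _ (fun ij : 'I_1 * 'I_N => `|w ij.1 ij.2|) (0, i)).
Qed.

Lemma bounded_enorm Om : bounded_set Om -> exists B, forall w, Om w -> enorm w <= B.
Proof.
move=> [M [_ HM]]; pose M' := `|M| + 1.
have M1 : M < M' by rewrite (le_lt_trans (ler_norm M))// ltrDl.
exists (Num.sqrt (M' ^+ 2 *+ N)) => w Ow.
apply: le_trans (enorm_le_norm w) _; apply: ler_wsqrtr.
rewrite lerMn2r; apply/orP; right.
by rewrite ler_pXn2r ?nnegrE ?addr_ge0//; exact: HM.
Qed.

Definition segment x y (t : R) := x + t *: (y - x).

Lemma segment0 x y : segment x y 0 = x.
Proof. by rewrite /segment scale0r addr0. Qed.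

Lemma segment1 x y : segment x y 1 = y.
Proof. by rewrite /segment scale1r addrC subrK. Qed.

Lemma segmentBy x y y' t : segment x y' t - segment x y t = t *: (y' - y).
Proof.
by rewrite /segment opprD addrACA subrr add0r -scalerBr opprB addrA subrK.
Qed.

Lemma segmentBt x y t t' : segment x y t' - segment x y t = (t' - t) *: (y - x).
Proof. by rewrite /segment opprD addrACA subrr add0r -scalerBl. Qed.

Lemma segment_near Om x y t : open Om -> 0 <= t <= 1 -> Om (segment x y t) ->
  exists2 e : R, 0 < e & forall y' t', 0 <= t' <= 1 ->
    enorm (y' - y) < e -> `|t' - t| < e -> Om (segment x y' t').
Proof.
move=> oOm t01 Ot.
have /nbhs_enormP[e e0 He] := open_nbhs_nbhs (conj oOm Ot).
have D0 : 0 < 1 + enorm (y - x) by rewrite ltr_pwDl// enorm_ge0.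
have E0 : 0 < e / (1 + enorm (y - x)) by exact: divr_gt0.
exists (e / (1 + enorm (y - x))) => // y' t' /andP[t0 t1] ye te; apply: He.
have -> : segment x y' t' - segment x y t =
    t' *: (y' - y) + (t' - t) *: (y - x).
  by rewrite -(segmentBy x) -(segmentBt x y) addrA subrK.
apply: le_lt_trans (enormD _ _) _; rewrite !enormZ (ger0_norm t0).
rewrite (@le_lt_trans _ _ (enorm (y' - y) + `|t' - t| * enorm (y - x)))//.
  by rewrite lerD2r ler_piMl// enorm_ge0.
have -> : e = e / (1 + enorm (y - x)) + e / (1 + enorm (y - x)) * enorm (y - x).
  by field; rewrite gt_eqF.
by rewrite ltr_leD// ler_wpM2r ?enorm_ge0// ltW.
Qed.

(** The supremum of the parameters whose points belong to the domain. *)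
Lemma exit_point Om p x : open Om -> Om p -> ~ Om x -> exists2 t,
  0 < t <= 1 & boundary Om (segment p x t).
Proof.
move=> oOm Op Ox.
pose T := [set t : R | 0 <= t <= 1 /\ Om (segment p x t)].
have T0 : T 0 by rewrite /T /= lexx ler01 segment0.
have T1 t : T t -> t <= 1 by case=> /andP[].
have uT : has_ubound T by exists 1 => t /T1.
have sT : has_sup T by split; [exists 0|].
have s0 : 0 <= sup T by exact: ub_le_sup.
have s1 : sup T <= 1 by apply: ge_sup; [exists 0|move=> t /T1].
have s01 : 0 <= sup T <= 1 by rewrite s0.
have nO : ~ Om (segment p x (sup T)).
  move=> Os; have [e e0 He] := segment_near oOm s01 Os.
  have sn1 : sup T < 1.
    rewrite lt_neqAle s1 andbT; apply/eqP => sT1.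
    by apply: Ox; rewrite -(segment1 p x) -sT1.
  pose t := Num.min 1 (sup T + e / 2).
  have e2 : 0 < e / 2 by exact: divr_gt0.
  have st : sup T < t by rewrite lt_min sn1 ltrDl.
  have t01 : 0 <= t <= 1 by rewrite ge_min lexx andbT (le_trans s0)// ltW.
  have /(ub_le_sup uT) : T t.
    split=> //; apply: He => //; first by rewrite subrr enorm0.
    rewrite ger0_norm ?subr_ge0 ?(ltW st)// ltrBlDl.
    by rewrite gt_min; apply/orP; right; rewrite ltrD2l ltr_pdivrMr// ltr_pMr// ltr1n.
  by rewrite leNgt st.
exists (sup T).
  rewrite s1 andbT lt_neqAle s0 andbT; apply/eqP => sT0.
  by apply: nO; rewrite -sT0 segment0.
apply/(boundaryE _ oOm); split => //; apply/closure_enormP => e e0.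
have D0 : 0 < 1 + enorm (x - p) by rewrite ltr_pwDl// enorm_ge0.
have E0 : 0 < e / (1 + enorm (x - p)) by exact: divr_gt0.
have [t Tt st] := sup_adherent E0 sT.
have ts : t <= sup T by exact: ub_le_sup.
exists (segment p x t); first by case: Tt.
rewrite segmentBt enormZ distrC ger0_norm ?subr_ge0//.
have st' : sup T - t < e / (1 + enorm (x - p)) by rewrite ltrBlDr -ltrBlDl.
rewrite (@le_lt_trans _ _ ((sup T - t) * (1 + enorm (x - p))))//.
  by rewrite ler_wpM2l ?subr_ge0// lerDr.
by rewrite -ltr_pdivlMr.
Qed.

Context (Om : set 'rV[R]_N) (oOm : open Om) (conOm : connected Om)
  (bOm : bounded_set Om)
  (loc : forall z0, boundary Om z0 -> exists2 rho : R, 0 < rho &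
    exists2 c : R, 0 < c & forall z, boundary Om z -> enorm (z - z0) < rho ->
    exists nu, supports [set w | closure Om w /\ enorm (w - z0) < rho] z nu c).

(** Compactness makes the radius of [segment_near] uniform along the segment. *)
Lemma star_open x y : Om y -> (forall t, 0 <= t <= 1 -> Om (segment x y t)) ->
  \forall y' \near y, Om y' /\ forall t, 0 <= t <= 1 -> Om (segment x y' t).
Proof.
move=> Oy Hy; near=> y'; split; first by near: y'; exact: open_nbhs_nbhs.
suff : [set t | 0 <= t <= 1] `<=` (fun t => 0 <= t <= 1 -> Om (segment x y' t)).
  by move=> H t t01; exact: H.
near: y'.
have K : compact [set t : R | 0 <= t <= 1].
  have -> : [set t : R | 0 <= t <= 1] = `[0, 1]%classic.
    by apply/seteqP; split => t /=; rewrite in_itv.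
  exact: segment_compact.
have /compact_near_coveringP := K; apply => t t01.
have [e e0 He] := segment_near oOm t01 (Hy t t01).
exists ([set t' | `|t' - t| < e], [set y' | enorm (y' - y) < e]).
  split => /=; last exact: nbhs_enorm_lt.
  by apply/nbhs_ballP; exists e => // t' /=; rewrite /ball/= distrC.
by move=> [t' y'] [/= h1 h2] t'01; exact: He.
Unshelve. all: by end_near. Qed.

(** Local strict convexity and connectedness give convexity. The set of points
[y] seen from [x] is open by [star_open]. It is closed in the domain: a limit
segment stays in the closure, and if it met the boundary, the supporting ball at
the contact point would contain points of the segment on both sides of it, which
a ball cannot do at a point of its sphere. *)
Lemma segment_in_domain x y : Om x -> Om y ->
  forall t, 0 <= t <= 1 -> Om (segment x y t).
Proof.
move=> Ox; pose S := [set y | Om y /\ forall t, 0 <= t <= 1 -> Om (segment x y t)].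
suff SE : S = Om by move=> Oy; have [] : S y by rewrite SE.
apply: conOm.
- exists x; split=> // t _.
  by rewrite /segment subrr scaler0 addr0.
- exists S; last by rewrite setIidr// => ? [].
  by rewrite openE => y' [Oy Hy]; exact: star_open.
exists (closure S); first exact: closed_closure.
apply/seteqP; split=> y'; first by move=> Sy; split; [case: Sy|exact: subset_closure].
move=> [Oy cy]; split=> // t t01; apply: contrapT => nOt.
have cl t' : 0 <= t' <= 1 -> closure Om (segment x y' t').
  move=> t'01; apply/closure_enormP => e e0.
  have [w [Ow Hw] we] := (closure_enormP S y').1 cy e e0.
  exists (segment x w t'); first exact: Hw.
  have /andP[t0 t1] := t'01.
  by rewrite segmentBy enormZ ger0_norm// (le_lt_trans _ we)// ler_piMl// enorm_ge0.
have bp : boundary Om (segment x y' t) by apply/(boundaryE _ oOm); split => //; exact: cl.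
have [rho rho0 [c c0 H]] := loc bp.
have [|nu [nu1 Hnu]] := H _ bp; first by rewrite subrr enorm0.
have /andP[t0 t1] := t01.
have tp : 0 < t.
  rewrite lt_neqAle t0 andbT; apply/eqP => t0'.
  by apply: nOt; rewrite -t0' segment0.
have tm : t < 1.
  rewrite lt_neqAle t1 andbT; apply/eqP => t1'.
  by apply: nOt; rewrite t1' segment1.
have D0 : 0 < 1 + enorm (y' - x) by rewrite ltr_pwDl// enorm_ge0.
have r0 : 0 < rho / (1 + enorm (y' - x)) by exact: divr_gt0.
pose m := Num.min (Num.min t (1 - t)) (rho / (1 + enorm (y' - x))).
have m0 : 0 < m by rewrite !lt_min tp subr_gt0 tm r0.
have [mt [m1t mr]] : m <= t /\ m <= 1 - t /\ m <= rho / (1 + enorm (y' - x)).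
  by rewrite /m !ge_min !lexx !orbT.
have sup_at a : `|a| = m -> c * (a ^+ 2 * dotv (y' - x) (y' - x)) <=
    a * dotv nu (y' - x).
  move=> am.
  have := Hnu (segment x y' (t + a)); rewrite segmentBt.
  have ta : t + a - t = a by rewrite (addrC t a) addrK.
  rewrite ta !(dotvZr, dotvZl) [X in c * X]mulrA -expr2; apply; split.
    apply: cl; have := ler_norm a; have := ler_norm (- a); rewrite normrN am.
    by move=> h1 h2; apply/andP; split; lra.
  rewrite /= segmentBt ta enormZ am.
  rewrite (@lt_le_trans _ _ (m * (1 + enorm (y' - x))))//.
    by rewrite ltr_pM2l// ltrDr.
  by rewrite -ler_pdivlMr.
have s1 := sup_at m (ger0_norm (ltW m0)).
have s2 := sup_at (- m); rewrite normrN (ger0_norm (ltW m0)) in s2.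
have {}s2 := s2 erefl; rewrite sqrrN in s2.
have cm : 0 < c * m ^+ 2 by rewrite mulr_gt0// exprn_gt0.
have d0 : dotv (y' - x) (y' - x) = 0.
  apply/eqP; rewrite eq_le dotv_ge0 andbT -(ler_pM2l cm) mulr0 -mulrA.
  by move: s1 s2; move: (dotv _ _) (dotv _ _) => ? ? ? ?; lra.
apply: nOt; rewrite /segment (@enorm_eq0 _ _ (y' - x)) ?scaler0 ?addr0//.
by rewrite /enorm d0 sqrtr0.
Qed.

Lemma compact_boundary : compact (boundary Om).
Proof.
have [B HB] := bounded_enorm bOm.
apply: (@subclosed_compact _ _ [set z : 'rV[R]_N | enorm z <= B]).
- have -> : boundary Om = closure Om `&` ~` Om.
    by apply/seteqP; split => z; [move/(boundaryE z oOm)|move=> h; apply/boundaryE].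
  apply: closedI; first exact: closed_closure.
  exact: open_closedC.
- exact: compact_closed_eball.
move=> z /(boundaryE z oOm)[cz _] /=; apply/ler_addgt0Pr => e e0.
have [w /HB wB we] := (closure_enormP Om z).1 cz e e0.
by have := enormD (z - w) w; rewrite subrK enormBC; lra.
Qed.

(** Convexity makes the local supports global: a point [w] far from [z] is
replaced by one on the segment from [z] to [w]. The constant is uniform because
the boundary is compact. *)
Lemma uniform_support : exists2 K : R, 0 < K & forall z, boundary Om z ->
  exists nu, enorm nu = 1 /\ forall w, Om w ->
    dotv (w - z) (w - z) <= K * dotv nu (w - z).
Proof.
have [B0 HB0] := bounded_enorm bOm.
pose B := `|B0| + 1.
have HB w : Om w -> enorm w < B.
  by move=> /HB0 h; rewrite (le_lt_trans h)// (le_lt_trans (ler_norm _))// ltrDl.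
have HBc z : closure Om z -> enorm z <= B.
  move=> cz; apply/ler_addgt0Pr => e e0.
  have [w /HB wB we] := (closure_enormP Om z).1 cz e e0.
  by have := enormD (z - w) w; rewrite subrK enormBC; lra.
have B1 : 0 < B by rewrite ltr_pwDr.
suff : \forall K \near +oo, boundary Om `<=` (fun z => exists nu, enorm nu = 1 /\
    forall w, Om w -> dotv (w - z) (w - z) <= K * dotv nu (w - z)).
  move=> [M [_ HM]]; exists (`|M| + 1); first by rewrite ltr_pwDr.
  by apply: HM; rewrite (le_lt_trans (ler_norm _))// ltrDl.
have /compact_near_coveringP/near_covering_withinP := compact_boundary.
apply=> z0 bz0.
have [rho rho0 [c c0 H]] := loc bz0.
pose t := Num.min 1 (rho / (4 * B)).
have B4 : 0 < 4 * B by exact: mulr_gt0.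
have rB : 0 < rho / (4 * B) by exact: divr_gt0.
have t0 : 0 < t by rewrite lt_min ltr01.
have [t1 tr] : t <= 1 /\ t <= rho / (4 * B) by rewrite /t !ge_min !lexx !orbT.
have ct0 : 0 < c * t by exact: mulr_gt0.
have rho2 : 0 < rho / 2 by exact: divr_gt0.
exists ([set z | enorm (z - z0) < rho / 2], [set K | (c * t)^-1 < K]).
  split => /=; first exact: nbhs_enorm_lt.
  by exists (c * t)^-1; split => //; exact: num_real.
move=> [z K] [/= zr Kt] bz.
have [|nu [nu1 Hnu]] := H z bz.
  by rewrite (lt_trans zr)// ltr_pdivrMr// ltr_pMr// ltr1n.
exists nu; split => // w Ow.
have [cz nOz] := (boundaryE z oOm).1 bz.
have szw : segment z w t - z = t *: (w - z).
  by rewrite /segment (addrC z (t *: _)) addrK.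
have key : c * (t ^+ 2 * dotv (w - z) (w - z)) <= t * dotv nu (w - z).
  have := Hnu (segment z w t); rewrite szw.
  rewrite !(dotvZr, dotvZl) [X in c * X]mulrA -expr2; apply; split.
    apply/closure_enormP => e e0.
    have [z' Oz' z'e] := (closure_enormP Om z).1 cz e e0.
    exists (segment z' w t); first by apply: segment_in_domain; rewrite // ltW.
    have -> : segment z' w t - segment z w t = (1 - t) *: (z' - z).
      by rewrite /segment; apply/matrixP => i j; rewrite !mxE; ring.
    rewrite enormZ ger0_norm ?subr_ge0// (le_lt_trans _ z'e)//.
    by rewrite ler_piMl ?enorm_ge0// gerBl ltW.
  rewrite /= -(subrK z (segment z w t)) szw.
  rewrite -addrA; apply: le_lt_trans (enormD _ _) _.
  rewrite enormZ (ger0_norm (ltW t0)).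
  have wz : enorm (w - z) <= 2 * B.
    apply: le_trans (enormD _ _) _; rewrite enormN mulr2n mulrDl !mul1r.
    by apply: lerD; [exact: ltW (HB w Ow)|exact: HBc].

  have : t * enorm (w - z) <= rho / (4 * B) * (2 * B).
    by rewrite ler_pM// ?enorm_ge0// ltW.
  have -> : rho / (4 * B) * (2 * B) = rho / 2 by field; rewrite gt_eqF.
  by move=> ht; rewrite (splitr rho); exact: ler_ltD.
have key2 : dotv (w - z) (w - z) <= (c * t)^-1 * dotv nu (w - z).
  rewrite ler_pdivlMl// -(ler_pM2l t0).
  by move: key; rewrite expr2 mulrA mulrA (mulrC t) -!mulrA (mulrCA c).
apply: le_trans key2 _; rewrite ler_wpM2r ?(ltW Kt)//.
rewrite -(ler_pM2l t0) mulr0; apply: le_trans key.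
by rewrite mulr_ge0 ?(ltW c0)// mulr_ge0 ?dotv_ge0// sqr_ge0.
Qed.

(** The radius is [K], twice that of the supporting balls, so that the open ball
contains the domain. For a point [x] outside the domain, take the ball at the
exit point [z] of a segment from inside to [x]: as [z] lies on its sphere and
the starting point in the ball, [x] cannot lie in the ball. *)
Lemma exterior_ball_family (N0 : (0 < N)%N) : exists2 rho : R, 0 < rho & exists Y : set 'rV[R]_N,
  [/\ Y !=set0, (forall y, Y y -> Om `<=` eball y rho) &
      forall x, ~ Om x -> exists2 y, Y y & rho <= enorm (x - y)].
Proof.
have [K K0 HK] := uniform_support.
exists K => //; exists [set y | Om `<=` eball y K].
have HG x : ~ Om x -> exists2 y, Om `<=` eball y K & K <= enorm (x - y).
  move=> nOx; have [[p Op]|nO] := pselect (Om !=set0); last first.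
    have [th th1] := @ex_unit R N N0.
    exists (x + K *: th); first by move=> w Ow; case: nO; exists w.
    by rewrite opprD addrA subrr add0r enormN enorm_line// ger0_norm// ltW.
  have [t /andP[t0 t1] bz] := exit_point oOm Op nOx.
  have [nu [nu1 Hnu]] := HK _ bz.
  move: bz Hnu; set z := segment p x t => bz Hnu.
  have [_ nOz] := (boundaryE z oOm).1 bz.
  have OK : Om `<=` eball (z + K *: nu) K.
    move=> w Ow; rewrite /eball/=.
    rewrite -(@ltr_pXn2r _ 2)// ?nnegrE ?enorm_ge0 ?(ltW K0)// enorm_sqr.
    rewrite opprD addrA.
    have h := Hnu w Ow.
    have wz : 0 < dotv (w - z) (w - z).
      rewrite lt_neqAle dotv_ge0 andbT eq_sym; apply/eqP => d0.
      apply: nOz; rewrite -[z](subrK w) -opprB.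
      by rewrite (@enorm_eq0 _ _ (w - z)) ?oppr0 ?add0r// /enorm d0 sqrtr0.
    move: h wz; move: (w - z) => a h wz.
    rewrite dotvDl !dotvDr !(dotvNl, dotvNr) !(dotvZl, dotvZr).
    rewrite -(enorm_sqr nu) nu1 expr1n (dotvC a nu).
    by move: h wz; move: (dotv _ _) (dotv _ _) => a1 b1 h wz; rewrite expr2; lra.
  exists (z + K *: nu) => //.
  rewrite leNgt; apply/negP => xK.
  have zK : enorm (z - (z + K *: nu)) = K.
    by rewrite opprD addrA subrr add0r enormN enormZ nu1 mulr1 ger0_norm// ltW.
  have pK : enorm (p - (z + K *: nu)) < K by exact: OK.
  suff : enorm (z - (z + K *: nu)) < K by rewrite zK ltxx.
  move: (z + K *: nu) pK xK => y pK xK.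
  have -> : z - y = (1 - t) *: (p - y) + t *: (x - y).
    by rewrite /z /segment; apply/matrixP => i j; rewrite !mxE; ring.
  apply: le_lt_trans (enormD _ _) _; rewrite !enormZ !ger0_norm ?subr_ge0// ?(ltW t0)//.
  have h : t * enorm (x - y) < t * K by rewrite ltr_pM2l.
  have h' : (1 - t) * enorm (p - y) <= (1 - t) * K.
    by rewrite ler_wpM2l ?subr_ge0// ltW.
  by move: h h'; move: (enorm _) (enorm _) => a b; lra.
split => //.
have [th th1] := @ex_unit R N N0.
have [B HB] := bounded_enorm bOm.
have /HG[y Oy _] : ~ Om ((`|B| + 1) *: th).
  move/HB; rewrite enorm_line// ger0_norm ?addr_ge0// => h.
  by have := ler_norm B; lra.
by exists y.
Qed.

End Global.

Lemma strictly_convex_exterior_balls (R : realType) (N : nat) (Om : set 'rV[R]_N) :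
  (1 < N)%N -> bounded_strictly_convex_domain Om ->
  exists2 rho : R, 0 < rho & exists Y : set 'rV[R]_N,
  [/\ Y !=set0, (forall y, Y y -> Om `<=` eball y rho) &
      forall x, ~ Om x -> exists2 y, Y y & rho <= enorm (x - y)].
Proof.
move=> N1 [[oOm cOm Om0] bOm C2 pOm].
apply: exterior_ball_family => //; last exact: ltnW.
move=> z0; exact: local_support.
Qed.

(** * From half lines to principal values *)

Section Symmetric.
Context {R : realType} (s : R) (hs : 1 / 2 < s).
Local Notation mu := (@lebesgue_measure R).

Lemma Kint_EFin g d : lingr g -> 0 < d ->
  (\int[mu]_(t in `[d, +oo[) (g t * kern s t)%:E = (Kint s d g)%:E)%E.
Proof.
move=> lg d0; rewrite /Kint /Rintegral fineK//.
by apply: integrable_fin_num => //; exact: Kint_integrable.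
Qed.

(** Lebesgue measure is invariant under the reflection, for sign-changing
integrands as well. *)
Lemma integral_reflect (f : R -> \bar R) d : measurable_fun setT f ->
  mu.-integrable `[d, +oo[ (f \o -%R) ->
  (\int[mu]_(t in `]-oo, (- d)%R]) f t = \int[mu]_(t in `[d, +oo[) f (- t)%R)%E.
Proof.
move=> mf fi.
have E : `[d, +oo[%classic = (-%R : _ -> measurableTypeR R) @^-1` `]-oo, - d].
  by apply/seteqP; split => t /=; rewrite !in_itv/= andbT lerN2.
have mo : measurable_fun [set: measurableTypeR R] (-%R : _ -> measurableTypeR R).
  exact: (@oppr_measurable R setT).
have mf' : measurable_fun [set: measurableTypeR R] f by exact: mf.
rewrite E in fi *; rewrite -(integral_pushforward mo mf' fi)//.
by apply: eq_measure_integral => //= A mA AS; exact/esym/lebesgue_measureN.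
Qed.

Lemma kernN t : kern s (- t) = kern s t. Proof. by rewrite /kern normrN. Qed.

(** The predicate [P] selects an annulus or the outside of an interval; the kernel
being even, both become an integral over a half line of a symmetrized
integrand. *)
Lemma integral_sym (P : R -> bool) (h : R -> R) (B d : R) :
  measurable_fun setT P -> measurable_fun setT h ->
  (forall t, P t -> `|h t| <= B) -> 0 <= B -> 0 < d ->
  let k t := if P t then h t else 0 in
  lingr (fun t => k t + k (- t)) /\
  (\int[mu]_(t in [set t | (d <= `|t|)%R /\ P t]) (h t * kern s t)%:E =
   (Kint s d (fun t => k t + k (- t)%R))%:E)%E.
Proof.
move=> mP mh hB B0 d0 k.
have mk : measurable_fun setT k by exact: measurable_fun_ifT.
have kB t : `|k t| <= B.
  by rewrite /k; case: ifP => [/hB//|_]; rewrite normr0.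
have lk : lingr k by exact: lingr_bounded kB.
have lkN : lingr (fun t => k (- t)).
  apply: lingr_bounded (fun t => kB (- t)).
  exact: (measurableT_comp mk (@oppr_measurable R setT)).
split; first exact: lingrD.
have -> : [set t : R | d <= `|t| /\ P t] = [set t | d <= `|t|] `&` [set t | P t].
  by [].
rewrite integral_mkcondr.
have -> : [set t : R | d <= `|t|] = `[d, +oo[ `|` `]-oo, - d].
  apply/seteqP; split => t /=; rewrite !in_itv/= andbT ler_normr lerNr.
    by move=> /orP.
  by move=> /orP.
have mf : measurable_fun setT (fun t => (k t * kern s t)%:E).
  by apply/measurable_EFinP; apply: measurable_funM => //; exact: measurable_kern.
under eq_integral.
  move=> t _; rewrite (_ : _ t = (k t * kern s t)%:E); last first.
    rewrite patchE /k; case: ifPn; first by rewrite inE/= => ->.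
    by rewrite notin_setE/=; case: (P t) => // _; rewrite mul0r.
  over.
have split_int : (\int[mu]_(t in `[d, +oo[ `|` `]-oo, (- d)%R]) (k t * kern s t)%:E =
    \int[mu]_(t in `[d, +oo[) (k t * kern s t)%:E +
    \int[mu]_(t in `]-oo, (- d)%R]) (k t * kern s t)%:E)%E.
  apply: integral_setU => //; first exact: measurable_funTS.
  apply/disj_setPS => t /=; rewrite !in_itv/= andbT => -[dt td].
  by have := lt_le_trans d0 dt; have := le_trans dt td; lra.
have reflected : (\int[mu]_(t in `]-oo, (- d)%R]) (k t * kern s t)%:E =
    \int[mu]_(t in `[d, +oo[) (k (- t) * kern s t)%:E)%E.
  have E : (fun t => (k t * kern s t)%:E) \o -%R = EFin \o (fun t => k (- t) * kern s t).
    by apply/funext => t /=; rewrite kernN.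
  have H : mu.-integrable `[d, +oo[ ((fun t => (k t * kern s t)%:E) \o -%R).
    by rewrite E; exact: Kint_integrable.
  have := integral_reflect mf H; rewrite -/(_ \o _).
  move=> ->; apply: eq_integral => t _; by rewrite kernN.
by rewrite split_int reflected KintD// EFinD -!Kint_EFin.
Qed.

End Symmetric.

Section TestValue.
Context {R : realType} {N : nat} (s : R) (hs : 1 / 2 < s) (hs1 : s < 1).
Implicit Types (w phi : 'rV[R]_N -> R) (x th : 'rV[R]_N).

Lemma hessform_bound phi x : exists2 C, 0 <= C &
  forall d, `|hessform phi d x| <= C * dotv d d.
Proof.
exists (\sum_(i < N) \sum_(j < N) `|partial j (partial i phi) x|).
  by apply: sumr_ge0 => i _; apply: sumr_ge0.
move=> d; rewrite /hessform mulr_suml (le_trans (ler_norm_sum _ _ _))// ler_sum// => i _.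
rewrite mulr_sumr mulr_suml (le_trans (ler_norm_sum _ _ _))// ler_sum// => j _.
rewrite mulrA normrM mulrC ler_wpM2l// normrM -enorm_sqr expr2.
by rewrite ler_pM// coord_le_enorm.
Qed.

(** The constant does not depend on the direction of [z], which makes the
estimates for the test function uniform over the sphere. *)
Lemma Taylor_two_sided phi x : Ck 2 phi -> exists C r, [/\ 0 <= C, 0 < r &
  forall z, enorm z <= r ->
    `|phi (x + z) - phi x - dotv (grad phi x) z| <= C * dotv z z].
Proof.
move=> cphi.
have [C0 C00 HC0] := hessform_bound phi x.
have /nbhs_enormP[r r0 Hr] := hessform_near x cphi ltr01.
exists ((C0 + 1) / 2), (r / 2); split; rewrite ?divr_ge0 ?addr_ge0 ?divr_gt0//.
move=> z zr; set m := (C0 + 1) * dotv z z.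
have bd t : 0 <= t <= 1 -> `|hessform phi z (x + t *: z)| <= m.
  move=> /andP[t0 t1].
  have tz : enorm (x + t *: z - x) < r.
    rewrite addrC addKr enormZ ger0_norm// (@le_lt_trans _ _ (r / 2))//.
      by rewrite (le_trans _ zr)// ler_piMl// enorm_ge0.
    by rewrite ltr_pdivrMr// ltr_pMr// ltr1n.
  have h1 := Hr _ tz z; have h2 := HC0 z.
  rewrite -(subrK (hessform phi z x) (hessform phi z _)) (le_trans (ler_normD _ _))//.
  by rewrite /m mulrDl addrC lerD// mul1r; move: h1; rewrite mul1r.
have lo : phi x + dotv z (grad phi x) + - m / 2 <= phi (x + z).
  by apply: Taylor_line_ge => // t /bd; rewrite ler_norml => /andP[].
have up : - phi x + - dotv z (grad phi x) + - m / 2 <= - phi (x + z).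
  have := @Taylor_ge _ (fun t => - phi (x + t *: z)) (fun t => - dirder phi z (x + t *: z))
    (fun t => - hessform phi z (x + t *: z)) (- m)
    (fun t => is_deriveN (is_derive_dir x z t (Ck1 cphi)))
    (fun t => is_deriveN (is_derive_dir2 x z t cphi)).
  rewrite scale0r addr0 scale1r dirder0; apply => t /bd.
  by rewrite lerN2 ler_norml => /andP[].
have -> : (C0 + 1) / 2 * dotv z z = m / 2 by rewrite /m; field.
by rewrite dotvC ler_norml; apply/andP; split; lra.
Qed.
(** The second difference of the test function up to distance [del], and of the
solution beyond: the integrand of the definition of viscosity solutions. *)
Definition hybrid w phi x th del (t : R) :=
  if t < del then secdiff phi x th t else secdiff w x th t.

(** The values [a e] minus and plus [C e^q] are monotone in opposite directions;
the supremum of the former is the limit, with a rate. *)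
Lemma right_limit (a : R -> R) (C r q : R) : 0 < r -> 0 <= C -> 0 < q ->
  (forall e e', 0 < e -> e <= e' -> e' < r ->
     `|a e - a e'| <= C * (e' `^ q - e `^ q)) ->
  exists l, (forall e, 0 < e < r -> `|a e - l| <= C * e `^ q) /\
            a e @[e --> 0^'+] --> l.
Proof.
move=> r0 C0 q0 H.
pose A := [set a e - C * e `^ q | e in [set e | 0 < e < r]].
have AU e e' : 0 < e < r -> 0 < e' < r -> a e - C * e `^ q <= a e' + C * e' `^ q.
  move=> /andP[e0 er] /andP[e'0 e'r].
  have p1 : 0 <= C * e `^ q by rewrite mulr_ge0// powR_ge0.
  have p2 : 0 <= C * e' `^ q by rewrite mulr_ge0// powR_ge0.
  have [ee|/ltW ee] := leP e e'.
    by have := H _ _ e0 ee e'r; rewrite ler_norml mulrBr => /andP[]; lra.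
  by have := H _ _ e'0 ee er; rewrite ler_norml mulrBr => /andP[]; lra.
have r2 : 0 < r / 2 < r by rewrite divr_gt0//= ltr_pdivrMr// ltr_pMr// ltr1n.
have A0 : A !=set0 by exists (a (r / 2) - C * (r / 2) `^ q), (r / 2).
have uA : has_ubound A.
  by exists (a (r / 2) + C * (r / 2) `^ q) => _ [e er <-]; exact: AU.
have Hl e : 0 < e < r -> `|a e - sup A| <= C * e `^ q.
  move=> er; have h1 : a e - C * e `^ q <= sup A by apply: ub_le_sup => //; exists e.
  have h2 : sup A <= a e + C * e `^ q.
    by apply: ge_sup => // _ [e' e'r <-]; exact: AU.
  by rewrite ler_norml; apply/andP; split; lra.
exists (sup A); split => //.
apply/cvgrPdist_le => e e0.
have [d0 d00 Hd] := powR_small C q0 e0.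
have m0 : 0 < Num.min d0 r by rewrite lt_min d00.
near=> x.
have x0 : 0 < x by near: x; exact: nbhs_right_gt.
have : x < Num.min d0 r by near: x; exact: nbhs_right_lt.
rewrite lt_min => /andP[xd xr].
rewrite distrC (le_trans (Hl x _)) ?x0//.
by apply: Hd; rewrite x0.
Unshelve. all: by end_near. Qed.

(** Taylor's formula bounds the second difference of the test function by
[2 C t^2], so that the principal value exists and the integrals from [e] to
infinity converge to the value of the test at the rate [e^(2-2s)], uniformly in
the direction. *)
Lemma test_value w phi x del : Ck 2 phi -> bdcont w -> 0 < del ->
  exists C r, [/\ 0 <= C, 0 < r & forall th, esphere th -> exists2 l : R,
    (pv_inner s phi x th del + outer s w x th del = l%:E)%E &
    forall e, 0 < e < r -> lingr (hybrid w phi x th del) /\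
      `|Kint s e (hybrid w phi x th del) - l| <= C * e `^ (2 - 2 * s)].
Proof.
move=> cphi bw del0.
have s1 : 0 < 1 - s by rewrite subr_gt0.
have q0 : 0 < 2 - 2 * s by lra.
have [C [r [C0 r0 HT]]] := Taylor_two_sided x cphi.
pose rr := Num.min r del.
have rr0 : 0 < rr by rewrite lt_min r0.
exists (C / (1 - s)), rr; split => //; first exact: divr_ge0 C0 (ltW s1).
move=> th th1.
pose h1 t := phi (x + t *: th) - phi x.
pose h2 t := w (x + t *: th) - w x.
have ch1 : continuous h1.
  apply: continuous_addf; last exact: cst_continuous.
  by apply: continuous_compf; [exact: continuous_line|case: cphi].
have ch2 : continuous h2.
  apply: continuous_addf; last exact: cst_continuous.
  by apply: continuous_compf; [exact: continuous_line|case: bw].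
have mh1 := continuous_measurable_fun ch1.
have mh2 := continuous_measurable_fun ch2.
pose P1 (t : R) := `|t| < del; pose P2 (t : R) := del <= `|t|.
have mP1 : measurable_fun setT P1.
  by apply: measurable_fun_ltr => //; exact: normr_measurable.
have mP2 : measurable_fun setT P2.
  by apply: measurable_fun_ler => //; exact: normr_measurable.
have [B1 B10 HB1] : exists2 B, 0 <= B & forall t, P1 t -> `|h1 t| <= B.
  have K : compact (h1 @` `[- del, del]).
    apply: continuous_compact; first exact: continuous_subspaceT.
    exact: segment_compact.
  have [M [_ HM]] := compact_bounded K.
  exists (`|M| + 1) => // t; rewrite /P1 ltr_norml => /andP[t1 t2].
  apply: HM; first by rewrite (le_lt_trans (ler_norm _))// ltrDl.
  by exists t => //=; rewrite in_itv/= !ltW.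
have [B2 B20 HB2] : exists2 B, 0 <= B & forall t, P2 t -> `|h2 t| <= B.
  have [_ [B HB]] := bw; exists (2 * B).
    by rewrite mulr_ge0// (le_trans _ (HB 0)).
  move=> t _; rewrite (le_trans (ler_normB _ _))// mulr2n mulrDl !mul1r.
  by rewrite lerD.
pose k1 t := if P1 t then h1 t else 0.
pose k2 t := if P2 t then h2 t else 0.
pose g1 t := k1 t + k1 (- t); pose g2 t := k2 t + k2 (- t).
have lg1 : lingr g1 := (integral_sym hs mP1 mh1 HB1 B10 ltr01).1.
have lg2 : lingr g2 := (integral_sym hs mP2 mh2 HB2 B20 ltr01).1.
have in1 e : 0 < e -> (\int[lebesgue_measure]_(tau in
    [set tau : R | (e <= `|tau| < del)%R]) (incr_quot s phi x th tau)%:E =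
    (Kint s e g1)%:E)%E.
  move=> e0; rewrite -(integral_sym hs mP1 mh1 HB1 B10 e0).2.
  by congr integral; apply/seteqP; split => t /=; [move/andP|move=> ?; exact/andP].
have in2 e : 0 < e < del -> outer s w x th del = (Kint s e g2)%:E.
  move=> /andP[e0 ed]; rewrite -(integral_sym hs mP2 mh2 HB2 B20 e0).2.
  congr integral; apply/seteqP; split => t /=; last by case.
  by move=> dt; split => //; rewrite (le_trans (ltW ed)).
have g1b t : 0 <= t <= rr -> `|g1 t| <= 2 * C * t ^+ 2.
  move=> /andP[t0 tr].
  have tC : 0 <= 2 * C * t ^+ 2 by rewrite !mulr_ge0// sqr_ge0.
  rewrite /g1 /k1 /P1 normrN; case: ifP => _; last by rewrite addr0 normr0.
  have trr : t <= r by rewrite (le_trans tr)// ge_min lexx.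
  have := HT (t *: th); have := HT (- t *: th).
  rewrite !enorm_line// normrN (ger0_norm t0) => /(_ trr) + /(_ trr).
  rewrite !(dotvZl, dotvZr) -(enorm_sqr th) th1 expr1n mulr1 mulrNN.
  rewrite /h1 scaleNr !ler_norml => /andP[? ?] /andP[? ?].
  by apply/andP; split; rewrite expr2; lra.
have [l [Hl cl]] : exists l, (forall e, 0 < e < rr ->
    `|Kint s e g1 - l| <= C / (1 - s) * e `^ (2 - 2 * s)) /\
    Kint s e g1 @[e --> 0^'+] --> l.
  apply: right_limit => //; first exact: divr_ge0 C0 (ltW s1).
  move=> e e' e0 ee' e'r.
  have b t : e <= t <= e' -> `|g1 t| <= 2 * C * t ^+ 2.
    move=> /andP[t1 t2]; apply: g1b.
    by rewrite (le_trans (ltW e0))//= (le_trans t2)// ltW.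
  have k1' := @Kint_split_le _ _ hs g1 e e' C hs1 lg1 e0 ee'.
  have k2' := @Kint_split_ge _ _ hs g1 e e' C hs1 lg1 e0 ee'.
  have {}k1' := k1' (fun t te => (andP (etrans (esym (ler_norml _ _)) (b t te))).2).
  have {}k2' := k2' (fun t te => (andP (etrans (esym (ler_norml _ _)) (b t te))).1).
  have E : C / (1 - s) * (e' `^ (2 - 2 * s) - e `^ (2 - 2 * s)) =
    C * ((e' `^ (2 - 2 * s) - e `^ (2 - 2 * s)) / (1 - s)).
    by rewrite mulrAC mulrA.
  by rewrite E ler_norml; apply/andP; split; lra.
have rr2 : 0 < rr / 2 < del.
  rewrite divr_gt0//= (@lt_le_trans _ _ rr)//.
    by rewrite ltr_pdivrMr// ltr_pMr// ltr1n.
  by rewrite ge_min lexx orbT.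
exists (l + Kint s (rr / 2) g2).
  rewrite (in2 _ rr2) EFinD; congr (_ + _)%E.
  rewrite /pv_inner; apply: cvg_lim => //.
  apply: (@cvg_trans _ ((Kint s e g1)%:E @[e --> 0^'+])); last first.
    by apply/fine_cvgP; split; [exact: nearW|exact: cl].
  apply: near_eq_cvg; apply: filterS (nbhs_right_gt (0 : R)) => e e0.
  by rewrite in1.
move=> e /andP[e0 er].
have ed : 0 < e < del.
  by rewrite e0/=; move: er; rewrite lt_min => /andP[].
have hybE t : 0 <= t -> hybrid w phi x th del t = g1 t + g2 t.
  move=> t0; rewrite /hybrid /g1 /g2 /k1 /k2 /P1 /P2 !normrN (ger0_norm t0).
  rewrite /h1 /h2 /secdiff scaleNr.
  by case: ltP => _; ring.
have lh : lingr (hybrid w phi x th del).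
  split.
    apply: measurable_fun_ifT; first exact: measurable_fun_ltr.
      by apply: continuous_measurable_fun; apply: continuous_secdiff; case: cphi.
    by apply: continuous_measurable_fun; apply: continuous_secdiff; case: bw.
  have [_ [A HA]] := lingrD lg1 lg2.
  by exists A => t t0; rewrite hybE//; exact: HA.
split => //.
have -> : Kint s e (hybrid w phi x th del) = Kint s e g1 + Kint s e g2.
  rewrite -KintD//; apply/eqP; rewrite eq_le; apply/andP.
  have lg := lingrD lg1 lg2.
  by split; apply: Kint_le => // t et; rewrite hybE// (le_trans (ltW e0)).
have -> : Kint s e g2 = Kint s (rr / 2) g2.
  by have := in2 _ rr2; rewrite (in2 _ ed) => -[].
by rewrite opprD addrACA subrr addr0; apply: Hl; rewrite e0.
Qed.

End TestValue.

(** * Viscosity inequalities for the opposite function *)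

Section Conversion.
Context {R : realType} {N : nat} (s : R) (hs : 1 / 2 < s) (hs1 : s < 1).
Context (v : 'rV[R]_N -> R) (bv : bdcont v).
Implicit Types (phi : 'rV[R]_N -> R) (x th : 'rV[R]_N).

Let u x := - v x.

Let secdiffu x th t : secdiff u x th t = - secdiff v x th t.
Proof. by rewrite /secdiff /u; ring. Qed.

Let bu : bdcont u.
Proof.
have [cv [B HB]] := bv; split; last by exists B => x; rewrite normrN.
have -> : u = fun x => 0 - v x by apply/funext => x; rewrite sub0r.
exact: continuous_cstB.
Qed.

Let OutN x th d : 0 < d -> Kint s d (fun t => - secdiff v x th t) = - Out s v x th d.
Proof.
move=> d0; rewrite /Out -mulN1r -KintZ//; last exact: lingr_secdiff.
by congr Kint; apply/funext => t; rewrite mulN1r.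
Qed.

Let lingrN x th : lingr (fun t => - secdiff v x th t).
Proof.
have := lingrZ (-1) (lingr_secdiff x th bv).
by congr lingr; apply/funext => t; rewrite mulN1r.
Qed.

Lemma le_of_powR (a b c q : R) r : 0 < q -> 0 < r ->
  (forall e, 0 < e < r -> a <= b + c * e `^ q) -> a <= b.
Proof.
move=> q0 r0 H; apply/ler_addgt0Pr => e e0.
have [d0 d00 Hd] := powR_small c q0 e0.
pose m := Num.min d0 r / 2.
have m1 : 0 < Num.min d0 r by rewrite lt_min d00.
have m0 : 0 < m by exact: divr_gt0.
have : m < Num.min d0 r by rewrite ltr_pdivrMr// ltr_pMr// ltr1n.
rewrite lt_min => /andP[md mr].
apply: le_trans (H m _) _; first by rewrite m0.
by rewrite lerD2l Hd// m0.
Qed.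

Lemma eball_line x th del t : esphere th -> 0 <= t < del ->
  eball x del (x + t *: th) /\ eball x del (x - t *: th).
Proof.
move=> th1 /andP[t0 td]; rewrite /eball /=.
by rewrite !(addrC x) !addrK enormN enorm_line// ger0_norm.
Qed.

(** The test function touches [u] from above, hence on each line its opposite
touches [v] from below along a parabola; compare the hybrid integrand with the
one of [v] and let the inner radius tend to zero. *)
Lemma test_ge phi x del F : Ck 2 phi -> 0 < del -> max_at u phi x del ->
  (forall th, esphere th -> SP s v x th F) ->
  (F%:E <= Lambda1_test s phi u x del)%E.
Proof.
move=> cphi del0 mx HSP.
have q0 : 0 < 2 - 2 * s by have := hs1; lra.
have [C [r [C0 r0 HC]]] := test_value hs hs1 x cphi bu del0.
have [C' [r' [C'0 r'0 HT]]] := Taylor_two_sided x cphi.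
apply: le_ereal_inf_tmp => _ [th th1 <-].
have [l -> Hl] := HC th th1; rewrite lee_fin.
have [r2 [r20 r2r' r2d]] : exists r2, [/\ 0 < r2, r2 <= r' & r2 < del].
  exists (Num.min r' (del / 2)); rewrite lt_min r'0 ge_min lexx gt_min.
  by rewrite divr_gt0// (ltr_pdivrMr _ _ (ltr0n R 2)) ltr_pMr// ltr1n orbT.
have m0 : 0 < Num.min r r2 by rewrite lt_min r0 r20.
apply: (@le_of_powR _ _ (C + C' / (1 - s)) (2 - 2 * s) _ q0 m0) => e /andP[e0].
rewrite lt_min => /andP[er er2].
have [|lh] := Hl e; first by rewrite e0.
rewrite ler_norml => /andP[_ h1].
have h2 : - Out s v x th e <= Kint s e (hybrid u phi x th del).
  rewrite -OutN//; apply: Kint_le => // t et.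
  have t0 : 0 <= t by rewrite (le_trans (ltW e0)).
  rewrite /hybrid; case: ltP => td; last by rewrite secdiffu.
  have [|b1 b2] := @eball_line x th del t th1; first by rewrite t0.
  have := mx _ b1; have := mx _ b2; rewrite /u /secdiff.
  by move: (v _) (v _) (v _) (phi _) (phi _) (phi _) => *; lra.
have h3 : Out s v x th e <= - F + C' * (e `^ (2 - 2 * s) / (1 - s)).
  apply: (HSP th th1 (- dotv (grad phi x) th) C' r2 r20); last by rewrite e0.
  move=> t tr.
  have tr' : `|t| <= r' by exact: le_trans r2r'.
  have td : `|t| < del by exact: le_lt_trans r2d.
  have := HT (t *: th); rewrite enorm_line// => /(_ tr').
  rewrite !(dotvZl, dotvZr) -(enorm_sqr th) th1 expr1n mulr1.
  rewrite ler_norml => /andP[_ hT].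
  have b1 : eball x del (x + t *: th).
    by rewrite /eball /= (addrC x) addrK enorm_line.
  have := mx _ b1; rewrite /u; move: hT.
  by move: (v _) (v _) (phi _) (phi _) (dotv _ _) => *; rewrite expr2; lra.
rewrite mulrDl -mulrA (mulrC _^-1).
by move: h1 h2 h3; move: (Kint _ _ _) (Out _ _ _ _ _) (_ `^ _) => *; lra.
Qed.

(** Dual to [test_ge]; as the direction given by [SB] depends on the inner
radius, the rate in [test_value] has to be uniform over the sphere. *)
Lemma test_le phi x del F : Ck 2 phi -> 0 < del -> min_at u phi x del ->
  SB s v x F -> (Lambda1_test s phi u x del <= F%:E)%E.
Proof.
move=> cphi del0 mn HSB.
have q0 : 0 < 2 - 2 * s by have := hs1; lra.
have [C [r [C0 r0 HC]]] := test_value hs hs1 x cphi bu del0.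
have [C' [r' [C'0 r'0 HT]]] := Taylor_two_sided x cphi.
have [r2 [r20 r2r' r2d]] : exists r2, [/\ 0 < r2, r2 <= r' & r2 < del].
  exists (Num.min r' (del / 2)); rewrite lt_min r'0 ge_min lexx gt_min.
  by rewrite divr_gt0// (ltr_pdivrMr _ _ (ltr0n R 2)) ltr_pMr// ltr1n orbT.
apply/lee_addgt0Pr => eta eta0.
have eta20 : 0 < eta / 2 by exact: divr_gt0.
have [d0 d00 Hd] := powR_small (C + C' / (1 - s)) q0 eta20.
have m0 : 0 < Num.min d0 (Num.min r r2) by rewrite !lt_min d00 r0 r20.
pose e := Num.min d0 (Num.min r r2) / 2.
have e0 : 0 < e by exact: divr_gt0.
have : e < Num.min d0 (Num.min r r2) by rewrite ltr_pdivrMr// ltr_pMr// ltr1n.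
rewrite !lt_min => /and3P[ed er er2].
have touch z : enorm z <= r2 ->
    v (x + z) <= v x + dotv (- grad phi x) z + C' * dotv z z.
  move=> zr; have zr' : enorm z <= r' by exact: le_trans r2r'.
  have := HT z zr'; rewrite ler_norml dotvNl => /andP[hT _].
  have b1 : eball x del (x + z).
    by rewrite /eball /= (addrC x) addrK (le_lt_trans zr).
  have := mn _ b1; rewrite /u; move: hT.
  by move: (v _) (v _) (phi _) (phi _) (dotv _ _) (C' * _) => *; lra.
have er2' : 0 < e < r2 by rewrite e0.
have [th th1 hS] := HSB _ _ _ r20 touch _ _ er2' eta20.
have [l El Hl] := HC th th1.
apply: (@le_trans _ _ l%:E).
  by apply: ereal_inf_lbound; exists th.
rewrite -EFinD lee_fin.
have [|lh] := Hl e; first by rewrite e0.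
rewrite ler_norml => /andP[h1 _].
have h2 : Kint s e (hybrid u phi x th del) <= - Out s v x th e.
  rewrite -OutN//; apply: Kint_le => // t et.
  have t0 : 0 <= t by rewrite (le_trans (ltW e0)).
  rewrite /hybrid; case: ltP => td; last by rewrite secdiffu.
  have [|b1 b2] := @eball_line x th del t th1; first by rewrite t0.
  have := mn _ b1; have := mn _ b2; rewrite /u /secdiff.
  by move: (v _) (v _) (v _) (phi _) (phi _) (phi _) => *; lra.
have := Hd e; rewrite e0 ed => /(_ isT).
rewrite mulrDl -mulrA (mulrC _^-1).
by move: h1 h2 hS; move: (Kint _ _ _) (Out _ _ _ _ _) (_ `^ _) => *; lra.
Qed.

End Conversion.

(** * The eigenvalue problem *)

Lemma continuous_lsc (R : realType) N (f : 'rV[R]_N -> R) : continuous f -> lsc f.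
Proof.
move=> cf x a; rewrite lte_fin => ax.
have /(@cvgr_gt _ _ _)/(_ a ax) H := cf x.
exists [set y | a < f y] => //.
Qed.

Theorem theorem3p1 (R : realType) (N : nat) (Om : set 'rV[R]_N) (s : R)
    (hN : (2 < N)%N) (hOm : bounded_strictly_convex_domain Om)
    (hs : 1 / 2 < s) (hs1 : s < 1) :
  exists (mu1 : R) (phi1 : 'rV[R]_N -> R),
    [/\ 0 < mu1,
        continuous phi1,
        (forall x, Om x -> phi1 x < 0) &
        visc_solution s Om (fun x => mu1 * phi1 x) (fun=> 0) phi1].
Proof.
have N1 : (1 < N)%N by exact: ltnW.
have [[oOm _ Om0] _ _ _] := hOm.
have [rho rho0 [Y [Y0 HY HG]]] := strictly_convex_exterior_balls N1 hOm.
have [mu mu0 [v [bv vpos v0 vSP vSB]]] :=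
  line_eigenfunction hs hs1 (ltnW N1) oOm rho0 Y0 Om0 HY HG.
have [cv [B HB]] := bv.
have cu : continuous (fun x => - v x).
  have -> : (fun x => - v x) = fun x => 0 - v x by apply/funext => x; rewrite sub0r.
  exact: continuous_cstB.
have bu : bounded_fun (fun x => - v x).
  exists B; split; first exact: num_real.
  by move=> M BM x _ /=; rewrite normrN (le_trans (HB x))// ltW.
exists mu, (fun x => - v x); split => //; first by move=> x /vpos; rewrite oppr_lt0.
split; split => //.
- by apply: continuous_lsc => x; under eq_fun do rewrite opprK; exact: cv.
- by move=> x /v0 ->; rewrite oppr0.
- move=> phi x del sphi Ox del0 _ mx.
  rewrite mulrN EFinN leeN2.
  by apply: (test_ge hs hs1 bv (sphi 2) del0 mx) => th; exact: vSP.
- exact: continuous_lsc.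
- by move=> x /v0 ->; rewrite oppr0.
move=> phi x del sphi Ox del0 _ mn.
rewrite mulrN EFinN leeN2.
by apply: (test_le hs hs1 bv (sphi 2) del0 mn); exact: vSB.
Qed.
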